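(* Let $T>0$ and assume: (a) for each $1\le i\le m$, $\mathcal K_i:\mathbb R\times\mathbb R^n\to[0,\infty)$ is continuous with $\mathcal K_i(t,0)>0$ and $\int_{\mathbb R^n}\mathcal K_i(t,x)\,\mathrm dx=1$ for all $t\in\mathbb R$; (b) $g\in C^{0,0,1}(\mathbb R\times\overline\Omega_0\times\mathbb R^m,\mathbb R^m)$; for all $t\ge0$, $x\in\overline\Omega_0$, $u\in\mathbb M$ the matrix $(\partial g_i(t,x,u)/\partial u_j)_{m\times m}$ is cooperative and irreducible; for each $1\le i\le m$, $g_i(t,x,0)=0$, and $g_i(t,x,u)\le0$ whenever $u\in\mathbb M$ with $u_i=v_i$; (c) $\alpha g(t,x,u)<g(t,x,\alpha u)$ for $u\in\mathbb M\cap\mathrm{Int}(\mathbb R^m_+)$, $t\ge0$, $x\in\overline\Omega_0$, $\alpha\in(0,1)$; (d) $\mathcal K_i(t+T,x)=\mathcal K_i(t,x)$ and $g_i(t+T,x,u)=g_i(t,x,u)$ for each $1\le i\le m$. Consider $$\frac{\partial u}{\partial t}=D\int_{\Omega_0}\mathcal K(t,x-y)u(t,y)\,\mathrm dy-Du+g(t,x,u),\quad t>0,\ x\in\overline\Omega_0,\qquad u(0,x)=u_0(x).\qquad(\ast)$$ With $\omega(\Phi)$ the exponential growth bound defined in the context, the following hold: (1) If $\omega(\Phi)<0$, then $0$ is globally asymptotically stable for $(\ast)$ in $X_+^v$. (2) If $\omega(\Phi)=0$ and either $\alpha g(t,x,u)\ll g(t,x,\alpha u)$ for all $u\in\mathbb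 M\cap\mathrm{Int}(\mathbb R^m_+)$, $t\ge0$, $x\in\overline\Omega_0$, $\alpha\in(0,1)$, or $\omega(\Phi)=0$ is the principal eigenvalue (of $L_T$), then $0$ is globally asymptotically stable for $(\ast)$ in $X_+^v$. (3) If $\omega(\Phi)>0$, then $w^\ast$ is globally asymptotically stable for $(\ast)$ in $X_+^v\setminus\{0\}$, where $w^\ast\in\mathrm{Int}(\mathcal C_T^+)$ is the unique positive $T$-periodic solution of the equation in $\tilde X_+^v$.
   Context: $m,n\ge1$ are integers; $\Omega_0\subset\mathbb R^n$ is a bounded, simply connected domain with smooth boundary; $D=\mathrm{diag}\{d_1,\dots,d_m\}$, $d_i>0$. $\mathcal K(t,x-y)u(t,y):=(\mathcal K_1(t,x-y)u_1(t,y),\dots,\mathcal K_m(t,x-y)u_m(t,y))^T$. In $\mathbb R^m$: $a\ge b$ means $a-b\in\mathbb R^m_+$; $a>b$ means $a\ge b$, $a\ne b$; $a\gg b$ means $a-b\in\mathrm{Int}(\mathbb R^m_+)$. $v\in\mathrm{Int}(\mathbb R^m_+)$ is fixed and $\mathbb M=\{u\in\mathbb R^m:0\le u\le v\}$. A matrix is cooperative if its off-diagonal entries are nonnegative. $C^{0,0,1}$: continuous in $(t,x,u)$ with continuous first derivatives in $u$. $X=C(\overline\Omega_0,\mathbb R^m)$ with the sup norm, $X_+^v=\{\varphi\in X:0\le\varphi(x)\le v\}$. $\mathcal C_T$: continuous $u:\mathbb R\times\overline\Omega_0\to\mathbb R^m$ with $u(t+T,x)=u(t,x)$, with the sup norm;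 $\mathcal C_T^+$: its cone of nonnegative functions. $\tilde X$: bounded measurable functions $u:\mathbb R\times\overline\Omega_0\to\mathbb R^m$ (defined everywhere) with $u(t+T,x)=u(t,x)$, with the sup norm; $\tilde X_+^v=\{u\in\tilde X:0\le u(t,x)\le v\}$. $\Phi(t,s)$, $t\ge s$, is the evolution family on $X$ generated by $\frac{\partial u}{\partial t}=D\int_{\Omega_0}\mathcal K(t,x-y)u(t,y)\,\mathrm dy-Du+\left(\frac{\partial g_i(t,x,0)}{\partial u_j}\right)_{m\times m}u$, and $\omega(\Phi)=\inf\{\tilde\omega:\exists M\ge1\text{ such that }\|\Phi(t,s)\|\le Me^{\tilde\omega(t-s)}\ \forall t\ge s\}$. $L_T$ is the operator $[L_Tu](t,x)=-\frac{\partial u}{\partial t}(t,x)+D\int_{\Omega_0}\mathcal K(t,x-y)u(t,y)\,\mathrm dy-Du+\left(\frac{\partial g_i(t,x,0)}{\partial u_j}\right)_{m\times m}u(t,x)$ on $\mathcal C_T$ (domain: functions $C^1$ in $t$); its spectral bound satisfies $s(L_T)=\omega(\Phi)=\frac{\ln r(\Phi(T,0))}{T}$. ''$\omega(\Phi)=0$ is the principal eigenvalue'' means that $0=s(L_T)$ is an eigenvalue of $L_T$ with an eigenfunction in $\mathrm{Int}(\mathcal C_T^+)$. When $\omega(\Phi)>0$, the equation in $(\ast)$, considered for $t\in\mathbb R$, has a unique positive $T$-periodic solution $w^\ast$ in $\tilde X_+^v$ (positive: every component is $>0$ at every $(t,x)$), and $w^\ast\in\mathrm{Int}(\mathcal C_T^+)$.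 Stability. Let $u(t,\cdot;\varphi)$ be the solution with $u(0,\cdot)=\varphi$. A solution $w$ is globally asymptotically stable in $S\subset X$ if $\lim_{t\to\infty}\|u(t,\cdot;\varphi)-w(t,\cdot)\|_X=0$ for all $\varphi\in S$, and for every $\varepsilon>0$ there is $\delta>0$ such that $\varphi\in S$, $\|\varphi-w(0,\cdot)\|_X<\delta$ imply $\|u(t,\cdot;\varphi)-w(t,\cdot)\|_X<\varepsilon$ for all $t\ge0$. *)

(* Defs.v *)
From HB Require Import structures.
From mathcomp Require Import all_boot all_order all_algebra.
From mathcomp Require Import all_classical all_reals all_analysis.

Set Implicit Arguments.
Unset Strict Implicit.
Unset Printing Implicit Defensive.

Import Order.TTheory GRing.Theory Num.Theory.
Import numFieldNormedType.Exports.

Local Open Scope classical_set_scope.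
Local Open Scope ring_scope.

(* Points of R^n are row vectors and values in R^m are column vectors.  A
   function on the closure of Omega (or on R x closure Omega) is represented by
   a total function, of which only the values on that set matter. *)

Section lebesgue.
Context {R : realType}.

(* Lebesgue measure on R^n is built on [n.-tuple], whose sigma-algebra is the
   product (Borel) one; [row_of_tuple] identifies tuples with row vectors. *)
Definition row_of_tuple n (y : n.-tuple (measurableTypeR R)) : 'rV[R]_n :=
  \row_j tnth y j.

Definition tuple_cons n (p : n.-tuple (measurableTypeR R) * measurableTypeR R) :
    n.+1.-tuple (measurableTypeR R) :=
  [the n.+1.-tuple _ of p.2 :: p.1].

Lemma measurable_tuple_cons n : measurable_fun setT (@tuple_cons n).
Proof. by apply: (@measurable_cons _ _ _ _ snd n fst). Qed.

Definition lebesgue_step n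
    (mu : {measure set (n.-tuple (measurableTypeR R)) -> \bar R}) :
    {measure set (n.+1.-tuple (measurableTypeR R)) -> \bar R} :=
  measure_function_pushforward__canonical__measure_function_Measure
    (mu \x (@lebesgue_measure R))%E (@measurable_tuple_cons n).

Fixpoint lebesgue_tuple n :
    {measure set (n.-tuple (measurableTypeR R)) -> \bar R} :=
  match n with
  | 0 => dirac [tuple]
  | n'.+1 => lebesgue_step (lebesgue_tuple n')
  end.

End lebesgue.

Section domains.
Context {R : realType} {n : nat}.
Implicit Types (Omega : set 'rV[R]_n) (rho : 'rV[R]_n -> R).

Fixpoint C_k (k : nat) rho : Prop :=
  continuous rho /\
  if k is k'.+1 then
    forall j : 'I_n, (forall x, derivable rho x (delta_mx 0 j)) /\
                     C_k k' (fun x => 'D_(delta_mx 0 j) rho x)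
  else True.

Definition C_infty rho := forall k, C_k k rho.

(* Near each boundary point, Omega is a strict sublevel set of a smooth function
   with nonzero gradient. *)
Definition smooth_boundary Omega :=
  forall p, (closure Omega `\` interior Omega) p ->
    exists (U : set 'rV[R]_n) rho,
      [/\ nbhs p U, C_infty rho,
          exists j : 'I_n, 'D_(delta_mx 0 j) rho p != 0 &
          forall x, U x -> Omega x <-> rho x < 0].

Definition loop_in Omega (c : R -> 'rV[R]_n) :=
  [/\ {within `[0, 1]%classic, continuous c}, (forall s, 0 <= s <= 1 -> Omega (c s)) &
      c 0 = c 1].

Definition null_homotopic_in Omega (c : R -> 'rV[R]_n) :=
  exists H : R * R -> 'rV[R]_n,
    [/\ {within `[0, 1]%classic `*` `[0, 1]%classic, continuous H},
        forall r s, 0 <= r <= 1 -> 0 <= s <= 1 -> Omega (H (r, s)),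
        forall s, 0 <= s <= 1 -> H (0, s) = c s /\ H (1, s) = c 0 &
        forall r, 0 <= r <= 1 -> H (r, 0) = c 0 /\ H (r, 1) = c 0].

Definition path_connected Omega :=
  forall x y, Omega x -> Omega y -> exists c : R -> 'rV[R]_n,
    [/\ {within `[0, 1]%classic, continuous c}, (forall s, 0 <= s <= 1 -> Omega (c s)),
        c 0 = x & c 1 = y].

Definition simply_connected Omega :=
  path_connected Omega /\
  forall c, loop_in Omega c -> null_homotopic_in Omega c.

Definition domain Omega := [/\ open Omega, connected Omega & Omega !=set0].

End domains.

Section cones_and_matrices.
Context {R : realType} {m : nat}.
Implicit Types (a b : 'cV[R]_m) (A : 'M[R]_m).

(* R^m_+ *)
Definition orthant : set 'cV[R]_m := [set a | forall i, 0 <= a i 0].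

Definition vle a b := orthant (b - a).
Definition vlt a b := vle a b /\ a <> b.
Definition vll a b := orthant° (b - a).

Definition order_interval (v : 'cV[R]_m) : set 'cV[R]_m :=
  [set u | vle 0 u /\ vle u v].

Definition cooperative A := forall i j, i != j -> 0 <= A i j.

(* With this convention every 1 x 1 matrix is irreducible. *)
Definition irreducible A :=
  forall I : {set 'I_m}, I != finset.set0 -> I != [set: 'I_m]%SET ->
    exists i j, [/\ i \in I, j \notin I & A i j != 0].

(* Jacobian matrix of [f], row index = component, column index = variable. *)
Definition dmx (f : 'cV[R]_m -> 'cV[R]_m) (u : 'cV[R]_m) : 'M[R]_m :=
  \matrix_(i, j) 'D_(delta_mx j 0) (fun z => f z i 0) u.

(* Sup norm over a set; [`|_|] is the max norm of R^m. *)
Definition supnorm T (A : set T) (f : T -> 'cV[R]_m) : R :=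
  sup [set `|f x| | x in A].

End cones_and_matrices.

Section equation.
Context {R : realType} {m n : nat}.
Variables (Omega : set 'rV[R]_n) (K : 'I_m -> R -> 'rV[R]_n -> R)
  (d v : 'cV[R]_m).

Local Notation space := ('rV[R]_n).
Local Notation state := ('cV[R]_m).
Local Notation field := (R -> 'rV[R]_n -> 'cV[R]_m).

Implicit Types (phi : space -> state) (u w : field)
  (F g : R -> space -> state -> state).

Definition cylinder : set (R * space) := [set p | closure Omega p.2].

Definition C00_1 g :=
  [/\ {within [set p : R * space * state | closure Omega p.1.2],
        continuous (fun p => g p.1.1 p.1.2 p.2)},
      forall t x z i j, closure Omega x ->
        derivable (fun z' => g t x z' i 0) z (delta_mx j 0) &
      {within [set p : R * space * state | closure Omega p.1.2],
        continuous (fun p => dmx (g p.1.1 p.1.2) p.2)}].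

(* The spaces X, X_+^v, C_T, C_T^+, Int (C_T^+). *)
Definition X_space : set (space -> state) :=
  [set phi | {within closure Omega, continuous phi}].

Definition X_interval : set (space -> state) :=
  [set phi | X_space phi /\
     forall x, closure Omega x -> order_interval v (phi x)].

Definition time_periodic (T : R) u :=
  forall t x, closure Omega x -> u (t + T) x = u t x.

Definition C_per (T : R) : set field :=
  [set u : field | {within cylinder, continuous (fun p => u p.1 p.2)} /\
     time_periodic T u].

Definition C_per_cone (T : R) : set field :=
  [set u : field | C_per T u /\ forall t x, closure Omega x -> vle 0 (u t x)].

Definition C_per_cone_interior (T : R) : set field :=
  [set u : field | C_per_cone T u /\ exists2 e, 0 < e &
     forall w, C_per T w ->
       supnorm cylinder (fun p => w p.1 p.2 - u p.1 p.2) < e ->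
       C_per_cone T w].

(* The space of bounded, T-periodic, Borel measurable functions. *)
Definition B_per (T : R) : set field :=
  [set u : field | [/\
     forall i, measurable_fun
       [set p : measurableTypeR R * n.-tuple (measurableTypeR R) |
          closure Omega (row_of_tuple p.2)]
       (fun p => u p.1 (row_of_tuple p.2) i 0 : measurableTypeR R),
     exists M, forall t x, closure Omega x -> `|u t x| <= M &
     time_periodic T u]].

Definition B_per_interval (T : R) : set field :=
  [set u : field | B_per T u /\
     forall t x, closure Omega x -> order_interval v (u t x)].

Definition convol u t (x : space) : state :=
  \col_i \int[lebesgue_tuple n]_(y in @row_of_tuple R n @^-1` Omega)
    (K i t (x - row_of_tuple y) * u t (row_of_tuple y) i 0).

Definition dispersal u t x : state :=
  diag_mx d^T *m convol u t x - diag_mx d^T *m u t x.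

Definition satisfies_at F u (t : R) (x : space) :=
  is_derive t (1 : R) (fun tau : R => u tau x) (dispersal u t x + F t x (u t x)).

(* Solutions are jointly continuous on [s, +oo[ x closure Omega; the equation
   then makes them C^1 as functions of time with values in X. *)
Definition is_solution F (s : R) phi u :=
  [/\ {within [set p : R * space | s <= p.1 /\ closure Omega p.2],
        continuous (fun p => u p.1 p.2)},
      forall x, closure Omega x -> u s x = phi x &
      forall t x, s < t -> closure Omega x -> satisfies_at F u t x].

(* The solution with value [phi] at time [s]. *)
Definition solution F (s : R) phi : field :=
  xget (fun _ _ => 0) (is_solution F s phi).

Definition linear_part g : R -> space -> state -> state :=
  fun t x z => dmx (g t x) 0 *m z.

(* The evolution family Phi(t, s) of the linearized equation. *)
Definition Phi g (t s : R) (phi : space -> state) : space -> state :=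
  solution (linear_part g) s phi t.

Definition growth_rate g (w : R) :=
  exists2 M : R, 1 <= M & forall t s phi, s <= t -> X_space phi ->
    supnorm (closure Omega) (Phi g t s phi) <=
      M * expR (w * (t - s)) * supnorm (closure Omega) phi.

Definition omega_Phi g : \bar R := ereal_inf (EFin @` growth_rate g).

Definition dom_L (T : R) : set field :=
  [set u : field | [/\ C_per T u,
     forall t x, closure Omega x -> derivable (fun tau : R => u tau x) t 1 &
     C_per T (fun t x => 'D_1 (fun tau : R => u tau x) t)]].

Definition L_op g u : field := fun (t : R) (x : space) =>
  - 'D_1 (fun tau : R => u tau x) t + dispersal u t x + linear_part g t x (u t x).

(* That [lambda] is the spectral bound of L_T is not part of this definition:
   that bound is always [omega_Phi]. *)
Definition has_positive_eigenfunction g (T lambda : R) :=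
  exists psi, [/\ dom_L T psi, C_per_cone_interior T psi &
    forall t x, closure Omega x -> L_op g psi t x = lambda *: psi t x].

Definition positive_periodic_solution g (T : R) w :=
  [/\ B_per_interval T w,
      forall t x, closure Omega x -> forall i, 0 < w t x i 0 &
      forall t x, closure Omega x -> satisfies_at g w t x].

Definition unique_positive_periodic_solution g (T : R) w :=
  positive_periodic_solution g T w /\
  forall w', positive_periodic_solution g T w' ->
    forall t x, closure Omega x -> w' t x = w t x.

Definition globally_asymptotically_stable g (S : set (space -> state)) w :=
  let dist phi t :=
    supnorm (closure Omega) (fun x => solution g 0 phi t x - w t x) in
  (forall phi, S phi -> dist phi t @[t --> +oo] --> (0 : R)) /\
  (forall e, 0 < e -> exists2 delta, 0 < delta & forall phi, S phi ->
     supnorm (closure Omega) (fun x => phi x - w 0 x) < delta ->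
     forall t, 0 <= t -> dist phi t < e).

End equation.

(* Main.v *)
Require Import Defs.
From HB Require Import structures.
From mathcomp Require Import all_boot all_order all_algebra.
From mathcomp Require Import all_classical all_reals all_analysis.
From mathcomp Require Import measurable_realfun ring lra.

Set Implicit Arguments.
Unset Strict Implicit.
Unset Printing Implicit Defensive.

Import Order.TTheory GRing.Theory Num.Theory.
Import numFieldNormedType.Exports.

Local Open Scope classical_set_scope.
Local Open Scope ring_scope.

(** The equation generates a monotone semiflow, sublinear in the initial value,
    and each case compares orbits with explicit sub- and supersolutions.

    Comparison.  Cooperativity makes the kinetics quasi-monotone: a component of
    [g] can drop only in proportion to how far one state lies below the other.
    The nonlocal term averages against a nonnegative kernel of mass at most one,
    so a difference of solutions obeys a one-sided estimate at all points and
    components simultaneously, and [comparison_principle] applies; it yields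
    [flow_monotone], while sublinearity places the orbits below those of the
    linearised equation ([flow_le_linear_flow]).  A negative growth bound
    therefore gives exponential decay at once.

    Zero growth bound.  Since the flow has no smoothing effect in space, orbits
    need not be precompact.  The orbit of the top state [v] decreases along the
    period map, and its pointwise limit [U] is merely measurable in space, but
    it still is a [T]-periodic solution, because solutions are equicontinuous in
    time ([limit_solution]).  Once [U = 0], Dini's theorem makes the decay
    uniform, and all other orbits lie below.  A strong maximum principle for
    measurable supersolutions replaces compactness: where all components vanish
    at an interior time, the time derivative vanishes too, hence so does the
    inflow; the mass of the solution near [x] depends continuously on [x], and
    its zero set is open and closed in the connected domain
    ([supersolution_dichotomy]).
    If there is a positive eigenfunction, the least multiple of it above [U]
    would have to touch [U], against strict sublinearity
    ([zero_limit_of_eigenfunction]).  If sublinearity is strict in every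
    component, a nonzero [U] is bounded below on the whole domain or on a single
    isolated fibre ([persistent_part]); there [g] lies below its linearisation by
    a uniform margin, so [exp (eps t) U] is a subsolution of the linear equation
    and contradicts the growth bound ([zero_limit_of_strict_sublinearity]).

    Positive growth bound.  The orbit of [v] decreases and that of a small
    multiple of [w 0] increases along the period map.  Both limits are positive
    periodic solutions, so they equal [w] by uniqueness, and Dini's theorem makes
    the convergence uniform.  Every nonzero orbit is positive after one period
    ([flow_positive]), hence caught between the two.  Stability holds because
    sublinearity keeps an orbit between the multiples of [w] that enclose its
    initial value ([flow_scale_le]). *)

(** * Continuity on compact sets *)

Section EpsilonDelta.
Context {R : realType}.

Lemma within_continuous_epsP (U : pseudoMetricType R) (A : set U) (f : U -> R) :
  {within A, continuous f} <->
  forall x, A x -> forall e, 0 < e -> exists2 r, 0 < r &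
    forall y, A y -> ball x r y -> `|f x - f y| < e.
Proof.
rewrite subspace_continuousP; split=> cf x Ax.
- move=> e e0; have /cvgrPdist_lt /(_ e e0) := cf x Ax.
  by rewrite /prop_near1 /within /= => /nbhs_ballP[r /= r0 h]; exists r => // y Ay /h; apply.
- apply/cvgrPdist_lt => e e0; have [r r0 h] := cf x Ax e e0.
  by apply/nbhs_ballP; exists r => //= y xy Ay; exact: h.
Qed.

Lemma compact_uniform_continuity (U : pseudoMetricType R) (A : set U) (f : U -> R) :
  compact A -> {within A, continuous f} -> forall e, 0 < e ->
  exists2 r, 0 < r & forall x y, A x -> A y -> ball x r y -> `|f x - f y| < e.
Proof.
move=> cA /within_continuous_epsP cf e e0.
have e20 : 0 < e / 2 by rewrite divr_gt0.
have : \forall r \near (0 : R)^'+, A `<=`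
    (fun x => forall y, A x -> A y -> ball x r y -> `|f x - f y| < e).
  move/compact_near_coveringP : cA; apply => x Ax.
  have [r r0 h] := cf x Ax _ e20.
  exists (ball x (r / 2), [set s : R | 0 < s < r / 2]).
    split; first by apply: nbhsx_ballx; rewrite divr_gt0.
    near=> s; apply/andP; split; near: s; first exact: nbhs_right_gt.
    by apply: nbhs_right_lt; rewrite divr_gt0.
  move=> [x' s] /= [xx' /andP[s0 sr]] y Ax' Ay x'y.
  have xy : ball x r y.
    by apply: (@ball_splitl _ _ x') => //; apply/ball_sym; apply: le_ball x'y; exact: ltW.
  rewrite (_ : f x' - f y = (f x' - f x) + (f x - f y)); last by ring.
  apply: le_lt_trans (ler_normD _ _) _; rewrite [ltRHS]splitr ltrD //.
    by rewrite distrC h //; apply: le_ball xx'; lra.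
  exact: h.
move=> near_r.
have : \forall r \near (0 : R)^'+, 0 < r /\ A `<=`
    (fun x => forall y, A x -> A y -> ball x r y -> `|f x - f y| < e).
  by near=> r; split; near: r => //; exact: nbhs_right_gt.
move=> /filter_ex[r [r0 h]]; exists r => // x y Ax Ay; exact: h.
Unshelve. all: by end_near. Qed.

Lemma compact_within_bounded (U : topologicalType) (V : normedModType R) (A : set U) (f : U -> V) :
  compact A -> {within A, continuous f} -> exists2 B, 0 <= B & forall x, A x -> `|f x| <= B.
Proof.
move=> cA cf; have [->|A0] := eqVneq A set0; first by exists 0.
have /set0P A0' := A0.
have cf' : {within A, continuous (fun x => `|f x|)}.
  by move=> x; apply: cvg_norm; exact: cf.
have [c cA' hc] := compact_EVT_max A0' cA cf'.
by exists `|f c| => // x Ax; apply: hc; rewrite inE.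
Qed.

(** Dini: pointwise smallness of a decreasing sequence spreads to neighbourhoods
    because later terms are smaller still. *)
Lemma dini_decreasing (U : topologicalType) (A : set U) (f : nat -> U -> R) (e : R) :
  compact A -> (forall k, {within A, continuous f k}) ->
  (forall k x, A x -> f k.+1 x <= f k x) ->
  (forall x, A x -> exists k, f k x < e) ->
  exists k0, forall k x, (k0 <= k)%N -> A x -> f k x < e.
Proof.
move=> cA cf fdec fe.
have fmono j k x : A x -> (j <= k)%N -> f k x <= f j x.
  move=> Ax /subnK <-; elim: (k - j)%N => [|p IHp]; first by rewrite add0n.
  by rewrite addSn (le_trans (fdec _ _ Ax)).
have : \forall k \near \oo, A `<=` (fun x => A x -> f k x < e).
  move/compact_near_coveringP : cA; apply => x Ax.
  have [j fj] := fe x Ax.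
  have : f j @ within A (nbhs x) --> f j x.
    by have := cf j; rewrite subspace_continuousP; apply.
  move=> /cvgr_lt /(_ _ fj); rewrite /prop_near1 /within /= => nx.
  exists ([set x' | A x' -> f j x' < e], [set k | (j <= k)%N]).
    by split => //; exists j.
  by move=> [x' k] /= [h jk] Ax'; rewrite (le_lt_trans (fmono _ _ _ Ax' jk)) ?h.
move=> [k0 _ hk0]; exists k0 => k x k0k Ax; exact: (hk0 k).
Qed.

End EpsilonDelta.

(** * Barriers and comparison *)

Section ScalarDerivatives.
Context {R : realType}.
Implicit Types (q dq : R -> R).

(** A function cannot enter the negative reals where its derivative is
    nonnegative: apply the mean value theorem after the last nonnegative time. *)
Lemma barrier_ge0 q dq (t1 : R) : 0 <= t1 ->
  {within `[0, t1]%classic, continuous q} ->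
  (forall t : R, 0 < t < t1 -> is_derive t (1 : R) q (dq t)) ->
  0 <= q 0 -> (forall t : R, 0 < t < t1 -> q t <= 0 -> 0 <= dq t) ->
  0 <= q t1.
Proof.
move=> t10 cq dqP q0 dq0; rewrite leNgt; apply/negP => qt1.
pose S : set R := [set t | 0 <= t <= t1 /\ 0 <= q t].
have S0 : S 0 by split; rewrite ?lexx.
have ubS : ubound S t1 by move=> t [/andP[]].
have hsS : has_sup S by split; [exists 0 | exists t1].
pose t0 := sup S.
have t0t1 : t0 <= t1 by apply: sup_le_ub => //; exists 0.
have t00 : 0 <= t0 by apply: ub_le_sup => //; exists t1.
have /within_continuous_epsP cqe := cq.
have t0I : `[0, t1]%classic t0 by rewrite /= in_itv /= t00 t0t1.
have qt0 : 0 <= q t0.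
  rewrite leNgt; apply/negP => qt0.
  have [r r0 h] := cqe t0 t0I (- q t0) ltac:(lra).
  have [s [/andP[s0 st1] qs] ss] := sup_adherent r0 hsS.
  have st0 : s <= t0 by apply: ub_le_sup; [exists t1 | split => //; apply/andP].
  have := h s; rewrite /= in_itv /= s0 st1 => /(_ isT).
  have rb : ball t0 r s by rewrite /ball /= /ball_ /= ger0_norm; rewrite -/t0 in ss; lra.
  move=> /(_ rb); rewrite distrC => /(le_lt_trans (ler_norm _)); lra.
have t0lt : t0 < t1.
  rewrite lt_neqAle t0t1 andbT; apply/eqP => E; move: qt1; rewrite -E; lra.
have qneg t : t0 < t -> t <= t1 -> q t < 0.
  move=> t0t tt1; rewrite ltNge; apply/negP => qt.
  have : t <= t0 by apply: ub_le_sup; [exists t1 | split => //; apply/andP; split; lra].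
  lra.
have [|||c] := @MVT R q dq t0 t1 => //.
- by move=> x; rewrite in_itv /= => /andP[a b]; apply: dqP; apply/andP; split; lra.
- apply: continuous_subspaceW cq => x /=; rewrite !in_itv /= => /andP[a b].
  by apply/andP; split; lra.
rewrite in_itv /= => /andP[a b] E.
have : 0 <= dq c * (t1 - t0).
  apply: mulr_ge0; last lra.
  by apply: dq0; [apply/andP; split; lra | apply/ltW/qneg; lra].
lra.
Qed.

(** The index set carries no structure: it gathers the points of space, the
    components, and (for two-sided estimates) a sign.  The exponential weight
    beats the Lipschitz constant, so no minimum need be attained. *)
Lemma comparison_principle (I : Type) (tau L B : R) (z dz : R -> I -> R) : 0 <= L ->
  (forall a, {within `[0, tau]%classic, continuous (z^~ a)}) ->
  (forall (t : R) a, 0 < t < tau -> is_derive t (1 : R) (z^~ a) (dz t a)) ->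
  (forall (t : R) a, 0 <= t <= tau -> - B <= z t a) ->
  (forall a, 0 <= z 0 a) ->
  (forall (t N : R) a, 0 < t < tau -> 0 <= N -> (forall b, - N <= z t b) ->
     z t a <= 0 -> - (L * N) <= dz t a) ->
  forall (t : R) a, 0 <= t <= tau -> 0 <= z t a.
Proof.
move=> L0 cz zP zB z0 zdz t2 a2 t2I; rewrite leNgt; apply/negP => zneg.
(* with this rate the barrier [- N / 2 * expR (y * t)] falls faster than [z] can *)
pose y := 2 * L + 1.
pose w t a := - z t a * expR (- (y * t)).
pose S := [set r : R | exists (t : R) a, 0 <= t <= tau /\ r = w t a].
have wle (t : R) a : 0 <= t <= tau -> w t a <= Num.max B 0.
  move=> tI; have /andP[t0 _] := tI; have e1 : expR (- (y * t)) <= 1.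
    by rewrite -expR0 ler_expR oppr_le0 mulr_ge0 // /y; lra.
  have e0 : 0 <= expR (- (y * t)) by exact: expR_ge0.
  have := zB t a tI; rewrite /w => zb.
  have [zn|zp] := leP 0 (- z t a).
    apply: le_trans (ler_piMr zn e1) _; rewrite le_max; apply/orP; left; lra.
  apply: (@le_trans _ _ 0); last by rewrite le_max lexx orbT.
  by rewrite pmulr_lle0 ?expR_gt0 //; lra.
have hS : has_sup S.
  split; first by exists (w t2 a2), t2, a2.
  by exists (Num.max B 0) => r [t [a [tI ->]]]; exact: wle.
pose N := sup S.
have wN (t : R) a : 0 <= t <= tau -> w t a <= N.
  by move=> tI; apply: ub_le_sup; [case: hS | exists t, a].
have N0 : 0 < N.
  by apply: lt_le_trans (wN _ a2 t2I); rewrite /w mulr_gt0 ?expR_gt0 //; lra.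
have [|r [t1 [a [t1I ->]]] Nw] := @sup_adherent _ S (N / 2) _ hS; first lra.
rewrite -/N in Nw.
have zN (t : R) b : 0 <= t <= tau -> - (N * expR (y * t)) <= z t b.
  move=> tI; have := wN t b tI; rewrite /w expRN -lerNl => h.
  by rewrite -ler_pdivrMr ?expR_gt0 // in h *; lra.
have /andP[t10 t1tau] := t1I.
pose q t := z t a + N / 2 * expR (y * t).
pose dq t := dz t a + N / 2 * (y * expR (y * t)).
have : 0 <= q t1.
  apply: (@barrier_ge0 q dq) => //.
  - move=> x; apply: cvgD.
      by move: x; apply: continuous_subspaceW (cz a); apply: subset_itvl; rewrite bnd_simp.
    move: x; apply: continuous_subspaceT => x.
    apply: cvgM; first exact: cvg_cst.
    apply: (@continuous_comp _ _ _ (fun t => y * t) expR); last exact: continuous_expR.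
    by apply: cvgM; [exact: cvg_cst | exact: cvg_id].
  - move=> t /andP[t0 tt1].
    have := zP t a ltac:(apply/andP; split; lra) => zP'.
    rewrite /q /dq; apply: is_deriveD.
    have -> : N / 2 * (y * expR (y * t)) = (N / 2) *: (expR (y * t) *: (y * 1)).
      by rewrite /GRing.scale /=; ring.
    apply: is_deriveZ.
  - rewrite /q mulr0 expR0; have := z0 a; lra.
  - move=> t /andP[t0 tt1] qt; rewrite /dq.
    have E := expR_gt0 (y * t).
    have NE : 0 < N * expR (y * t) by rewrite mulr_gt0.
    have tI : 0 < t < tau by apply/andP; split; lra.
    have tI' : 0 <= t <= tau by apply/andP; split; lra.
    have := zdz t (N * expR (y * t)) a tI (ltW NE) (fun b => zN t b tI').
    have zle : z t a <= 0.
      have : 0 <= N / 2 * expR (y * t) by rewrite mulr_ge0; lra.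
      move: qt; rewrite /q; lra.
    move=> /(_ zle); set E' := expR _ in NE E * => h.
    have -> : N / 2 * (y * E') = L * (N * E') + N * E' / 2 by rewrite /y; field.
    lra.
move: Nw; rewrite /w expRN; set E := expR _.
have E0 : 0 < E := expR_gt0 _.
rewrite ltr_pdivlMr // /q -/E; lra.
Qed.

End ScalarDerivatives.

(** * Lebesgue measure on tuples *)

Section LebesgueTuple.
Context {R : realType}.
Local Notation mR := (measurableTypeR R).

Lemma measurable_lebesgue_reflect (a : R) :
  measurable_fun setT ((fun s => a - s) : mR -> mR).
Proof. by apply: measurable_funB => //; exact: measurable_cst. Qed.

Lemma lebesgue_measure_reflect (a : R) (A : set mR) : measurable A ->
  lebesgue_measure ((fun s => a - s) @^-1` A) = lebesgue_measure A.
Proof.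
move=> mA.
have [m mE] : exists m : {measure set mR -> \bar R},
    forall B, m B = pushforward lebesgue_measure ((fun s => a - s) : mR -> mR) B.
  exists (measure_function_pushforward__canonical__measure_function_Measure
    (@lebesgue_measure R) (measurable_lebesgue_reflect a)); by [].
rewrite -[LHS]/(pushforward lebesgue_measure ((fun s => a - s) : mR -> mR) A) -mE.
apply/esym/lebesgue_measure_unique => //= _ [[p q]] _ <-.
rewrite mE /pushforward.
rewrite (_ : _ @^-1` _ = `[a - q, a - p[%classic); last first.
  apply/seteqP; split=> s /=; rewrite !in_itv /= => /andP[h1 h2].
    by apply/andP; split; lra.
  by apply/andP; split; lra.
rewrite !lebesgue_measure_itv/= !lte_fin.
rewrite (_ : (a - q < a - p) = (p < q)); last by apply/idP/idP; lra.
by case: ifP => // _; rewrite -!EFinB; congr (_%:E); ring.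
Qed.

Lemma row_of_tupleE n (y : n.-tuple mR) j : row_of_tuple y 0 j = tnth y j.
Proof. by rewrite mxE. Qed.

Definition tuple_reflect n (x : 'rV[R]_n) (y : n.-tuple mR) : n.-tuple mR :=
  [tuple x 0 i - tnth y i | i < n].

Lemma row_of_tuple_reflect n (x : 'rV[R]_n) y :
  row_of_tuple (tuple_reflect x y) = x - row_of_tuple y.
Proof. by apply/rowP => j; rewrite !mxE tnth_mktuple. Qed.

Lemma measurable_tuple_reflect n (x : 'rV[R]_n) :
  measurable_fun setT (tuple_reflect x).
Proof.
apply/measurable_fun_tnthP => i.
rewrite (_ : _ \o _ = (fun y => x 0 i - tnth y i)); last first.
  by apply/funext => y /=; rewrite tnth_mktuple.
apply: measurable_funB; first exact: measurable_cst.
exact: measurable_tnth.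
Qed.

Lemma tuple_consE n (p : n.-tuple mR * mR) (i : 'I_n.+1) :
  tnth (tuple_cons p) i = if unlift ord0 i is Some j then tnth p.1 j else p.2.
Proof.
case: unliftP => [j ->|->]; first by rewrite tnthS; congr tnth; exact/val_inj.
by rewrite /tnth.
Qed.

Lemma tuple_reflect_cons n (x : 'rV[R]_n.+1) (y : n.-tuple mR) (s : mR) :
  tuple_reflect x (tuple_cons (y, s)) =
  tuple_cons (tuple_reflect (\row_j x 0 (lift ord0 j)) y, x 0 ord0 - s).
Proof.
apply/eq_from_tnth => i; rewrite tnth_mktuple !tuple_consE.
by case: unliftP => [j ->|->] //=; rewrite tnth_mktuple mxE.
Qed.

Lemma lebesgue_tupleS n (A : set (n.+1.-tuple mR)) :
  lebesgue_tuple n.+1 A =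
  (\int[lebesgue_tuple n]_y
     lebesgue_measure (xsection (@tuple_cons R n @^-1` A) y))%E.
Proof. by []. Qed.

(** Slicing along the first coordinate reduces the claim to reflections of the
    line and a change of variables in the remaining coordinates. *)
Lemma lebesgue_tuple_reflect n (x : 'rV[R]_n) (A : set (n.-tuple mR)) :
  measurable A -> lebesgue_tuple n (tuple_reflect x @^-1` A) = lebesgue_tuple n A.
Proof.
elim: n => [|n IH] in x A *.
  move=> mA /=; rewrite /dirac /=; congr ((_ : R)%:E).
  rewrite !indicE; congr (_%:R); congr nat_of_bool.
  by apply/idP/idP; rewrite !inE /= (tuple0 (tuple_reflect _ _)).
move=> mA; rewrite !lebesgue_tupleS.
pose x' : 'rV[R]_n := \row_j x 0 (lift ord0 j).
pose B := @tuple_cons R n @^-1` A.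
have mB : measurable B by rewrite -[B]setTI; exact: measurable_tuple_cons.
pose G y := lebesgue_measure (xsection B y).
have mG : measurable_fun setT G by exact: measurable_fun_xsection.
transitivity (\int[lebesgue_tuple n]_y (G \o tuple_reflect x') y)%E.
  apply: eq_integral => y _.
  rewrite -[RHS]/(G (tuple_reflect x' y)) /G.
  rewrite -[RHS](@lebesgue_measure_reflect (x 0 ord0)); last exact: measurable_xsection.
  congr lebesgue_measure; apply/seteqP; split=> s /=.
    by rewrite /xsection /= !inE /B /= tuple_reflect_cons.
  by rewrite /xsection /= !inE /B /= tuple_reflect_cons.
rewrite -[RHS]/(\int[lebesgue_tuple n]_y G y)%E.
rewrite -[X in integral _ X _](@preimage_setT _ _ (tuple_reflect x')).
rewrite -ge0_integral_pushforward //; last exact: measurable_tuple_reflect.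
apply: eq_measure_integral; first exact: measurable_tuple_reflect.
by move=> mr C mC _; exact: IH.
Qed.

Lemma ge0_integral_tuple_reflect n (x : 'rV[R]_n) (f : n.-tuple mR -> \bar R) :
  measurable_fun setT f -> (forall y, 0 <= f y)%E ->
  (\int[lebesgue_tuple n]_y f (tuple_reflect x y) =
   \int[lebesgue_tuple n]_y f y)%E.
Proof.
move=> mf f0; rewrite -[LHS]/(\int[lebesgue_tuple n]_y (f \o tuple_reflect x) y)%E.
rewrite -[X in integral _ X _](@preimage_setT _ _ (tuple_reflect x)).
rewrite -ge0_integral_pushforward //; last exact: measurable_tuple_reflect.
apply: eq_measure_integral; first exact: measurable_tuple_reflect.
by move=> mr C mC _; exact: lebesgue_tuple_reflect.
Qed.

Definition tuple_box n (c : 'rV[R]_n) (r : R) : set (n.-tuple mR) :=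
  [set y | forall i, `|tnth y i - c 0 i| < r].

Lemma measurable_tuple_box n (c : 'rV[R]_n) r : measurable (tuple_box c r).
Proof.
rewrite (_ : tuple_box c r =
    \bigcap_(i in [set: 'I_n]) (@tnth n mR ^~ i @^-1` `]c 0 i - r, c 0 i + r[%classic)).
  apply: fin_bigcap_measurable => [|i _]; first exact: finite_finset.
  by rewrite -[X in measurable X]setTI; apply: measurable_tnth.
apply/seteqP; split=> y /= h i.
  move=> _ /=; have := h i; rewrite in_itv /= ltr_norml => /andP[h1 h2].
  by apply/andP; split; lra.
have := h i I; rewrite /= in_itv /= ltr_norml => /andP[h1 h2].
by apply/andP; split; lra.
Qed.

Lemma lebesgue_tuple_box n (c : 'rV[R]_n) r : 0 < r ->
  lebesgue_tuple n (tuple_box c r) = ((2 * r) ^+ n)%:E.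
Proof.
move=> r0; elim: n => [|n IH] in c *.
  by rewrite /= /dirac /= indicE mem_set //; case.
pose c' : 'rV[R]_n := \row_j c 0 (lift ord0 j).
rewrite -[LHS]/((lebesgue_tuple n \x @lebesgue_measure R)%E
  (@tuple_cons R n @^-1` tuple_box c r)).
rewrite (_ : _ @^-1` _ = tuple_box c' r `*` `]c 0 ord0 - r, c 0 ord0 + r[%classic); last first.
  apply/seteqP; split=> -[y s] /=.
    move=> h; split=> [i|].
      have := h (lift ord0 i); rewrite tuple_consE liftK /= mxE; exact.
    have := h ord0; rewrite tuple_consE unlift_none /= in_itv /= ltr_norml => /andP[h1 h2].
    by apply/andP; split; lra.
  rewrite in_itv /= => -[h /andP[h1 h2]] i; rewrite tuple_consE.
  case: unliftP => [j ->|->] /=; first by have := h j; rewrite mxE.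
  by rewrite ltr_norml; apply/andP; split; lra.
rewrite product_measure1E //; last exact: measurable_tuple_box.
rewrite IH [X in (_ * X)%E]lebesgue_measure_itv /= lte_fin ifT; last lra.
by rewrite -EFinD -EFinM exprSr; congr (_%:E); congr (_ * _); ring.
Qed.

Definition time_space n (p : mR * n.-tuple mR) : R * 'rV[R]_n :=
  (p.1, row_of_tuple p.2).

(** Rational cubes form a countable base, and cubes are measurable. *)
Lemma measurable_time_space_open n (U : set (R * 'rV[R]_n)) : open U ->
  measurable (@time_space n @^-1` U).
Proof.
move=> oU.
pose cube (q : rat) (c : 'rV[rat]_n) (rho : R) : set (mR * n.-tuple mR) :=
  `]ratr q - rho, ratr q + rho[%classic `*` tuple_box (\row_j ratr (c 0 j)) rho.
pose D := [set i : rat * 'rV[rat]_n * nat |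
  cube i.1.1 i.1.2 (i.2.+1%:R^-1) `<=` @time_space n @^-1` U].
suff -> : @time_space n @^-1` U = \bigcup_(i in D) cube i.1.1 i.1.2 (i.2.+1%:R^-1).
  rewrite bigcup_mkcond; apply: countable_bigcupT_measurable; first exact: countableP.
  move=> [[q c] k] /=; case: ifP => // _; apply: measurableX; first exact: measurable_itv.
  exact: measurable_tuple_box.
apply/seteqP; split=> [[t y] /= Uty|p [i Di /Di]] //.
have /nbhs_ballP[e /= e0 he] : nbhs (t, row_of_tuple y) U by exact: open_nbhs_nbhs.
have [k [rho [rhoE rho0 ke]]] : exists (k : nat) (rho : R),
    [/\ rho = k.+1%:R^-1, 0 < rho & 2 * rho < e].
  have e20 : 0 < e / 2 by rewrite divr_gt0.
  have [k _ /(_ k (leqnn k)) /= h] := near_infty_natSinv_lt (PosNum e20).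
  by exists k, k.+1%:R^-1; split; rewrite ?invr_gt0 // mulrC -ltr_pdivlMr.
have dense (s : R) : exists q : rat, `|s - ratr q| < rho.
  have [|q] := @rat_in_itvoo R (s - rho) (s + rho); first lra.
  rewrite in_itv /= => /andP[h1 h2]; exists q.
  by rewrite ltr_norml; apply/andP; split; lra.
have [q hq] := dense t.
pose c : 'rV[rat]_n := \row_j xchoose (dense (tnth y j)).
have hc j : `|tnth y j - ratr (c 0 j)| < rho.
  by rewrite mxE; exact: (xchooseP (dense (tnth y j))).
exists (q, c, k); rewrite /D /= -rhoE; last first.
  split => /=; last by move=> j; rewrite mxE.
  move: hq; rewrite in_itv /= ltr_norml => /andP[h1 h2]; apply/andP; split; lra.
move=> [t' y'] [/= h1 h2]; apply: he; split => /=.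
  move: h1 hq; rewrite in_itv /= /ball /= => /andP[h1 h3].
  rewrite !ltr_norml => /andP[h4 h5]; apply/andP; split; lra.
split=> // i j; rewrite ord1 !mxE /ball /=.
have := h2 j; have := hc j; rewrite !mxE !ltr_norml => /andP[a1 a2] /andP[a3 a4].
by apply/andP; split; lra.
Qed.

End LebesgueTuple.

(** * Integration over the domain *)

Section MatrixNorm.
Context {R : realType}.

Lemma normr_coord_le m n (x : 'M[R]_(m, n)) i j : `|x i j| <= `|x|.
Proof.
by rewrite [leRHS]/Num.norm /= mx_normrE; apply/bigmax_geP; right; exists (i, j).
Qed.

Lemma normr_mx_le m n (x : 'M[R]_(m, n)) (e : R) : 0 <= e ->
  (forall i j, `|x i j| <= e) -> `|x| <= e.
Proof.
move=> e0 h; rewrite [leLHS]/Num.norm /= mx_normrE; apply/bigmax_leP.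
by split => // -[i j] _ /=.
Qed.

Lemma bounded_set_ub n (A : set 'rV[R]_n) : bounded_set A ->
  exists2 B, 0 < B & forall x, A x -> `|x| <= B.
Proof.
move=> [B [_ hB]]; exists (Num.max B 0 + 1).
  by rewrite ltr_pwDr // le_max lexx orbT.
by apply: hB; rewrite ltr_pwDr // le_max lexx.
Qed.

Lemma bounded_closure_compact n (A : set 'rV[R]_n) : bounded_set A ->
  compact (closure A).
Proof.
move=> /bounded_set_ub[B B0 hB]; apply: bounded_closed_compact.
  exists (B + 1); split; first by rewrite num_real.
  move=> M MB x Ax; apply: le_trans (ltW MB).
  have [y [Ay]] := Ax (ball x 1) (nbhsx_ballx _ _ ltr01).
  rewrite -ball_normE /= => xy; have := hB _ Ay.
  have -> : x = (x - y) + y by rewrite subrK.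
  by move=> yB; apply: le_trans (ler_normD _ _) _; rewrite addrC; apply: lerD => //; exact: ltW.
exact: closed_closure.
Qed.

End MatrixNorm.

Section BorelMeasurability.
Context {R : realType} {n : nat}.
Local Notation mR := (measurableTypeR R).

Lemma measurable_time_space_continuous (A : set (R * 'rV[R]_n)) (f : R * 'rV[R]_n -> R) :
  measurable (@time_space R n @^-1` A) -> {within A, continuous f} ->
  measurable_fun (@time_space R n @^-1` A) (f \o @time_space R n : _ -> mR).
Proof.
move=> mA /continuousP cf; apply: (measurability _ (RGenOpens.measurableE R)).
move=> _ [_ [a [b ->] <-]].
have /open_subspaceP[V oV VE] := cf _ (@interval_open _ (BRight a) (BLeft b) isT isT).
rewrite (_ : _ `&` _ = @time_space R n @^-1` (V `&` A)).
  by rewrite preimage_setI; apply: measurableI => //; exact: measurable_time_space_open.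
by rewrite VE preimage_setI setIC.
Qed.

Lemma measurable_row_open (U : set 'rV[R]_n) : open U ->
  measurable (@row_of_tuple R n @^-1` U).
Proof.
move=> oU.
have oV : open [set p : R * 'rV[R]_n | U p.2].
  by apply: (open_comp (f := snd)) => // p _; exact: cvg_snd.
rewrite (_ : _ @^-1` _ = pair (0 : mR) @^-1`
  (@time_space R n @^-1` [set p : R * 'rV[R]_n | U p.2])) //.
rewrite -[X in measurable X]setTI; apply: pair1_measurable => //.
exact: measurable_time_space_open.
Qed.

Lemma measurable_row_continuous (A : set 'rV[R]_n) (f : 'rV[R]_n -> R) :
  measurable (@row_of_tuple R n @^-1` A) -> {within A, continuous f} ->
  measurable_fun (@row_of_tuple R n @^-1` A) (f \o @row_of_tuple R n : _ -> mR).
Proof.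
move=> mA /continuousP cf; apply: (measurability _ (RGenOpens.measurableE R)).
move=> _ [_ [a [b ->] <-]].
have /open_subspaceP[V oV VE] := cf _ (@interval_open _ (BRight a) (BLeft b) isT isT).
rewrite (_ : _ `&` _ = @row_of_tuple R n @^-1` (V `&` A)).
  by rewrite preimage_setI; apply: measurableI => //; exact: measurable_row_open.
by rewrite VE preimage_setI setIC.
Qed.

End BorelMeasurability.

Section DomainIntegral.
Context {R : realType} {n : nat}.
Variable Omega : set 'rV[R]_n.
Hypotheses (oOmega : open Omega) (bOmega : bounded_set Omega).

Local Notation mR := (measurableTypeR R).
Local Notation mu := (@lebesgue_tuple R n).
Local Notation O := (@row_of_tuple R n @^-1` Omega).

Lemma domain_measurable : measurable O.
Proof. exact: measurable_row_open. Qed.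

Lemma domain_finite_measure : (mu O < +oo)%E.
Proof.
have [B B0 hB] := bounded_set_ub bOmega.
apply: (@le_lt_trans _ _ (mu (tuple_box 0 (B + 1)))).
  apply: le_measure; rewrite ?inE; [exact: domain_measurable|exact: measurable_tuple_box|].
  move=> y /= /hB yB i; rewrite mxE subr0 -row_of_tupleE.
  by apply: le_lt_trans (normr_coord_le _ _ _) _; rewrite (le_lt_trans yB) // ltrDl.
by rewrite lebesgue_tuple_box ?ltry // addr_gt0.
Qed.

Definition bounded_measurable (f : 'rV[R]_n -> R) :=
  measurable_fun O (f \o @row_of_tuple R n : _ -> mR) /\
  exists B, forall y, Omega y -> `|f y| <= B.

Definition integralO (f : 'rV[R]_n -> R) : R :=
  \int[mu]_(y in O) f (row_of_tuple y).

Lemma bounded_measurable_integrable f : bounded_measurable f ->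
  mu.-integrable O (EFin \o (f \o @row_of_tuple R n)).
Proof.
move=> [mf [B fB]]; apply: measurable_bounded_integrable => //.
- exact: domain_measurable.
- exact: domain_finite_measure.
- exists B; split; first by rewrite num_real.
  by move=> M /ltW BM y /fB /le_trans; apply.
Qed.

Lemma bounded_measurable_cst a : bounded_measurable (fun=> a).
Proof. by split; [exact: measurable_cst | exists `|a|]. Qed.

Lemma bounded_measurableD f g : bounded_measurable f -> bounded_measurable g ->
  bounded_measurable (fun y => f y + g y).
Proof.
move=> [mf [B fB]] [mg [C gC]]; split; first exact: measurable_funD.
exists (B + C) => y Oy; apply: le_trans (ler_normD _ _) _.
by apply: lerD; [exact: fB | exact: gC].
Qed.

Lemma bounded_measurableM f g : bounded_measurable f -> bounded_measurable g ->
  bounded_measurable (fun y => f y * g y).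
Proof.
move=> [mf [B fB]] [mg [C gC]]; split; first exact: measurable_funM.
exists (B * C) => y Oy; rewrite normrM.
by apply: ler_pM => //; [exact: fB | exact: gC].
Qed.

Lemma bounded_measurableZ a f : bounded_measurable f ->
  bounded_measurable (fun y => a * f y).
Proof. by move=> bf; apply: bounded_measurableM => //; exact: bounded_measurable_cst. Qed.

Lemma bounded_measurableB f g : bounded_measurable f -> bounded_measurable g ->
  bounded_measurable (fun y => f y - g y).
Proof.
move=> bf bg; rewrite (_ : (fun y => _) = (fun y => f y + -1 * g y)).
  by apply: bounded_measurableD => //; exact: bounded_measurableZ.
by apply/funext => y; rewrite mulN1r.
Qed.

Lemma bounded_measurable_continuous f : {within closure Omega, continuous f} ->
  bounded_measurable f.
Proof.
move=> cf; have [B _ fB] := compact_within_bounded (bounded_closure_compact bOmega) cf.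
split; last by exists B => y /subset_closure/fB.
apply: measurable_row_continuous; first exact: domain_measurable.
by apply: continuous_subspaceW cf; exact: subset_closure.
Qed.

Lemma eq_bounded_measurable f g : (forall y, Omega y -> f y = g y) ->
  bounded_measurable f -> bounded_measurable g.
Proof.
move=> fg [mf [B fB]]; split; last by exists B => y Oy; rewrite -fg ?fB.
by apply: eq_measurable_fun mf => y; rewrite inE /= => /fg.
Qed.

Lemma eq_integralO f g : (forall y, Omega y -> f y = g y) -> integralO f = integralO g.
Proof. by move=> fg; apply: eq_Rintegral => y; rewrite inE /= => /fg. Qed.

Lemma integralOD f g : bounded_measurable f -> bounded_measurable g ->
  integralO (fun y => f y + g y) = integralO f + integralO g.
Proof.
by move=> bf bg; apply: RintegralD; [exact: domain_measurable | |];
  exact: bounded_measurable_integrable.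
Qed.

Lemma integralOZ a f : bounded_measurable f ->
  integralO (fun y => a * f y) = a * integralO f.
Proof.
by move=> bf; apply: RintegralZl; [exact: domain_measurable |
  exact: bounded_measurable_integrable].
Qed.

Lemma integralOB f g : bounded_measurable f -> bounded_measurable g ->
  integralO (fun y => f y - g y) = integralO f - integralO g.
Proof.
by move=> bf bg; apply: RintegralB; [exact: domain_measurable | |];
  exact: bounded_measurable_integrable.
Qed.

Lemma integralO_ge0 f : (forall y, Omega y -> 0 <= f y) -> 0 <= integralO f.
Proof. by move=> f0; apply: Rintegral_ge0 => y /f0. Qed.

Lemma le_integralO f g : bounded_measurable f -> bounded_measurable g ->
  (forall y, Omega y -> f y <= g y) -> integralO f <= integralO g.
Proof.
move=> bf bg fg; apply: le_Rintegral; [exact: domain_measurable | | |];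
  try exact: bounded_measurable_integrable.
by move=> y /fg.
Qed.

Definition volumeO : R := integralO (fun=> 1).

Lemma volumeO_ge0 : 0 <= volumeO.
Proof. exact: integralO_ge0. Qed.

Lemma normr_integralO_le f (B : R) : bounded_measurable f ->
  (forall y, Omega y -> `|f y| <= B) -> `|integralO f| <= B * volumeO.
Proof.
move=> bf fB; rewrite -integralOZ; last exact: bounded_measurable_cst.
have b1 a : bounded_measurable (fun=> a * 1).
  by apply: bounded_measurableZ; exact: bounded_measurable_cst.
rewrite ler_norml; apply/andP; split.
  rewrite lerNl -mulN1r -integralOZ //; apply: le_integralO => //.
    exact: bounded_measurableZ.
  by move=> y /fB; rewrite ler_norml mulr1 => /andP[]; lra.
apply: le_integralO => // y /fB; rewrite ler_norml mulr1 => /andP[]; lra.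
Qed.

Lemma integralO_cvg (f : nat -> 'rV[R]_n -> R) (g : 'rV[R]_n -> R) (B : R) :
  (forall k, bounded_measurable (f k)) ->
  (forall k y, Omega y -> `|f k y| <= B) ->
  (forall y, Omega y -> f ^~ y @ \oo --> g y) ->
  bounded_measurable g /\ integralO (f k) @[k --> \oo] --> integralO g.
Proof.
move=> bf fB fg.
have mg : measurable_fun O (g \o @row_of_tuple R n : _ -> mR).
  apply: (@measurable_fun_cvg _ _ _ _ (fun k => f k \o @row_of_tuple R n)).
    by move=> k; have [] := bf k.
  by move=> y /fg.
have gB y : Omega y -> `|g y| <= B.
  move=> Oy; have := fg y Oy => /cvg_norm h.
  by apply: (cvgr_to_le h); apply: nearW => k; exact: fB.
have bg : bounded_measurable g by split => //; exists B.
split => //.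
have := @dominated_convergence _ _ _ mu O domain_measurable
  (fun k => EFin \o (f k \o @row_of_tuple R n)) (EFin \o (g \o @row_of_tuple R n))
  (fun=> B%:E).
case.
- by move=> k; apply/measurable_EFinP; have [] := bf k.
- exact/measurable_EFinP.
- apply: aeW => y Oy /=; apply/fine_cvgP; split; first exact: nearW.
  exact: fg.
- by have := bounded_measurable_integrable (bounded_measurable_cst B).
- by apply: aeW => y k Oy /=; rewrite lee_fin; exact: fB.
move=> ig _ cvgE.
have E h : bounded_measurable h ->
    (\int[mu]_(y in O) (EFin \o (h \o @row_of_tuple R n)) y)%E = (integralO h)%:E.
  move=> bh; rewrite /integralO /Rintegral fineK //.
  exact: (integrable_fin_num domain_measurable (bounded_measurable_integrable bh)).
move: cvgE; rewrite E // => /fine_cvgP[_].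
by apply: cvg_trans; apply: near_eq_cvg; apply: nearW => k /=; rewrite E.
Qed.

(** [Omega] is open, so a ball around a point of its closure meets it in a set
    of positive measure. *)
Lemma integralO_gt0 f x (r : R) : bounded_measurable f -> (forall y, Omega y -> 0 <= f y) ->
  closure Omega x -> 0 < r -> (forall y, Omega y -> ball x r y -> 0 < f y) ->
  0 < integralO f.
Proof.
move=> bf f0 Cx r0 fpos; rewrite lt_neqAle integralO_ge0 // andbT; apply/eqP => J0.
have [y0 [Oy0 xy0]] := Cx (ball x r)° (open_nbhs_nbhs (open_nbhs_ball x (PosNum r0))).
have [e /= e0 he] : nbhs_ball y0 (Omega `&` ball x r).
  apply/nbhs_ballP; apply: filterI; first exact: open_nbhs_nbhs.
  by have : nbhs y0 (ball x r)° by apply: open_nbhs_nbhs; split => //; exact: open_interior.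
have [mf _] := bf.
have : (\int[mu]_(y in O) `|(f (row_of_tuple y))%:E| = 0)%E.
  rewrite (eq_integral (fun y => (f (row_of_tuple y))%:E)); last first.
    by move=> y; rewrite inE /= => Oy; rewrite ger0_norm // f0.
  have := integrable_fin_num domain_measurable (bounded_measurable_integrable bf).
  by move=> /fineK <-; rewrite -[fine _]/(integralO f) -J0.
move/ae_eq_integral_abs => /(_ domain_measurable).
have mf' : measurable_fun O (EFin \o (f \o @row_of_tuple R n)) by exact/measurable_EFinP.
move=> /(_ mf') [N [mN N0 hN]].
have : (mu (tuple_box y0 e) <= mu N)%E.
  apply: le_measure; rewrite ?inE //; first exact: measurable_tuple_box.
  move=> y hy; apply: hN => /= h.
  have [Oy xy] : (Omega `&` ball x r) (row_of_tuple y).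
    apply: he; split => // i j; rewrite ord1 mxE /ball /= distrC; exact: hy.
  have [fy0] := h Oy; have := fpos _ Oy xy; rewrite fy0 ltxx //.
rewrite N0 lebesgue_tuple_box // lee_fin leNgt exprn_gt0 //; lra.
Qed.

(** Reflecting [y] to [x - y] preserves the measure, and restricting to the domain
    can only lower the integral of a nonnegative kernel. *)
Lemma kernel_integralO_le1 (k : 'rV[R]_n -> R) (x : 'rV[R]_n) : continuous k ->
  (forall z, 0 <= k z) -> (\int[mu]_y (k (row_of_tuple y))%:E = 1)%E ->
  integralO (fun y => k (x - y)) <= 1.
Proof.
move=> ck k0 k1.
have mk (h : 'rV[R]_n -> R) : continuous h ->
    measurable_fun setT (EFin \o (h \o @row_of_tuple R n)).
  move=> ch; apply/measurable_EFinP.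
  have := @measurable_row_continuous R n setT h; rewrite preimage_setT; apply=> //.
  exact: continuous_subspaceT.
have mkx : measurable_fun setT (EFin \o ((fun y => k (x - y)) \o @row_of_tuple R n)).
  apply: mk => z; apply: (@continuous_comp _ _ _ (fun y : 'rV[R]_n => x - y) k); last exact: ck.
  by apply: (@continuousB R 'rV[R]_n); [exact: cst_continuous | exact: cvg_id].
have E : (\int[mu]_y (k (x - row_of_tuple y))%:E = 1)%E.
  rewrite -k1 -(ge0_integral_tuple_reflect x (mk k ck)) => [|y]; last by rewrite /= lee_fin.
  by apply: eq_integral => y _ /=; rewrite row_of_tuple_reflect.
have le1 : (\int[mu]_(y in O) (k (x - row_of_tuple y))%:E <= 1)%E.
  rewrite -E; apply: ge0_subset_integral => //; first exact: domain_measurable.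
  by move=> y _; rewrite lee_fin.
rewrite /integralO /Rintegral; have : (0 <= \int[mu]_(y in O) (k (x - row_of_tuple y))%:E)%E.
  by apply: integral_ge0 => y _; rewrite lee_fin.
by move: le1; case: (\int[mu]_(y in O) _)%E.
Qed.

End DomainIntegral.

(** * Order and calculus in the state space *)

Lemma common_lower_bound (R : realType) (I : finType) (f : I -> R) :
  (forall i, 0 < f i) -> exists2 e, 0 < e & forall i, e <= f i.
Proof.
move=> f0; exists (\big[Num.min/1]_i f i); last by move=> i; apply: bigmin_le.
by elim/big_ind : _ => // x y x0 y0; rewrite lt_min x0.
Qed.

Section ColumnVectors.
Context {R : realType} {m : nat}.
Implicit Types (a b u : 'cV[R]_m).

Lemma vleP a b : vle a b <-> forall i, a i 0 <= b i 0.
Proof. by split=> h i; have := h i; rewrite !mxE subr_ge0. Qed.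

Lemma order_intervalP v u : order_interval v u <-> forall i, 0 <= u i 0 <= v i 0.
Proof.
split=> [[/vleP h1 /vleP h2] i|h].
  by have := h1 i; rewrite mxE => ->; exact: h2.
by split; apply/vleP => i; have /andP[] := h i; rewrite ?mxE.
Qed.

Lemma vllP a b : vll a b <-> forall i, a i 0 < b i 0.
Proof.
rewrite /vll /interior /=; split.
  move=> /nbhs_ballP[e /= e0 h] i; rewrite -subr_gt0.
  have /h /(_ i) : ball (b - a) e (b - a - const_mx (e / 2)).
    split=> // k l; rewrite /ball /= !mxE ltr_norml; apply/andP; split; lra.
  rewrite !mxE; lra.
move=> h; have [|e e0 he] := @common_lower_bound R 'I_m (fun i => b i 0 - a i 0).
  by move=> i; rewrite subr_gt0.
apply/nbhs_ballP; exists e => //= y [_ hy] i.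
have := hy i 0; have := he i; rewrite /ball /= !mxE ltr_norml => h1 /andP[h2 h3]; lra.
Qed.

Lemma vltP a b : vlt a b <-> (forall i, a i 0 <= b i 0) /\ exists i, a i 0 < b i 0.
Proof.
split=> [[/vleP ab nab]|[ab [i abi]]]; last first.
  by split; [exact/vleP | move=> E; move: abi; rewrite E ltxx].
split=> //; apply: contrapT => /forallNP h; apply: nab.
apply/colP => i; apply/eqP; rewrite eq_le ab /=.
by have /negP := h i; rewrite -leNgt.
Qed.

(** Transposition carries the Heine-Borel theorem from rows to columns. *)
Lemma compact_cV_ball (B : R) : compact [set u : 'cV[R]_m | `|u| <= B].
Proof.
have cN : continuous (fun w : 'rV[R]_m => w^T).
  move=> w A [P hP sPA]; apply/nbhs_ballP.
  have [e e0 he] : exists2 e, 0 < e & forall i, ball (w 0 i) e `<=` P i 0.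
    have h i : exists e : R, 0 < e /\ ball (w 0 i) e `<=` P i 0.
      by have /nbhs_ballP[e /= e0 h] := hP i 0; exists e; move: h; rewrite mxE.
    have [f hf] := choice h.
    have [i|e e0 he] := @common_lower_bound R 'I_m f; first by have [] := hf i.
    exists e => // i; have [_] := hf i; apply: subset_trans; exact: le_ball.
  exists e => //= y [_ hy]; apply: sPA => i j; rewrite ord1 mxE; apply: he; exact: hy.
rewrite (_ : [set u | _] = (fun w : 'rV[R]_m => w^T) @` [set w : 'rV[R]_m | `|w| <= B]).
  apply: continuous_compact; first exact: continuous_subspaceT.
  apply: bounded_closed_compact.
    by exists B; split; [rewrite num_real | move=> M BM w /= /le_trans; apply; exact: ltW].
  by apply: (@closed_comp _ _ (fun w : 'rV[R]_m => `|w|) [set r | r <= B]);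
    [move=> w _; exact: norm_continuous | exact: closed_le].
have tr_le k l (w : 'M[R]_(k, l)) : `|w| <= B -> `|w^T| <= B.
  move=> h; apply: normr_mx_le; first by apply: le_trans h.
  by move=> i j; rewrite mxE (le_trans (normr_coord_le _ _ _)).
apply/seteqP; split=> u /=; last by move=> [w + <-]; exact: tr_le.
by move=> h; exists u^T; [exact: tr_le | rewrite trmxK].
Qed.

Lemma within_coord (U : topologicalType) (A : set U) k l (f : U -> 'M[R]_(k, l)) i j :
  {within A, continuous f} -> {within A, continuous (fun p => f p i j)}.
Proof.
move=> cf p; apply: (@continuous_comp _ _ _ (f : subspace A -> _) (fun M : 'M[R]_(k,l) => M i j)).
  exact: cf.
exact: coord_continuous.
Qed.

Lemma within_coordP (U : topologicalType) (A : set U) k l (f : U -> 'M[R]_(k, l)) :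
  (forall i j, {within A, continuous (fun p => f p i j)}) -> {within A, continuous f}.
Proof.
move=> cf p; apply/cvg_mx_entourageP => E entE.
have h ij : \forall q \near (p : subspace A), (f p ij.1 ij.2, f q ij.1 ij.2) \in E.
  have /cvg_entourageP /(_ E entE) h := cf ij.1 ij.2 p.
  have {}h : \forall q \near (p : subspace A), E (f p ij.1 ij.2, f q ij.1 ij.2) by exact: h.
  by apply: filterS h => q hq; rewrite inE.
have : \forall q \near (p : subspace A), forall ij : 'I_k * 'I_l,
    (f p ij.1 ij.2, f q ij.1 ij.2) \in E.
  exact: filter_forall.
by apply: filterS => q hq i j; exact: hq (i, j).
Qed.

End ColumnVectors.

Section CoordinatePath.
Context {R : realType} {m : nat}.
Implicit Types (f : 'cV[R]_m -> R) (a b z : 'cV[R]_m).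

Lemma is_derive_along f z e s : (forall y, derivable f y e) ->
  is_derive (s : R) (1 : R) (fun r : R => f (z + r *: e)) ('D_e f (z + s *: e)).
Proof.
move=> df.
have E : (fun h => h^-1 *: (((fun r : R => f (z + r *: e)) \o shift s) (h *: (1 : R)) - f (z + s *: e)))
   = (fun h => h^-1 *: ((f \o shift (z + s *: e)) (h *: e) - f (z + s *: e))).
  apply/funext => h /=; congr (_ *: (f _ - _)).
  by rewrite scalerDl [h *: (1 : R)]mulr1 addrCA.
by split; rewrite /derivable /derive E; [exact: df | ].
Qed.

Lemma mvt_line f z e (r : R) : (forall y, derivable f y e) ->
  exists c, (0 <= c <= r \/ r <= c <= 0) /\
    f (z + r *: e) - f z = 'D_e f (z + c *: e) * r.
Proof.
move=> df; have isd s := is_derive_along z s df.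
have cts (p q : R) : {within `[p, q]%classic, continuous (fun s : R => f (z + s *: e))}.
  apply: continuous_subspaceT => s; apply: differentiable_continuous.
  by apply/derivable1_diffP; have [] := isd s.
have [r0|r0] := leP 0 r.
  have [c] := MVT_segment r0 (fun s _ => isd s) (cts _ _).
  rewrite in_itv /= scale0r addr0 subr0 => cI E; exists c; split=> //; by left.
have [c] := MVT_segment (ltW r0) (fun s _ => isd s) (cts _ _).
rewrite in_itv /= scale0r addr0 sub0r => cI E; exists c; split; first by right.
by rewrite -opprB E mulrN opprK.
Qed.

(** Mean value theorem along the path that changes one coordinate at a time:
    it needs partial derivatives only, and stays in the box spanned by the end
    points. *)
Lemma mvt_box f a b : (forall j y, derivable f y (delta_mx j 0)) ->
  exists xi : 'I_m -> 'cV[R]_m,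
    (forall j k, (a k 0 <= xi j k 0 <= b k 0) \/ (b k 0 <= xi j k 0 <= a k 0)) /\
    f a - f b = \sum_j 'D_(delta_mx j 0) f (xi j) * (a j 0 - b j 0).
Proof.
move=> df.
pose p (k : nat) : 'cV[R]_m := \col_j (if (j < k)%N then a j 0 else b j 0).
have pS (k : 'I_m) : p k.+1 = p k + (a k 0 - b k 0) *: delta_mx k 0.
  apply/colP => j; rewrite !mxE eqxx andbT ltnS.
  have [->|jk] := eqVneq j k; first by rewrite leqnn ltnn mulr1 addrC subrK.
  by rewrite mulr0 addr0 leq_eqVlt (inj_eq val_inj) (negbTE jk).
have h (k : 'I_m) : exists c : R,
    (0 <= c <= a k 0 - b k 0 \/ a k 0 - b k 0 <= c <= 0) /\
    f (p k.+1) - f (p k) = 'D_(delta_mx k 0) f (p k + c *: delta_mx k 0) * (a k 0 - b k 0).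
  by rewrite pS; apply: mvt_line => y; exact: df.
have [c hc] := choice h.
exists (fun k : 'I_m => p k + c k *: delta_mx k 0); split.
  move=> j k; rewrite !mxE eqxx andbT; have [->|kj] := eqVneq k j.
    rewrite ltnn mulr1; have [[/andP[h1 h2]|/andP[h1 h2]] _] := hc j;
      [right|left]; apply/andP; split; lra.
  rewrite mulr0 addr0; case: ifP => _; have [ab|ab] := leP (a k 0) (b k 0);
    ((by left; rewrite ?lexx ?ab) || (by right; rewrite ?lexx ?(ltW ab))).
have -> : f a - f b = \sum_(k < m) (f (p k.+1) - f (p k)).
  rewrite -(big_mkord xpredT (fun k => f (p k.+1) - f (p k))) telescope_sumr //.
  congr (f _ - f _); apply/colP => j; rewrite mxE ?ltn_ord ?ltn0 //.
by apply: eq_bigr => k _; have [_ ->] := hc k.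
Qed.

End CoordinatePath.

Lemma within_continuous_comp (U V W : topologicalType) (A : set U) (B : set V)
    (h : U -> V) (f : V -> W) :
  {within A, continuous h} -> (forall x, A x -> B (h x)) ->
  {within B, continuous f} -> {within A, continuous (f \o h)}.
Proof.
rewrite !subspace_continuousP => ch AB cf x Ax.
have hc : h y @[y --> within A (nbhs x)] --> within B (nbhs (h x)).
  move=> P wP; have := ch x Ax _ wP; rewrite !nbhs_simpl /within /=.
  by apply: filterS => y h1 Ay; apply: h1 => //; exact: AB.
move=> P fP.
by have h2 := hc _ (cf _ (AB _ Ax) P fP); exact: h2.
Qed.

Lemma within_continuous_pair (U V W : topologicalType) (A : set U)
    (f : U -> V) (h : U -> W) :
  {within A, continuous f} -> {within A, continuous h} ->
  {within A, continuous (fun x => (f x, h x))}.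
Proof. by move=> cf ch x; apply: cvg_pair; [exact: cf | exact: ch]. Qed.

(** * Cooperative and sublinear kinetics *)

Section Sums.
Context {R : realType} {m : nat}.
Implicit Types (c w : 'I_m -> R).

Lemma sum_ge_const c (B : R) : (forall j, - B <= c j) -> - (m%:R * B) <= \sum_j c j.
Proof.
move=> h; apply: (@le_trans _ _ (\sum_(j < m) - B)); last exact: ler_sum.
by rewrite sumr_const card_ord mulNrn -[B *+ m]mulr_natl.
Qed.

(** Off-diagonal terms are bounded below because their coefficients are
    nonnegative, the diagonal one because [w i] is bounded on both sides. *)
Lemma cooperative_sum_ge c w (i : 'I_m) (Lam N : R) :
  (forall j, `|c j| <= Lam) -> (forall j, j != i -> 0 <= c j) ->
  (forall j, - N <= w j) -> w i <= N -> - (m%:R * Lam * N) <= \sum_j c j * w j.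
Proof.
move=> cL c0 wN wiN; have N0 : 0 <= N by have := wN i; lra.
rewrite -mulrA; apply: sum_ge_const => j.
have := cL j; rewrite ler_norml => /andP[h1 h2]; have := wN j => h3.
have [->|ji] := eqVneq j i.
  have : `|c i * w i| <= Lam * N.
    by rewrite normrM; apply: ler_pM => //; rewrite ler_norml wN.
  by rewrite ler_norml => /andP[].
have := c0 _ ji => h4; nra.
Qed.

End Sums.

(** The one-sided estimate behind all comparison arguments: component [i] may
    drop only in proportion to how far [a] lies below [b]. *)
Definition quasi_monotone (R : realType) m n (C : set 'rV[R]_n) (B : set 'cV[R]_m)
    (tau L : R) (F : R -> 'rV[R]_n -> 'cV[R]_m -> 'cV[R]_m) :=
  forall (t : R) x a b i (N : R), 0 <= t <= tau -> C x -> B a -> B b ->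
    (forall j, - N <= a j 0 - b j 0) -> a i 0 - b i 0 <= N ->
    - (L * N) <= F t x a i 0 - F t x b i 0.

Definition vclamp (R : realType) m (v u : 'cV[R]_m) : 'cV[R]_m :=
  \col_i Num.max 0 (Num.min (u i 0) (v i 0)).

Section Kinetics.
Context {R : realType} {m n : nat}.
Variables (Omega : set 'rV[R]_n) (v : 'cV[R]_m)
  (g : R -> 'rV[R]_n -> 'cV[R]_m -> 'cV[R]_m).
Implicit Types (a b u z : 'cV[R]_m) (t tau alpha e B N : R) (x : 'rV[R]_n).
Hypotheses (bOmega : bounded_set Omega) (hv : vll 0 v) (gC : C00_1 Omega g).
Hypothesis gcoop : forall t x u, 0 <= t -> closure Omega x -> order_interval v u ->
  cooperative (dmx (g t x) u) /\ irreducible (dmx (g t x) u).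
Hypothesis g0 : forall t x, closure Omega x -> g t x 0 = 0.
Hypothesis gsub : forall t x u alpha, 0 <= t -> closure Omega x ->
  order_interval v u -> vll 0 u -> 0 < alpha -> alpha < 1 ->
  vlt (alpha *: g t x u) (g t x (alpha *: u)).

Local Notation C := (closure Omega).
Local Notation M := (order_interval v).
Local Notation statespace := [set p : R * 'rV[R]_n * 'cV[R]_m | C p.1.2].

Lemma v_gt0 i : 0 < v i 0.
Proof. by have /vllP/(_ i) := hv; rewrite mxE. Qed.

Lemma order_interval_zero : M 0.
Proof. by apply/order_intervalP => i; rewrite mxE lexx ltW // v_gt0. Qed.

Lemma order_interval_top : M v.
Proof. by apply/order_intervalP => i; rewrite lexx andbT ltW // v_gt0. Qed.

Lemma order_interval_norm u : M u -> `|u| <= `|v|.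
Proof.
move=> /order_intervalP h; apply: normr_mx_le => // i j; rewrite ord1.
have /andP[u0 uv] := h i; rewrite ger0_norm // (le_trans uv) //.
by apply: le_trans (normr_coord_le v i 0); exact: ler_norm.
Qed.

Lemma order_interval_scale u alpha : M u -> 0 <= alpha <= 1 -> M (alpha *: u).
Proof.
move=> /order_intervalP h /andP[a0 a1]; apply/order_intervalP => i; rewrite mxE.
have /andP[u0 uv] := h i; rewrite mulr_ge0 //=.
by apply: le_trans uv; rewrite ler_piMl.
Qed.

Lemma order_interval_between a b u : M a -> M b ->
  (forall k, a k 0 <= u k 0 <= b k 0 \/ b k 0 <= u k 0 <= a k 0) -> M u.
Proof.
move=> /order_intervalP ha /order_intervalP hb h; apply/order_intervalP => k.
have /andP[h1 h2] := ha k; have /andP[h3 h4] := hb k.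
by case: (h k) => /andP[h5 h6]; apply/andP; split; lra.
Qed.

Lemma g_mvt t x a b i : C x -> exists xi : 'I_m -> 'cV[R]_m,
  (forall j k, (a k 0 <= xi j k 0 <= b k 0) \/ (b k 0 <= xi j k 0 <= a k 0)) /\
  g t x a i 0 - g t x b i 0 = \sum_j dmx (g t x) (xi j) i j * (a j 0 - b j 0).
Proof.
move=> Cx; have [_ dg _] := gC.
have [|xi [h1 h2]] := @mvt_box _ _ (fun z => g t x z i 0) a b.
  by move=> j y; exact: dg.
by exists xi; split=> //; rewrite h2; apply: eq_bigr => j _; rewrite mxE.
Qed.

Lemma dmx_bounded tau B : exists2 Lam, 0 <= Lam & forall t x z i j,
  0 <= t <= tau -> C x -> `|z| <= B -> `|dmx (g t x) z i j| <= Lam.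
Proof.
have [_ _ cd] := gC.
pose K : set (R * 'rV[R]_n * 'cV[R]_m) := (`[0, tau]%classic `*` C) `*` [set z | `|z| <= B].
have cK : compact K.
  apply: compact_setX; last exact: compact_cV_ball.
  by apply: compact_setX; [exact: segment_compact | exact: bounded_closure_compact].
have [|Lam L0 hL] := @compact_within_bounded _ _ _ K (fun p => dmx (g p.1.1 p.1.2) p.2) cK.
  by apply: continuous_subspaceW cd => p [[_ Cp] _].
exists Lam => // t x z i j tI Cx zB; apply: le_trans (normr_coord_le _ i j) _.
by apply: (hL (t, x, z)); split => //; split => //; rewrite /= in_itv.
Qed.

Lemma g_lipschitz tau B : exists2 L, 0 <= L & forall t x a b i N,
  0 <= t <= tau -> C x -> `|a| <= B -> `|b| <= B ->
  (forall j, `|a j 0 - b j 0| <= N) -> `|g t x a i 0 - g t x b i 0| <= L * N.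
Proof.
have [Lam L0 hL] := dmx_bounded tau B.
exists (m%:R * Lam); first by rewrite mulr_ge0.
move=> t x a b i N tI Cx aB bB abN; have [xi [h1 ->]] := g_mvt t a b i Cx.
have B0 : 0 <= B by apply: le_trans aB.
have hj j : `|dmx (g t x) (xi j) i j * (a j 0 - b j 0)| <= Lam * N.
  rewrite normrM; apply: ler_pM => //; apply: hL => //.
  apply: normr_mx_le => // k l; rewrite ord1.
  have := le_trans (normr_coord_le a k 0) aB; have := le_trans (normr_coord_le b k 0) bB.
  rewrite !ler_norml => /andP[e1 e2] /andP[e3 e4].
  by case: (h1 j k) => /andP[e5 e6]; apply/andP; split; lra.
apply: le_trans (ler_norm_sum _ _ _) _.
apply: le_trans (ler_sum _ (fun j _ => hj j)) _.
by rewrite sumr_const card_ord -[_ * N *+ m]mulr_natl mulrA.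
Qed.

Lemma g_quasi_monotone tau : exists2 L, 0 <= L & quasi_monotone C M tau L g.
Proof.
have [Lam L0 hL] := dmx_bounded tau `|v|.
exists (m%:R * Lam); first by rewrite mulr_ge0.
move=> t x a b i N tI Cx Ma Mb abN abi; have [xi [h1 ->]] := g_mvt t a b i Cx.
have Mxi j : M (xi j) by apply: order_interval_between Ma Mb (h1 j).
have /andP[t0 _] := tI.
apply: (@cooperative_sum_ge _ _ (fun j => dmx (g t x) (xi j) i j)
  (fun j => a j 0 - b j 0) i) => // j.
  by apply: hL => //; exact: order_interval_norm.
by move=> ji; have [/(_ i j) + _] := gcoop t0 Cx (Mxi j); rewrite eq_sym; apply.
Qed.

Lemma linear_partE t x z i : linear_part g t x z i 0 = \sum_j dmx (g t x) 0 i j * z j 0.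
Proof. by rewrite /linear_part mxE. Qed.

Lemma linear_quasi_monotone tau : exists2 L, 0 <= L &
  quasi_monotone C setT tau L (linear_part g).
Proof.
have [Lam L0 hL] := dmx_bounded tau 0.
exists (m%:R * Lam); first by rewrite mulr_ge0.
move=> t x a b i N tI Cx _ _ abN abi; rewrite !linear_partE -sumrB.
under eq_bigr do rewrite -mulrBr; have /andP[t0 _] := tI.
apply: (@cooperative_sum_ge _ _ (fun j => dmx (g t x) 0 i j)
  (fun j => a j 0 - b j 0) i) => // j.
  by apply: hL => //; rewrite normr0.
by move=> ji; have [/(_ i j) + _] := gcoop t0 Cx order_interval_zero; rewrite eq_sym; apply.
Qed.

Lemma linear_lipschitz tau : exists2 L, 0 <= L & forall t x a b i N,
  0 <= t <= tau -> C x -> (forall j, `|a j 0 - b j 0| <= N) ->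
  `|linear_part g t x a i 0 - linear_part g t x b i 0| <= L * N.
Proof.
have [Lam L0 hL] := dmx_bounded tau 0.
exists (m%:R * Lam); first by rewrite mulr_ge0.
move=> t x a b i N tI Cx abN; rewrite !linear_partE -sumrB.
under eq_bigr do rewrite -mulrBr.
apply: le_trans (ler_norm_sum _ _ _) _.
apply: (@le_trans _ _ (\sum_(j < m) Lam * N)); last first.
  by rewrite sumr_const card_ord -[_ * N *+ m]mulr_natl mulrA.
apply: ler_sum => j _; rewrite normrM; apply: ler_pM => //.
by apply: hL => //; rewrite normr0.
Qed.

Lemma g_monotone t x a b i : 0 <= t -> C x -> M a -> M b ->
  (forall j, b j 0 <= a j 0) -> a i 0 = b i 0 -> g t x b i 0 <= g t x a i 0.
Proof.
move=> t0 Cx Ma Mb ba abi; have [L L0 /(_ t x a b i 0)] := g_quasi_monotone t.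
rewrite mulr0 oppr0 subr_ge0; apply=> //; rewrite ?t0 ?lexx //.
  by move=> j; rewrite subr_ge0.
by rewrite abi subrr.
Qed.

Lemma dmx0_continuous t x i j e : C x -> 0 < e ->
  exists2 r, 0 < r & forall z, `|z| < r -> `|dmx (g t x) 0 i j - dmx (g t x) z i j| < e.
Proof.
move=> Cx e0; have [_ _ cd] := gC.
have /within_continuous_epsP := within_coord (i := i) (j := j) cd.
move=> /(_ (t, x, 0) Cx e e0)[r r0 h]; exists r => // z zr.
apply: (h (t, x, z)) => //; split; first by split; exact: ballxx.
by rewrite -ball_normE /ball_ /= sub0r normrN.
Qed.

(** Zero rows of [A] towards the positive components would leave the zero set of
    [a] invariant, which irreducibility excludes unless that set is trivial. *)
Lemma irreducible_zero_set (A : 'M[R]_m) a : irreducible A -> (forall i, 0 <= a i 0) ->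
  (forall i j, a i 0 = 0 -> 0 < a j 0 -> A i j = 0) -> a = 0 \/ forall i, 0 < a i 0.
Proof.
move=> irr a0 Az; pose I := [set i | a i 0 == 0]%SET.
have pos j : j \notin I -> 0 < a j 0.
  by rewrite finset.in_set => aj; rewrite lt_neqAle eq_sym aj a0.
have [I0|I0] := eqVneq I finset.set0.
  by right=> i; apply: pos; rewrite I0 finset.in_set0.
have [IT|IT] := eqVneq I [set: 'I_m]%SET.
  left; apply/colP => i; rewrite mxE; apply/eqP.
  by have : i \in I; [rewrite IT finset.in_setT | rewrite finset.in_set].
have [i [j [iI /pos aj /eqP Aij]]] := irr I I0 IT; case: Aij.
by apply: Az => //; move: iI; rewrite finset.in_set => /eqP.
Qed.

(** If component [i] does not feel the positive components of [a], it does not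
    feel them along the coordinate axes near the origin either, so the Jacobian
    at the origin decouples the zero set of [a]. *)
Lemma g_irreducible t x a : 0 <= t -> C x -> M a ->
  (forall i, a i 0 = 0 -> g t x a i 0 <= 0) -> a = 0 \/ forall i, 0 < a i 0.
Proof.
move=> t0 Cx Ma ha; have /order_intervalP aM := Ma.
have [_ irr] := gcoop t0 Cx order_interval_zero.
apply: (irreducible_zero_set irr) => [k|i j ai0 aj]; first by have /andP[] := aM k.
have ij : i != j by apply: contraTneq aj => <-; rewrite ai0 ltxx.
have Ms (s : R) : 0 <= s <= a j 0 -> M (s *: delta_mx j 0).
  move=> /andP[s0 sa]; apply/order_intervalP => k; rewrite !mxE eqxx andbT.
  have /andP[_ av] := aM j; have vk := v_gt0 k.
  by have [->|_] := eqVneq k j; rewrite ?mulr1 ?mulr0; apply/andP; split; lra.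
have gs (s : R) : 0 <= s <= a j 0 -> g t x (s *: delta_mx j 0) i 0 = 0.
  move=> sI; have /andP[s0 sa] := sI; apply/eqP; rewrite eq_le; apply/andP; split.
    apply: le_trans (ha i ai0); apply: g_monotone => //; first exact: Ms.
      move=> k; rewrite !mxE eqxx andbT; have /andP[ak _] := aM k.
      by have [->|_] := eqVneq k j; rewrite ?mulr1 ?mulr0.
    by rewrite !mxE (negbTE ij) mulr0.
  rewrite -[leLHS](_ : g t x 0 i 0 = 0); last by rewrite g0 // mxE.
  apply: g_monotone => //; [exact: Ms | exact: order_interval_zero | | ].
    by move=> k; rewrite !mxE mulr_ge0 // ler0n.
  by rewrite !mxE (negbTE ij) mulr0.
apply/eqP; rewrite -normr_le0; apply/ler_addgt0Pr => e e0; rewrite add0r.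
have [r r0 hr] := dmx0_continuous t i j Cx e0.
pose s := Num.min (a j 0) (r / 2).
have s0 : 0 < s by rewrite lt_min aj divr_gt0.
have sa : s <= a j 0 by rewrite ge_min lexx.
have sr : s <= r / 2 by rewrite ge_min lexx orbT.
have [_ dg _] := gC.
have [|c [cs]] := @mvt_line _ _ (fun z => g t x z i 0) 0 (delta_mx j 0) s.
  by move=> y; exact: dg.
rewrite add0r gs ?(ltW s0) // g0 // mxE subrr add0r.
move=> /esym/eqP; rewrite mulf_eq0 (gt_eqF s0) orbF => /eqP Dc.
have : `|c *: delta_mx j 0 : 'cV[R]_m| < r.
  have cI : `|c| <= s by rewrite ler_norml; case: cs => /andP[c0 c1]; apply/andP; split; lra.
  rewrite normrZ; apply: (@le_lt_trans _ _ `|c|); last lra.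
  rewrite ler_piMr // normr_mx_le // => k l; rewrite mxE.
  by case: (_ && _); rewrite ?normr1 ?normr0.
by move=> /hr; rewrite [X in _ - X]mxE Dc subr0 => /ltW.
Qed.

Lemma linear_irreducible t x a : 0 <= t -> C x -> (forall i, 0 <= a i 0) ->
  (forall i, a i 0 = 0 -> linear_part g t x a i 0 <= 0) -> a = 0 \/ forall i, 0 < a i 0.
Proof.
move=> t0 Cx ap ha; have [co irr] := gcoop t0 Cx order_interval_zero.
apply: (irreducible_zero_set irr ap) => i j ai0 aj.
have ij : i != j by apply: contraTneq aj => <-; rewrite ai0 ltxx.
apply/eqP/negPn/negP => Aij.
have A0 k : 0 <= dmx (g t x) 0 i k * a k 0.
  have [->|ki] := eqVneq k i; first by rewrite ai0 mulr0.
  by rewrite mulr_ge0 // co // eq_sym.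
have := ha i ai0; rewrite linear_partE (bigD1 j) //= leNgt => /negP; apply.
rewrite ltr_pwDl //; last by apply: sumr_ge0 => k _; exact: A0.
by rewrite mulr_gt0 // lt_neqAle eq_sym Aij co.
Qed.

(** Sublinearity is assumed for strictly positive states; the closed order
    interval is reached by moving slightly towards [v]. *)
Lemma g_sublinear t x u alpha i : 0 <= t -> C x -> M u -> 0 <= alpha <= 1 ->
  alpha * g t x u i 0 <= g t x (alpha *: u) i 0.
Proof.
move=> t0 Cx Mu /andP[a0 a1].
have [->|an0] := eqVneq alpha 0; first by rewrite mul0r scale0r g0 // mxE.
have [->|an1] := eqVneq alpha 1; first by rewrite mul1r scale1r.
have {an0}a0' : 0 < alpha by rewrite lt_neqAle eq_sym an0.
have {an1}a1' : alpha < 1 by rewrite lt_neqAle an1.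
have [L L0 hL] := g_lipschitz t `|v|.
have tI : 0 <= t <= t by rewrite t0 lexx.
have /order_intervalP uM := Mu.
apply/ler_addgt0Pr => e e0.
pose d := Num.min (1 / 2) (e / (2 * (L * `|v| + 1))).
have Lv : 0 < 2 * (L * `|v| + 1) by rewrite mulr_gt0 // ltr_wpDl // mulr_ge0.
have d0 : 0 < d by rewrite lt_min; apply/andP; split; [lra | exact: divr_gt0].
have d1 : d <= 1 / 2 by rewrite ge_min lexx.
have de : 2 * (L * `|v| * d) <= e.
  have : d <= e / (2 * (L * `|v| + 1)) by rewrite ge_min lexx orbT.
  rewrite ler_pdivlMr //; lra.
pose w : 'cV[R]_m := (1 - d) *: u + d *: v.
have wi k : w k 0 = u k 0 + d * (v k 0 - u k 0) by rewrite !mxE; ring.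
have Mw : M w.
  apply/order_intervalP => k; rewrite wi; have /andP[h1 h2] := uM k.
  by apply/andP; split; nra.
have w0 : vll 0 w.
  apply/vllP => k; rewrite mxE wi; have /andP[h1 h2] := uM k; have := v_gt0 k; nra.
have vn k : v k 0 <= `|v| by apply: le_trans (ler_norm _) (normr_coord_le v k 0).
have wu k : `|w k 0 - u k 0| <= d * `|v|.
  rewrite wi addrAC subrr add0r; have /andP[h1 h2] := uM k; have := vn k.
  by rewrite ger0_norm => [?|]; nra.
have wua k : `|(alpha *: w) k 0 - (alpha *: u) k 0| <= d * `|v|.
  have E (y : 'cV[R]_m) : (alpha *: y) k 0 = alpha * y k 0 by rewrite mxE.
  rewrite !E -mulrBr normrM (ger0_norm a0); apply: le_trans (wu k).
  by rewrite -[leRHS]mul1r ler_wpM2r.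
have aI : 0 <= alpha <= 1 by rewrite a0.
have h1 := hL t x w u i _ tI Cx (order_interval_norm Mw) (order_interval_norm Mu) wu.
have h2 := hL t x _ _ i _ tI Cx (order_interval_norm (order_interval_scale Mw aI))
  (order_interval_norm (order_interval_scale Mu aI)) wua.
have /vltP[/(_ i) + _] := gsub t0 Cx Mw w0 a0' a1'; rewrite mxE => h3.
move: h1 h2; rewrite !ler_norml => /andP[h4 h5] /andP[h6 h7].
have : alpha * g t x u i 0 <= alpha * (g t x w i 0 + L * (d * `|v|)).
  by apply: ler_wpM2l => //; lra.
have : alpha * (L * (d * `|v|)) <= L * (d * `|v|).
  by apply: ler_piMl => //; rewrite !mulr_ge0 // ltW.
rewrite mulrDr; nra.
Qed.

(** Dividing sublinearity by [alpha] and letting [alpha] tend to zero. *)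
Lemma g_le_linear t x u i : 0 <= t -> C x -> M u ->
  g t x u i 0 <= linear_part g t x u i 0.
Proof.
move=> t0 Cx Mu; have /order_intervalP uM := Mu.
apply/ler_addgt0Pr => e e0.
have s0 : 0 <= \sum_j u j 0 by apply: sumr_ge0 => j _; have /andP[] := uM j.
pose e' := e / (1 + \sum_j u j 0).
have e'0 : 0 < e' by rewrite divr_gt0 // ltr_pwDl.
have h j : exists r : R, 0 < r /\ forall z, `|z| < r ->
    `|dmx (g t x) 0 i j - dmx (g t x) z i j| < e'.
  by have [r r0 hr] := dmx0_continuous t i j Cx e'0; exists r.
have [f hf] := choice h.
have [j|r r0 hr] := @common_lower_bound R 'I_m f; first by have [] := hf j.
pose alpha := Num.min 1 (r / (2 * (`|v| + 1))).
have v1 : 0 < `|v| + 1 by rewrite ltr_wpDl.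
have a0 : 0 < alpha by rewrite lt_min ltr01 divr_gt0 // mulr_gt0.
have a1 : alpha <= 1 by rewrite ge_min lexx.
have ar : alpha * `|v| < r.
  have : alpha <= r / (2 * (`|v| + 1)) by rewrite ge_min lexx orbT.
  rewrite ler_pdivlMr ?mulr_gt0 // => har; nra.
have aI : 0 <= alpha <= 1 by rewrite ltW.
have [xi [xiI]] := g_mvt t (alpha *: u) 0 i Cx.
rewrite g0 // [X in _ - X]mxE subr0 => E.
have := g_sublinear i t0 Cx Mu aI; rewrite E.
have E' j : (alpha *: u) j 0 - (0 : 'cV[R]_m) j 0 = alpha * u j 0 by rewrite !mxE subr0.
under eq_bigr do rewrite E' mulrCA.
have -> : \sum_j alpha * (dmx (g t x) (xi j) i j * u j 0) =
    alpha * \sum_j dmx (g t x) (xi j) i j * u j 0 by rewrite mulr_sumr.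
rewrite ler_pM2l // => /le_trans; apply.
have -> : linear_part g t x u i 0 + e =
    linear_part g t x u i 0 + e' * \sum_j u j 0 + e'.
  by rewrite -addrA; congr (_ + _); rewrite /e'; field; rewrite gt_eqF // ltr_pwDl.
rewrite ler_wpDr ?(ltW e'0) // linear_partE mulr_sumr -big_split /=.
apply: ler_sum => j _; rewrite -mulrDl; apply: ler_wpM2r; first by have /andP[] := uM j.
have [_ /(_ (xi j))] := hf j; rewrite ltr_norml => h1.
suff /h1 /andP[] : `|xi j| < f j by lra.
apply: lt_le_trans (hr j); apply: le_lt_trans ar; apply: normr_mx_le.
  by rewrite mulr_ge0 // ltW.
move=> k l; rewrite ord1; have /andP[u0 uv] := uM k.
have vk : v k 0 <= `|v| by apply: le_trans (ler_norm _) (normr_coord_le v k 0).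
have := xiI j k; rewrite !mxE ler_norml.
by case=> /andP[h2 h3]; apply/andP; split; nra.
Qed.

End Kinetics.

Lemma pair_continuous (U V W : topologicalType) (f : U -> V) (h : U -> W) :
  continuous f -> continuous h -> continuous (fun x => (f x, h x)).
Proof. by move=> cf ch x; exact: (cvg_pair (cf x) (ch x)). Qed.

Lemma sub_continuous (R : realType) (U : topologicalType) n (f h : U -> 'rV[R]_n) :
  continuous f -> continuous h -> continuous (fun x => f x - h x).
Proof. by move=> cf ch x; apply: (@continuousB R 'rV[R]_n); [exact: cf | exact: ch]. Qed.

Lemma id_continuous (U : topologicalType) : continuous (fun x : U => x).
Proof. by move=> x; exact: cvg_id. Qed.

Lemma is_derive_coord (R : realType) m n (f : R -> 'M[R]_(m, n)) (D : 'M[R]_(m, n)) (t : R) i j :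
  is_derive t (1 : R) f D -> is_derive t (1 : R) (fun s => f s i j) (D i j).
Proof.
move=> [df fD]; split; first by have /derivable_mxP := df; exact.
by rewrite -fD derive_mx // mxE.
Qed.

Lemma is_derive_coordP (R : realType) m n (f : R -> 'M[R]_(m, n)) (D : 'M[R]_(m, n)) (t : R) :
  (forall i j, is_derive t (1 : R) (fun s => f s i j) (D i j)) -> is_derive t (1 : R) f D.
Proof.
move=> h; have df : derivable f t 1 by apply/derivable_mxP => i j; have [] := h i j.
split=> //; rewrite derive_mx //; apply/matrixP => i j; rewrite mxE.
by have [_ ->] := h i j.
Qed.

(** * The nonlocal operator *)

Section NonlocalOperator.
Context {R : realType} {m n : nat}.
Variables (Omega : set 'rV[R]_n) (K : 'I_m -> R -> 'rV[R]_n -> R) (d : 'cV[R]_m).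
Hypotheses (oOmega : open Omega) (bOmega : bounded_set Omega).
Hypothesis hd : forall i, 0 < d i 0.
Hypothesis Kcont : forall i, continuous (fun p : R * 'rV[R]_n => K i p.1 p.2).
Hypothesis Kge0 : forall i t x, 0 <= K i t x.
Hypothesis Kint : forall i t,
  (\int[lebesgue_tuple n]_y (K i t (row_of_tuple y))%:E = 1)%E.

Implicit Types (t s tau e B N : R) (x y : 'rV[R]_n) (w f : 'rV[R]_n -> R)
  (u : R -> 'rV[R]_n -> 'cV[R]_m).
Local Notation C := (closure Omega).
Local Notation bm := (bounded_measurable Omega).

Definition nonlocal i t x w : R := integralO Omega (fun y => K i t (x - y) * w y).

Lemma dispersalE u t x i : dispersal Omega K d u t x i 0 =
  d i 0 * nonlocal i t x (fun y => u t y i 0) - d i 0 * u t x i 0.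
Proof.
rewrite /dispersal mxE [X in _ + X]mxE !mul_diag_mx !mxE.
by [].
Qed.

Lemma kernel_section_continuous i t : continuous (K i t).
Proof.
move=> z; apply: (@continuous_comp _ _ _ (fun z : 'rV[R]_n => (t, z))
  (fun p : R * 'rV[R]_n => K i p.1 p.2)); last exact: Kcont.
by move: z; apply: pair_continuous; [exact: cst_continuous | exact: id_continuous].
Qed.

Lemma kernel_bounded_measurable i t x : bm (fun y => K i t (x - y)).
Proof.
apply: bounded_measurable_continuous => //; apply: continuous_subspaceT => z.
apply: (@continuous_comp _ _ _ (fun y : 'rV[R]_n => x - y) (K i t)).
  by move: z; apply: sub_continuous; [exact: cst_continuous | exact: id_continuous].
exact: kernel_section_continuous.
Qed.

Lemma kernel_mul_bounded_measurable i t x w : bm w -> bm (fun y => K i t (x - y) * w y).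
Proof. by apply: bounded_measurableM; exact: kernel_bounded_measurable. Qed.

Lemma nonlocal_ge0 i t x w : (forall y, Omega y -> 0 <= w y) -> 0 <= nonlocal i t x w.
Proof. by move=> w0; apply: integralO_ge0 => y /w0 h; rewrite mulr_ge0. Qed.

(** By the normalisation of [K], the kernel has mass at most one over the domain. *)
Lemma nonlocal_ge i t x w N : bm w -> 0 <= N -> (forall y, Omega y -> - N <= w y) ->
  - N <= nonlocal i t x w.
Proof.
move=> bw N0 wN.
have k1 : integralO Omega (fun y => K i t (x - y)) <= 1.
  by apply: kernel_integralO_le1 => //; exact: kernel_section_continuous.
apply: (@le_trans _ _ (integralO Omega (fun y => - N * K i t (x - y)))).
  rewrite integralOZ //; last exact: kernel_bounded_measurable.
  by rewrite mulNr lerN2 ler_piMr.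
apply: le_integralO => //; [| exact: kernel_mul_bounded_measurable |].
  by apply: bounded_measurableZ; exact: kernel_bounded_measurable.
by move=> y /wN h; rewrite mulrC; apply: ler_wpM2l.
Qed.

Lemma nonlocalZ i t x w a : bm w -> nonlocal i t x (fun y => a * w y) = a * nonlocal i t x w.
Proof.
move=> bw; rewrite -integralOZ //; last exact: kernel_mul_bounded_measurable.
by apply: eq_integralO => y _; rewrite mulrCA.
Qed.

Lemma nonlocalB i t x w f : bm w -> bm f ->
  nonlocal i t x (fun y => w y - f y) = nonlocal i t x w - nonlocal i t x f.
Proof.
move=> bw bf; rewrite -integralOB //; try exact: kernel_mul_bounded_measurable.
by apply: eq_integralO => y _; rewrite mulrBr.
Qed.

Lemma nonlocal_le i t x w N : bm w -> 0 <= N -> (forall y, Omega y -> w y <= N) ->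
  nonlocal i t x w <= N.
Proof.
move=> bw N0 wN; have := @nonlocal_ge i t x (fun y => -1 * w y) N.
rewrite nonlocalZ // mulN1r lerN2; apply => //; first exact: bounded_measurableZ.
by move=> y /wN; rewrite mulN1r lerN2.
Qed.

Lemma normr_nonlocal_le i t x w N : bm w -> 0 <= N ->
  (forall y, Omega y -> `|w y| <= N) -> `|nonlocal i t x w| <= N.
Proof.
move=> bw N0 wN; rewrite ler_norml nonlocal_ge ?nonlocal_le //;
  by move=> y /wN; rewrite ler_norml => /andP[].
Qed.

Lemma kernel_uniform i a b e : 0 < e -> exists2 r, 0 < r & forall t s x z y,
  a <= t <= b -> a <= s <= b -> C x -> C z -> C y -> `|t - s| < r -> ball x r z ->
  `|K i t (x - y) - K i s (z - y)| < e.
Proof.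
move=> e0.
pose A : set (R * 'rV[R]_n * 'rV[R]_n) := (`[a, b]%classic `*` C) `*` C.
have cA : compact A.
  by do ! apply: compact_setX => //; do ? exact: bounded_closure_compact; exact: segment_compact.
have cf : continuous (fun p : R * 'rV[R]_n * 'rV[R]_n => K i p.1.1 (p.1.2 - p.2)).
  move=> p; apply: (@continuous_comp _ _ _
    (fun p : R * 'rV[R]_n * 'rV[R]_n => (p.1.1, p.1.2 - p.2))
    (fun p : R * 'rV[R]_n => K i p.1 p.2)); last exact: Kcont.
  have c1 (U V : topologicalType) : continuous (@fst U V) by move=> q; exact: cvg_fst.
  have c2 (U V : topologicalType) : continuous (@snd U V) by move=> q; exact: cvg_snd.
  move: p; apply: pair_continuous => [p|].
    by apply: (@continuous_comp _ _ _ fst fst); [exact: c1 | exact: c1].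
  apply: sub_continuous => [p|]; last exact: c2.
  by apply: (@continuous_comp _ _ _ fst snd); [exact: c1 | exact: c2].
have [r r0 h] := compact_uniform_continuity cA (continuous_subspaceT cf) e0.
exists r => // t s x z y tI sI Cx Cz Cy ts xz.
have mA q p : a <= q <= b -> C p -> A (q, p, y).
  by move=> qI Cp; split; [split => //=; rewrite in_itv | ].
apply: (h (t, x, y) (s, z, y)); [exact: mA | exact: mA | ].
by split; [split | exact: ballxx].
Qed.

Lemma nonlocal_diff i t s x z w f B e eta : bm w -> bm f ->
  (forall y, Omega y -> `|w y| <= B) -> 0 <= eta ->
  (forall y, Omega y -> `|w y - f y| <= eta) ->
  (forall y, Omega y -> `|K i t (x - y) - K i s (z - y)| <= e) ->
  `|nonlocal i t x w - nonlocal i s z f| <= e * B * volumeO Omega + eta.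
Proof.
move=> bw bf wB eta0 wf Ke.
have -> : nonlocal i t x w - nonlocal i s z f =
    integralO Omega (fun y => (K i t (x - y) - K i s (z - y)) * w y) +
    nonlocal i s z (fun y => w y - f y).
  rewrite nonlocalB // (_ : integralO _ _ = nonlocal i t x w - nonlocal i s z w); first by ring.
  rewrite -integralOB //; try exact: kernel_mul_bounded_measurable.
  by apply: eq_integralO => y _; rewrite mulrBl.
apply: le_trans (ler_normD _ _) _; apply: lerD.
  apply: normr_integralO_le => //.
    apply: bounded_measurableM => //.
    by apply: bounded_measurableB => //; exact: kernel_bounded_measurable.
  by move=> y Oy; rewrite normrM; apply: ler_pM => //; [exact: Ke | exact: wB].
by apply: normr_nonlocal_le => //; exact: bounded_measurableB.
Qed.

Lemma slice_continuous (A : set R) u t : A t ->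
  {within [set p : R * 'rV[R]_n | A p.1 /\ C p.2], continuous (fun p => u p.1 p.2)} ->
  forall i, {within C, continuous (fun y => u t y i 0)}.
Proof.
move=> At cu i; apply: (within_continuous_comp (h := fun y => (t, y)) _ _ (within_coord (i := i) (j := 0) cu)).
  by apply: continuous_subspaceT; apply: pair_continuous; [exact: cst_continuous | exact: id_continuous].
by move=> y Cy.
Qed.

Lemma path_continuous (A : set R) u x : C x ->
  {within [set p : R * 'rV[R]_n | A p.1 /\ C p.2], continuous (fun p => u p.1 p.2)} ->
  forall i, {within A, continuous (fun t => u t x i 0)}.
Proof.
move=> Cx cu i; apply: (within_continuous_comp (h := fun t => (t, x)) _ _ (within_coord (i := i) (j := 0) cu)).
  by apply: continuous_subspaceT; apply: pair_continuous; [exact: id_continuous | exact: cst_continuous].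
by move=> y Cy.
Qed.

Lemma slab_bounded a b u :
  {within [set p : R * 'rV[R]_n | a <= p.1 <= b /\ C p.2], continuous (fun p => u p.1 p.2)} ->
  exists2 B, 0 <= B & forall t x i, a <= t <= b -> C x -> `|u t x i 0| <= B.
Proof.
move=> cu; have cK : compact [set p : R * 'rV[R]_n | a <= p.1 <= b /\ C p.2].
  rewrite (_ : [set p | _] = `[a, b]%classic `*` C); last first.
    by apply/seteqP; split=> p /=; rewrite in_itv.
  by apply: compact_setX; [exact: segment_compact | exact: bounded_closure_compact].
have [B B0 hB] := compact_within_bounded cK cu; exists B => // t x i tI Cx.
by apply: le_trans (normr_coord_le _ i 0) _; apply: (hB (t, x)).
Qed.

Definition regular tau u := [/\
  forall x i, C x -> {within `[0, tau]%classic, continuous (fun t => u t x i 0)},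
  exists B, forall t x i, 0 <= t <= tau -> C x -> `|u t x i 0| <= B &
  forall t i, 0 <= t <= tau -> bm (fun y => u t y i 0)].

Lemma continuous_regular tau u :
  {within [set p : R * 'rV[R]_n | 0 <= p.1 /\ C p.2], continuous (fun p => u p.1 p.2)} ->
  regular tau u.
Proof.
move=> cu.
have cu' : {within [set p : R * 'rV[R]_n | 0 <= p.1 <= tau /\ C p.2],
    continuous (fun p => u p.1 p.2)}.
  by apply: continuous_subspaceW cu => p /= [/andP[]].
split.
- move=> x i Cx; have := path_continuous Cx (A := [set t | 0 <= t <= tau]) cu' (i := i).
  by apply: continuous_subspaceW => t /=; rewrite in_itv.
- by have [B _ hB] := slab_bounded cu'; exists B.
- move=> t i tI; apply: bounded_measurable_continuous => //.
  exact: (slice_continuous (A := [set t | 0 <= t <= tau]) tI cu' (i := i)).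
Qed.

Variable F : R -> 'rV[R]_n -> 'cV[R]_m -> 'cV[R]_m.

(** All points and components are compared at once, so that the drop [N] of
    [u - w] also bounds the drop of its nonlocal average. *)
Lemma evolution_comparison (Bset : set 'cV[R]_m) tau L (u w du dw : R -> 'rV[R]_n -> 'cV[R]_m) :
  0 <= L -> quasi_monotone C Bset tau L F -> regular tau u -> regular tau w ->
  (forall t x, 0 < t < tau -> C x -> is_derive t (1 : R) (fun s => u s x) (du t x)) ->
  (forall t x, 0 < t < tau -> C x -> is_derive t (1 : R) (fun s => w s x) (dw t x)) ->
  (forall t x, 0 < t < tau -> C x -> Bset (u t x) /\ Bset (w t x)) ->
  (forall t x i, 0 < t < tau -> C x ->
     dispersal Omega K d u t x i 0 + F t x (u t x) i 0 <= du t x i 0) ->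
  (forall t x i, 0 < t < tau -> C x ->
     dw t x i 0 <= dispersal Omega K d w t x i 0 + F t x (w t x) i 0) ->
  (forall x i, C x -> w 0 x i 0 <= u 0 x i 0) ->
  forall t x i, 0 <= t <= tau -> C x -> w t x i 0 <= u t x i 0.
Proof.
move=> L0 qm [uc [Bu hBu] ub] [wc [Bw hBw] wb] du_ dw_ Bs su sw init t x i tI Cx.
pose I := ({x : 'rV[R]_n | C x} * 'I_m)%type.
pose z t (a : I) := u t (sval a.1) a.2 0 - w t (sval a.1) a.2 0.
pose dz t (a : I) := du t (sval a.1) a.2 0 - dw t (sval a.1) a.2 0.
rewrite -subr_ge0 -[leRHS]/(z t (exist _ x Cx, i)).
pose D := \sum_i d i 0.
have dD j : d j 0 <= D.
  by rewrite /D (bigD1 j) //= lerDl sumr_ge0 // => k _; rewrite ltW.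
have D0 : 0 <= D by apply: sumr_ge0 => k _; rewrite ltW.
apply: (@comparison_principle R I tau (D + L) (Bu + Bw) z dz) => //.
- exact: addr_ge0.
- move=> [[y Cy] j] s; apply: cvgB; [exact: uc | exact: wc].
- move=> s [[y Cy] j] sI; apply: is_deriveB.
    exact: (is_derive_coord j 0 (du_ s y sI Cy)).
  exact: (is_derive_coord j 0 (dw_ s y sI Cy)).
- move=> s [[y Cy] j] sI; rewrite /z /=.
  have := hBu s y j sI Cy; have := hBw s y j sI Cy.
  rewrite !ler_norml => /andP[h1 h2] /andP[h3 h4]; lra.
- by move=> [[y Cy] j]; rewrite /z /= subr_ge0 init.
move=> s N [[y Cy] j] sI N0 zN; rewrite /z /dz /= => zle.
have sI' : 0 <= s <= tau by have /andP[h1 h2] := sI; rewrite !ltW.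
have [Bsu Bsw] := Bs s y sI Cy.
have := su s y j sI Cy; have := sw s y j sI Cy; rewrite !dispersalE => h1 h2.
have h3 : - (L * N) <= F s y (u s y) j 0 - F s y (w s y) j 0.
  apply: qm => //; last by apply: le_trans N0.
  by move=> k; exact: (zN (exist _ y Cy, k)).
have h4 : - N <= nonlocal j s y (fun y => u s y j 0) - nonlocal j s y (fun y => w s y j 0).
  rewrite -nonlocalB //; [|exact: ub|exact: wb].
  apply: nonlocal_ge => //; first by apply: bounded_measurableB; [exact: ub|exact: wb].
  by move=> q /subset_closure Cq; exact: (zN (exist _ q Cq, j)).
have dj := hd j; have := dD j.
set A := nonlocal j s y (fun y => u s y j 0) in h2 h4.
set A' := nonlocal j s y (fun y => w s y j 0) in h1 h4.
have : - (D * N) <= d j 0 * (A - A').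
  have : d j 0 * (- N) <= d j 0 * (A - A') by rewrite ler_pM2l.
  have := ler_wpM2r N0 (dD j); lra.
have : 0 <= - d j 0 * (u s y j 0 - w s y j 0) by rewrite mulr_le0 // oppr_le0 ltW.
lra.
Qed.

End NonlocalOperator.

(** * Existence by Picard iteration *)

Section ScalarTools.
Context {R : realType}.
Implicit Types (f df h : R -> R) (a b t B : R).

Lemma derivable_increment_le f df a b B : a <= b ->
  (forall t, a <= t <= b -> is_derive t (1 : R) f (df t)) ->
  (forall t, a <= t <= b -> `|df t| <= B) -> `|f b - f a| <= B * (b - a).
Proof.
move=> ab fd dB.
have fd' x : x \in `]a, b[ -> is_derive x (1 : R) f (df x).
  by rewrite in_itv /= => /andP[h1 h2]; apply: fd; rewrite !ltW.
have [|c] := MVT_segment ab fd'.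
  by apply: derivable_within_continuous => t; rewrite in_itv /= => tI; have [] := fd t tI.
rewrite in_itv /= => cI ->; rewrite normrM (@ger0_norm _ (b - a)) ?subr_ge0 //.
by apply: ler_wpM2r; [rewrite subr_ge0 | exact: dB].
Qed.

Lemma max0_distance t (s : R) : `|Num.max t 0 - Num.max s 0| <= `|t - s|.
Proof.
have := ler_norm (t - s); have := ler_norm (s - t); rewrite (distrC s t) => a1 a2.
case: (leP t 0) => tt; case: (leP s 0) => ss; rewrite ?subrr ?normr0 // ?ler_norml;
  by apply/andP; split; lra.
Qed.

Local Notation mu := (@lebesgue_measure R).

Definition primitive h t : R :=
  \int[mu]_(s in `[- (1 : R), t]) h s - \int[mu]_(s in `[- (1 : R), 0]) h s.

Lemma primitive0 h : primitive h 0 = 0.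
Proof. exact: subrr. Qed.

(** The base point [-1] makes time [0] interior. *)
Lemma is_derive_primitive h t : continuous h -> - 1 < t ->
  is_derive t (1 : R) (primitive h) (h t).
Proof.
move=> ch t1.
have ih : mu.-integrable `[- (1 : R), t + 1] (EFin \o h).
  apply: continuous_compact_integrable; first exact: segment_compact.
  exact: continuous_subspaceT.
have tt : t < t + 1 by rewrite ltrDl.
have [dF FE] := continuous_FTC1_closed tt ih t1 (ch t).
have d1 : is_derive t (1 : R) (fun t => \int[mu]_(s in `[- (1 : R), t]) h s) (h t).
  by split; [exact: dF | rewrite -FE derive1E].
have := is_deriveB d1 (is_derive_cst (\int[mu]_(s in `[- (1 : R), 0]) h s) t (1 : R)).
by rewrite subr0.
Qed.

Lemma is_derive_expRM (y t : R) :
  is_derive t (1 : R) (fun s => expR (y * s)) (y * expR (y * t)).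
Proof.
have -> : y * expR (y * t) = expR (y * t) *: (y * 1) by rewrite /GRing.scale /=; ring.
by apply: is_derive1_comp.
Qed.

Lemma is_deriveMl (c t : R) f (D : R) : is_derive t (1 : R) f D ->
  is_derive t (1 : R) (fun s => c * f s) (c * D).
Proof. by move=> h; exact: (@is_deriveZ R R R f c t 1 D h). Qed.

Lemma geometric_limit (a : nat -> R) (A : R) :
  (forall k, `|a k.+1 - a k| <= A / 2 ^+ k) ->
  cvgn a /\ forall k, `|limn a - a k| <= 2 * A / 2 ^+ k.
Proof.
move=> ha.
have A0 : 0 <= A by have := le_trans (normr_ge0 _) (ha 0%N); rewrite expr0 divr1.
have step k : A / 2 ^+ k = 2 * A / 2 ^+ k - 2 * A / 2 ^+ k.+1.
  by rewrite exprS invfM; move: (2 ^+ k)^-1 => q; lra.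
have p0 k : 0 <= 2 * A / 2 ^+ k by rewrite divr_ge0 ?mulr_ge0 // exprn_ge0.
have far j k : (k <= j)%N -> `|a j - a k| <= 2 * A / 2 ^+ k - 2 * A / 2 ^+ j.
  move=> /subnK <-; elim: (j - k)%N => [|p IHp]; first by rewrite add0n !subrr normr0.
  rewrite addSn; have := ha (p + k)%N; rewrite step.
  move: IHp; rewrite !ler_norml => /andP[h1 h2] /andP[h3 h4].
  apply/andP; split; lra.
have ndb : nondecreasing_seq (fun k => a k - 2 * A / 2 ^+ k).
  apply/nondecreasing_seqP => k; have := ha k; rewrite step ler_norml => /andP[h1 h2]; lra.
have ubb : has_ubound (range (fun k => a k - 2 * A / 2 ^+ k)).
  exists (a 0%N + 2 * A) => _ [k _ <-].
  have := far k 0%N (leq0n k); rewrite expr0 divr1 ler_norml => /andP[h1 h2].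
  have := p0 k; lra.
have c0 : (2 * A / 2 ^+ k) @[k --> \oo] --> (0 : R).
  have := @cvg_geometric R (2 * A) (2^-1); rewrite ger0_norm ?invr_ge0 // invf_lt1 ?ltr1n //.
  move=> /(_ isT); apply: cvg_trans; apply: near_eq_cvg; apply: nearW => k.
  by rewrite /geometric /= exprVn.
have ca : cvgn a.
  have h : (a k - 2 * A / 2 ^+ k) + 2 * A / 2 ^+ k @[k --> \oo] -->
      sup (range (fun k => a k - 2 * A / 2 ^+ k)) + 0.
    by apply: cvgD => //; exact: nondecreasing_cvgn.
  apply/cvg_ex; eexists; move: h; apply: cvg_trans; apply: near_eq_cvg.
  by apply: nearW => k /=; rewrite subrK.
split=> // k; have cak : `|a j - a k| @[j --> \oo] --> `|limn a - a k|.
  by apply: cvg_norm; apply: cvgB; [exact: ca | exact: cvg_cst].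
apply: (cvgr_to_le cak); exists k => // j /= kj.
by apply: le_trans (far _ _ kj) _; rewrite gerBl.
Qed.

End ScalarTools.

Section Picard.
Context {R : realType} {m n : nat}.
Variables (Omega : set 'rV[R]_n) (K : 'I_m -> R -> 'rV[R]_n -> R) (d : 'cV[R]_m).
Hypotheses (oOmega : open Omega) (bOmega : bounded_set Omega).
Hypothesis hd : forall i, 0 < d i 0.
Hypothesis Kcont : forall i, continuous (fun p : R * 'rV[R]_n => K i p.1 p.2).
Hypothesis Kge0 : forall i t x, 0 <= K i t x.
Hypothesis Kint : forall i t,
  (\int[lebesgue_tuple n]_y (K i t (row_of_tuple y))%:E = 1)%E.
Variable G : R -> 'rV[R]_n -> 'cV[R]_m -> 'cV[R]_m.

Implicit Types (t s tau e B N L : R) (x y z : 'rV[R]_n) (i j : 'I_m)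
  (u w : R -> 'rV[R]_n -> 'cV[R]_m).
Local Notation C := (closure Omega).
Local Notation bm := (bounded_measurable Omega).
Local Notation cyl u := {within cylinder Omega, continuous (fun p => u p.1 p.2)}.

Definition rhs u t x : 'cV[R]_m := dispersal Omega K d u t x + G t x (u t x).

Lemma rhsE u t x i : rhs u t x i 0 =
  d i 0 * nonlocal Omega K i t x (fun y => u t y i 0) - d i 0 * u t x i 0 + G t x (u t x) i 0.
Proof. by rewrite /rhs mxE dispersalE. Qed.

Lemma cyl_slab a b u : cyl u ->
  {within [set p : R * 'rV[R]_n | a <= p.1 <= b /\ C p.2], continuous (fun p => u p.1 p.2)}.
Proof. by apply: continuous_subspaceW => p []. Qed.

Lemma cyl_bm u t i : cyl u -> bm (fun y => u t y i 0).
Proof.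
move=> cu; apply: bounded_measurable_continuous => //.
have cu' : {within [set p : R * 'rV[R]_n | setT p.1 /\ C p.2], continuous (fun p => u p.1 p.2)}.
  by apply: continuous_subspaceW cu => p [].
exact: (slice_continuous (A := setT) (t := t) I cu' (i := i)).
Qed.

Lemma cyl_path u x i : cyl u -> C x -> continuous (fun t => u t x i 0).
Proof.
move=> cu Cx; apply/continuous_subspace_setT.
have cu' : {within [set p : R * 'rV[R]_n | setT p.1 /\ C p.2], continuous (fun p => u p.1 p.2)}.
  by apply: continuous_subspaceW cu => p [].
exact: (path_continuous Cx cu' (i := i)).
Qed.

Lemma cyl_uniform u a b i e : cyl u -> 0 < e -> exists2 r, 0 < r &
  forall t s x y, a <= t <= b -> a <= s <= b -> C x -> C y -> `|t - s| < r -> ball x r y ->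
  `|u t x i 0 - u s y i 0| < e.
Proof.
move=> cu e0; have cK : compact (`[a, b]%classic `*` C).
  by apply: compact_setX; [exact: segment_compact | exact: bounded_closure_compact].
have cu' : {within (`[a, b]%classic `*` C), continuous (fun p : R * 'rV[R]_n => u p.1 p.2 i 0)}.
  by apply: within_coord; apply: continuous_subspaceW cu => p [].
have [r r0 h] := compact_uniform_continuity cK cu' e0.
exists r => // t s x y tI sI Cx Cy ts xy.
by apply: (h (t, x) (s, y)) => //; split => //=; rewrite in_itv.
Qed.

Lemma nonlocal_continuous u i : cyl u ->
  {within cylinder Omega, continuous (fun p => nonlocal Omega K i p.1 p.2 (fun y => u p.1 y i 0))}.
Proof.
move=> cu; apply/within_continuous_epsP => -[t x] Cx e e0.
have tI : t - 1 <= t <= t + 1 by rewrite gerBl lerDl ler01.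
have [B B0 hB] := slab_bounded bOmega (cyl_slab (a := t - 1) (b := t + 1) cu).
have V0 := volumeO_ge0 Omega; set V := volumeO Omega in V0.
have BV : 0 < B * V + 1 by rewrite ltr_wpDl // mulr_ge0.
pose e1 := e / (3 * (B * V + 1)).
have e10 : 0 < e1 by rewrite divr_gt0 // mulr_gt0.
have e1E : e1 * B * V <= e / 3.
  have -> : e / 3 = e1 * (B * V + 1).
    by rewrite /e1; field; rewrite (gt_eqF BV).
  by rewrite -mulrA ler_pM2l //; lra.
have [r1 r10 h1] := kernel_uniform bOmega Kcont i (t - 1) (t + 1) e10.
have e30 : 0 < e / 3 by rewrite divr_gt0.
have [r2 r20 h2] := cyl_uniform (t - 1) (t + 1) i cu e30.
exists (Num.min 1 (Num.min r1 r2)); first by rewrite !lt_min ltr01 r10.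
move=> [s z] /= Cz [/= ts xz].
have ts' : `|t - s| < 1 /\ `|t - s| < r1 /\ `|t - s| < r2.
  by move: ts; rewrite /ball /= !lt_min => /andP[-> /andP[-> ->]].
have [ts1 [ts2 ts3]] := ts'.
have sI : t - 1 <= s <= t + 1.
  by move: ts1; rewrite ltr_norml => /andP[a1 a2]; apply/andP; split; lra.
apply: (@le_lt_trans _ _ (e1 * B * V + e / 3)); last lra.
apply: nonlocal_diff => //; try exact: cyl_bm.
- by move=> y /subset_closure Cy; exact: hB.
- exact: ltW.
- by move=> y /subset_closure Cy; apply/ltW/h2 => //; exact: ballxx.
- move=> y /subset_closure Cy; apply/ltW/h1 => //.
  by apply: le_ball xz; rewrite ge_min; apply/orP; right; rewrite ge_min lexx.
Qed.

Hypothesis Gc : {within [set p : R * 'rV[R]_n * 'cV[R]_m | C p.1.2],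
  continuous (fun p => G p.1.1 p.1.2 p.2)}.

Lemma rhs_continuous u : cyl u -> cyl (rhs u).
Proof.
move=> cu; apply: within_coordP => i j; rewrite ord1.
have E : (fun p => rhs u p.1 p.2 i 0) = (fun p =>
   d i 0 * nonlocal Omega K i p.1 p.2 (fun y => u p.1 y i 0) - d i 0 * u p.1 p.2 i 0 +
   G p.1 p.2 (u p.1 p.2) i 0) by apply/funext => p; exact: rhsE.
rewrite E => p; apply: cvgD; first apply: cvgB.
- by apply: cvgM; [exact: cvg_cst | exact: nonlocal_continuous].
- by apply: cvgM; [exact: cvg_cst | exact: within_coord].
- move: p; apply: (within_continuous_comp (h := fun p : R * 'rV[R]_n => (p, u p.1 p.2)) _ _
    (within_coord (i := i) (j := 0) Gc)) => //.
  by apply: within_continuous_pair => //; apply: continuous_subspaceT; exact: id_continuous.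
Qed.

Variable phi : 'rV[R]_n -> 'cV[R]_m.
Hypothesis phic : {within C, continuous phi}.

(** Freezing time before [0] keeps every iterate continuous on the whole
    cylinder. *)
Definition picard u t x : 'cV[R]_m :=
  phi x + \col_i primitive (fun s => rhs u s x i 0) (Num.max t 0).

Lemma picardE u t x i :
  picard u t x i 0 = phi x i 0 + primitive (fun s => rhs u s x i 0) (Num.max t 0).
Proof. by rewrite !mxE. Qed.

Lemma is_derive_picard_primitive u x i t : cyl u -> C x -> 0 <= t ->
  is_derive t (1 : R) (primitive (fun s => rhs u s x i 0)) (rhs u t x i 0).
Proof.
move=> cu Cx t0; apply: is_derive_primitive; last lra.
by apply: cyl_path => //; exact: rhs_continuous.
Qed.

Lemma picard_primitive_increment u x i tau B a b : cyl u -> C x ->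
  (forall t, 0 <= t <= tau -> `|rhs u t x i 0| <= B) -> 0 <= a <= tau -> 0 <= b <= tau ->
  `|primitive (fun s => rhs u s x i 0) b - primitive (fun s => rhs u s x i 0) a| <= B * `|b - a|.
Proof.
move=> cu Cx hB; wlog ab : a b / a <= b.
  move=> H aI bI; have [ab|ba] := leP a b; first exact: H.
  by rewrite distrC (distrC b); apply: H => //; exact: ltW.
move=> /andP[a0 _] /andP[_ bt]; rewrite (@ger0_norm _ (b - a)) ?subr_ge0 //.
apply: (@derivable_increment_le _ _ (fun s => rhs u s x i 0)) => // q /andP[aq qb].
  by apply: is_derive_picard_primitive => //; exact: le_trans aq.
by apply: hB; rewrite (le_trans a0 aq) (le_trans qb bt).
Qed.

Lemma picard_primitive_diff u w x y i eta t : cyl u -> cyl w -> C x -> C y -> 0 <= t ->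
  (forall s, 0 <= s <= t -> `|rhs u s x i 0 - rhs w s y i 0| <= eta) ->
  `|primitive (fun s => rhs u s x i 0) t - primitive (fun s => rhs w s y i 0) t| <= eta * t.
Proof.
move=> cu cw Cx Cy t0 h.
have := @derivable_increment_le _
  (fun t => primitive (fun s => rhs u s x i 0) t - primitive (fun s => rhs w s y i 0) t)
  (fun s => rhs u s x i 0 - rhs w s y i 0) 0 t eta t0.
rewrite !primitive0 subrr !subr0; apply => // s /andP[s0 _].
by apply: is_deriveB; exact: is_derive_picard_primitive.
Qed.

Lemma picard_continuous u : cyl u -> cyl (picard u).
Proof.
move=> cu; have cr := rhs_continuous cu.
apply: within_coordP => i j; rewrite ord1; apply/within_continuous_epsP => -[t x] /= Cx e e0.
pose tau := Num.max t 0 + 1.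
have tau0 : 0 < tau by rewrite ltr_pwDr // le_max lexx orbT.
have [B B0 hB] := slab_bounded bOmega (cyl_slab (a := 0) (b := tau) cr).
have e30 : 0 < e / 3 by rewrite divr_gt0.
have et0 : 0 < e / 3 / tau by rewrite divr_gt0.
have [r1 r10 h1] := cyl_uniform 0 tau i cr et0.
have phii : {within C, continuous (fun x => phi x i 0)} by exact: within_coord.
have /within_continuous_epsP := phii; move=> /(_ x Cx _ e30) [r2 r20 h2].
have B1 : 0 < B + 1 by rewrite ltr_wpDl.
have [r3 r30 r3E] : exists2 r3, 0 < r3 & B * r3 < e / 3.
  exists (e / 3 / (B + 1)); first by rewrite divr_gt0.
  by rewrite mulrA ltr_pdivrMr // mulrC ltr_pM2l // ltrDl.
exists (Num.min (Num.min 1 r3) (Num.min r1 r2)); first by rewrite !lt_min ltr01 r10 r20 r30.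
move=> [s z] /= Cz [/= ts xz].
have [ts1 ts3] : `|t - s| < 1 /\ `|t - s| < r3.
  by move: ts; rewrite /ball /= !lt_min => /andP[/andP[-> ->] _].
have xz1 : ball x r1 z.
  by apply: le_ball xz; rewrite ge_min; apply/orP; right; rewrite ge_min lexx.
have xz2 : ball x r2 z.
  by apply: le_ball xz; rewrite ge_min; apply/orP; right; rewrite ge_min lexx orbT.
rewrite !picardE; have := max0_distance t s; rewrite /tau in tau0 hB et0 h1 *.
have : 0 <= Num.max t 0 by rewrite le_max lexx orbT.
have : 0 <= Num.max s 0 by rewrite le_max lexx orbT.
move: (Num.max t 0) (Num.max s 0) tau0 hB et0 h1 => t' s' tau0 hB et0 h1 s'0 t'0 ts'.
have s'tau : s' <= t' + 1.
  have := le_lt_trans ts' ts1; rewrite ltr_norml => /andP[a1 _].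
  by rewrite -lerBlDl; rewrite ltrNl opprB in a1; exact: ltW.
have P1 := picard_primitive_increment (i := i) (a := s') (b := t') cu Cx
  (fun q qI => hB q x i qI Cx).
have P2 := picard_primitive_diff (i := i) (eta := e / 3 / (t' + 1)) cu cu Cx Cz s'0.
have {}P1 : `|primitive (fun s => rhs u s x i 0) t' - primitive (fun s => rhs u s x i 0) s'| < e / 3.
  have I1 : 0 <= s' <= t' + 1 by rewrite s'0.
  have I2 : 0 <= t' <= t' + 1 by rewrite t'0 lerDl ler01.
  apply: le_lt_trans (P1 I1 I2) _.
  by apply: le_lt_trans r3E; apply: ler_wpM2l => //; exact: le_trans ts' (ltW ts3).
have {}P2 : `|primitive (fun s => rhs u s x i 0) s' - primitive (fun s => rhs u s z i 0) s'| <= e / 3.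
  apply: le_trans (P2 _) _ => [q /andP[q0 qs]|].
    have qI : 0 <= q <= t' + 1 by rewrite q0 (le_trans qs).
    by apply/ltW/h1 => //; rewrite subrr normr0.
  by rewrite mulrAC ler_pdivrMr // ler_wpM2l // ltW.
have := h2 z Cz xz2; move: P1 P2; clear.
set P := primitive _ _; set P' := primitive _ _; set Q := primitive _ _ => P1 P2 P3.
rewrite (_ : _ - _ = (phi x i 0 - phi z i 0) + ((P - P') + (P' - Q))); last by ring.
apply: le_lt_trans (ler_normD _ _) _.
have : `|P - P' + (P' - Q)| < e / 3 + e / 3.
  by apply: le_lt_trans (ler_normD _ _) _; exact: ltr_leD.
lra.
Qed.

Lemma rhs_diff_le u w t x i N L : 0 <= N -> C x ->
  (forall j, bm (fun y => u t y j 0)) -> (forall j, bm (fun y => w t y j 0)) ->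
  (forall y j, C y -> `|u t y j 0 - w t y j 0| <= N) ->
  `|G t x (u t x) i 0 - G t x (w t x) i 0| <= L * N ->
  `|rhs u t x i 0 - rhs w t x i 0| <= (2 * (\sum_j d j 0) + L) * N.
Proof.
move=> N0 Cx bu bw uw GL; rewrite !rhsE.
have dD : d i 0 <= \sum_j d j 0.
  by rewrite (bigD1 i) //= lerDl sumr_ge0 // => j _; rewrite ltW.
have di : 0 <= d i 0 by exact: ltW.
have J : `|nonlocal Omega K i t x (fun y => u t y i 0) -
           nonlocal Omega K i t x (fun y => w t y i 0)| <= N.
  rewrite -nonlocalB //; apply: normr_nonlocal_le => //; first exact: bounded_measurableB.
  by move=> y /subset_closure Cy; exact: uw.
have U := uw x i Cx.
set a := nonlocal _ _ _ _ _ _ in J *; set b := nonlocal _ _ _ _ _ _ in J *.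
rewrite (_ : _ - _ = d i 0 * (a - b) - d i 0 * (u t x i 0 - w t x i 0) +
  (G t x (u t x) i 0 - G t x (w t x) i 0)); last by ring.
have h1 : `|d i 0 * (a - b)| <= (\sum_j d j 0) * N.
  by rewrite normrM (ger0_norm di); apply: ler_pM.
have h2 : `|d i 0 * (u t x i 0 - w t x i 0)| <= (\sum_j d j 0) * N.
  by rewrite normrM (ger0_norm di); apply: ler_pM.
set S := \sum_j _ in h1 h2 *; rewrite (_ : (2 * S + L) * N = S * N + S * N + L * N); last by ring.
apply: le_trans (ler_normD _ _) _; apply: lerD => //.
by apply: le_trans (ler_normB _ _) _; apply: lerD.
Qed.

(** The exponential weight makes the Picard operator halve distances on any
    bounded time interval. *)
Lemma picard_contraction tau Gam A u w : 0 < Gam -> 0 <= A -> cyl u -> cyl w ->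
  (forall t x i N, 0 <= t <= tau -> C x -> 0 <= N ->
     (forall y j, C y -> `|u t y j 0 - w t y j 0| <= N) ->
     `|rhs u t x i 0 - rhs w t x i 0| <= Gam * N) ->
  (forall t x i, 0 <= t <= tau -> C x ->
     `|u t x i 0 - w t x i 0| <= A * expR (2 * Gam * t)) ->
  forall t x i, 0 <= t <= tau -> C x ->
    `|picard u t x i 0 - picard w t x i 0| <= A / 2 * expR (2 * Gam * t).
Proof.
move=> Gam0 A0 cu cw rl uw t x i tI Cx; have /andP[t0 ttau] := tI.
rewrite !picardE max_l // opprD addrACA subrr add0r.
pose f s := primitive (fun s => rhs u s x i 0) s - primitive (fun s => rhs w s x i 0) s.
pose df s := rhs u s x i 0 - rhs w s x i 0.
have fd s : 0 <= s -> is_derive s (1 : R) f (df s).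
  by move=> s0; apply: is_deriveB; exact: is_derive_picard_primitive.
have f0 : f 0 = 0 by rewrite /f !primitive0 subrr.
have dfB s : 0 <= s <= t -> `|df s| <= Gam * (A * expR (2 * Gam * s)).
  move=> /andP[s0 st]; have sI : 0 <= s <= tau by rewrite s0 (le_trans st).
  apply: rl => //; first by rewrite mulr_ge0 // expR_ge0.
  by move=> y j Cy; exact: uw.
have key (c : R) : `|c| <= 1 -> 0 <= A / 2 * expR (2 * Gam * t) + c * f t.
  move=> c1.
  have qd s : 0 <= s -> is_derive s (1 : R) (fun s => A / 2 * expR (2 * Gam * s) + c * f s)
      (A / 2 * (2 * Gam * expR (2 * Gam * s)) + c * df s).
    move=> s0; exact: (is_deriveD (is_deriveMl (A / 2) (is_derive_expRM (2 * Gam) s))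
      (is_deriveMl c (fd s s0))).
  apply: (@barrier_ge0 _ (fun s => A / 2 * expR (2 * Gam * s) + c * f s) (fun s =>
    A / 2 * (2 * Gam * expR (2 * Gam * s)) + c * df s)); first exact: t0.
  - apply: derivable_within_continuous => s; rewrite in_itv /= => /andP[s0 _].
    by have [] := qd s s0.
  - by move=> s /andP[s0 _]; apply: qd; exact: ltW.
  - by rewrite mulr0 expR0 f0 mulr0 addr0 mulr1 divr_ge0.
  - move=> s /andP[s0 st] _; have := dfB s _; rewrite (ltW s0) (ltW st) => /(_ isT) h.
    have h2 : `|c * df s| <= Gam * (A * expR (2 * Gam * s)).
      by rewrite normrM; apply: le_trans h; rewrite ler_piMl.
    move: h2; rewrite ler_norml => /andP[h3 _].
    rewrite (_ : A / 2 * _ = Gam * (A * expR (2 * Gam * s))); last by field.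
    by rewrite -lerBlDl sub0r.
have := key 1; have := key (-1); rewrite normrN normr1 lexx mul1r mulN1r => /(_ isT) h1 /(_ isT) h2.
rewrite -/(f t) ler_norml; apply/andP; split; lra.
Qed.

Hypothesis Glip : forall tau, exists2 L, 0 <= L & forall t x (a b : 'cV[R]_m) i N, 0 <= t <= tau -> C x ->
  (forall j, `|a j 0 - b j 0| <= N) -> `|G t x a i 0 - G t x b i 0| <= L * N.

Definition picard_iterate k := iter k picard (fun=> phi).

Lemma picard_iterate_continuous k : cyl (picard_iterate k).
Proof.
elim: k => [|k IH]; last exact: picard_continuous.
apply: (within_continuous_comp (h := fun p : R * 'rV[R]_n => p.2) _ _ phic) => //.
by apply: continuous_subspaceT => p; exact: cvg_snd.
Qed.

Lemma rhs_lipschitz tau : exists2 Gam, 0 < Gam & forall u w, cyl u -> cyl w ->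
  forall t x i N, 0 <= t <= tau -> C x -> 0 <= N ->
     (forall y j, C y -> `|u t y j 0 - w t y j 0| <= N) ->
     `|rhs u t x i 0 - rhs w t x i 0| <= Gam * N.
Proof.
have [L L0 hL] := Glip tau.
have D0 : 0 <= \sum_j d j 0 by apply: sumr_ge0 => j _; rewrite ltW.
exists (2 * (\sum_j d j 0) + L + 1); first by rewrite ltr_wpDl // addr_ge0 // mulr_ge0.
move=> u w cu cw t x i N tI Cx N0 uw.
apply: (@le_trans _ _ ((2 * (\sum_j d j 0) + L) * N)); last first.
  by apply: ler_wpM2r => //; rewrite lerDl.
apply: rhs_diff_le => //; try by move=> j; exact: cyl_bm.
by apply: hL => // j; exact: uw.
Qed.

Lemma picard_iterate_geometric tau : 0 <= tau -> exists A, forall k t x i, t <= tau -> C x ->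
  `|picard_iterate k.+1 t x i 0 - picard_iterate k t x i 0| <= A / 2 ^+ k.
Proof.
move=> tau0; have [Gam Gam0 hG] := rhs_lipschitz tau.
have cI := picard_iterate_continuous.
have [B1 B10 hB1] := slab_bounded bOmega (cyl_slab (a := 0) (b := tau) (cI 1%N)).
have [B0 B00 hB0] := slab_bounded bOmega (cyl_slab (a := 0) (b := tau) (cI 0%N)).
have h k t x i : 0 <= t <= tau -> C x ->
    `|picard_iterate k.+1 t x i 0 - picard_iterate k t x i 0|
      <= (B1 + B0) / 2 ^+ k * expR (2 * Gam * t).
  elim: k t x i => [|k IH] t x i tI Cx.
    rewrite expr0 divr1; apply: le_trans (ler_normB _ _) _.
    apply: le_trans (lerD (hB1 _ _ _ tI Cx) (hB0 _ _ _ tI Cx)) _.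
    rewrite ler_peMr ?addr_ge0 // -expR0 ler_expR !mulr_ge0 // ?(ltW Gam0) //.
    by have /andP[] := tI.
  rewrite exprSr invfM mulrA.
  apply: (picard_contraction Gam0 _ (cI k.+1) (cI k) (hG _ _ (cI k.+1) (cI k))) tI Cx => //.
  by rewrite divr_ge0 ?addr_ge0 // exprn_ge0.
exists ((B1 + B0) * expR (2 * Gam * tau)) => k t x i ttau Cx.
have frz (l : nat) s : picard_iterate l s x i 0 = picard_iterate l (Num.max s 0) x i 0.
  case: l => [//|l]; rewrite /picard_iterate /= !picardE; congr (_ + primitive _ _).
  by rewrite [RHS]max_l // le_max lexx orbT.
have sI : 0 <= Num.max t 0 <= tau by rewrite le_max lexx orbT ge_max ttau.
rewrite (frz k.+1) (frz k); apply: le_trans (h k _ x i sI Cx) _.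
rewrite mulrAC; apply: ler_wpM2r; first by rewrite invr_ge0 exprn_ge0.
apply: ler_wpM2l; first exact: addr_ge0.
by rewrite ler_expR ler_wpM2l ?mulr_ge0 ?(ltW Gam0) //; have /andP[] := sI.
Qed.

(** Picard-Lindelof: the iterates converge uniformly on bounded time intervals
    and the limit is a fixed point of the Picard operator. *)
Lemma solution_exists : exists u, is_solution Omega K d G 0 phi u.
Proof.
have cI := picard_iterate_continuous.
pose u t x : 'cV[R]_m := \col_i limn (fun k => picard_iterate k t x i 0).
have lim_le tau : 0 <= tau -> exists2 A, 0 <= A & forall k t x i, t <= tau -> C x ->
    `|u t x i 0 - picard_iterate k t x i 0| <= A / 2 ^+ k.
  move=> tau0; have [A hA] := picard_iterate_geometric tau0.
  exists (2 * `|A|); first by rewrite mulr_ge0.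
  move=> k t x i ttau Cx.
  have [_ /(_ k)] := geometric_limit (fun k => hA k t x i ttau Cx).
  rewrite (_ : limn _ = u t x i 0); last by rewrite mxE.
  move=> /le_trans; apply.
  by rewrite ler_wpM2r ?invr_ge0 ?exprn_ge0 // ler_wpM2l // ler_norm.
have small A e : 0 < e -> exists k : nat, A / 2 ^+ k < e.
  move=> e0; have := @cvg_geometric R A (2^-1).
  rewrite ger0_norm ?invr_ge0 // invf_lt1 ?ltr1n // => /(_ isT) /cvgr_lt /(_ e e0) [k _ hk].
  by exists k; have := hk k (leqnn k); rewrite /geometric /= exprVn.
have cu : cyl u.
  apply: within_coordP => i j; rewrite ord1; apply/within_continuous_epsP => -[t x] /= Cx e e0.
  have tau0 : 0 <= Num.max t 0 + 1 by rewrite addr_ge0 // le_max lexx orbT.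
  have [A A0 hA] := lim_le _ tau0.
  have e30 : 0 < e / 3 by rewrite divr_gt0.
  have [k hk] := small A _ e30.
  have /within_continuous_epsP := within_coord (i := i) (j := 0) (cI k).
  move=> /(_ (t, x) Cx _ e30)[r r0 hr].
  exists (Num.min 1 r); first by rewrite lt_min ltr01.
  move=> [s y] /= Cy [/= ts xy].
  have tt : t <= Num.max t 0 + 1 by rewrite (le_trans (_ : t <= Num.max t 0)) ?lerDl // le_max lexx.
  have st : s <= Num.max t 0 + 1.
    apply: (@le_trans _ _ (t + 1)); last by rewrite lerD2r le_max lexx.
    have : `|t - s| < 1 by move: ts; rewrite /ball /= lt_min => /andP[].
    by rewrite ltr_norml ltrNl opprB => /andP[h _]; rewrite addrC -lerBlDr; exact: ltW.
  have h1 := le_lt_trans (hA k t x i tt Cx) hk.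
  have h2 := le_lt_trans (hA k s y i st Cy) hk.
  have h3 : `|picard_iterate k t x i 0 - picard_iterate k s y i 0| < e / 3.
    apply: (hr (s, y)) => //; split; first by apply: le_ball ts; rewrite ge_min lexx orbT.
    by apply: le_ball xy; rewrite ge_min lexx orbT.
  move: h1 h2 h3; clear; set a := u _ _ _ _; set b := u _ _ _ _.
  set p := picard_iterate _ _ _ _ _; set q := picard_iterate _ _ _ _ _.
  rewrite !ltr_norml => /andP[a1 a2] /andP[a3 a4] /andP[a5 a6]; apply/andP; split; lra.
have ufix t x i : 0 <= t -> C x -> u t x i 0 = picard u t x i 0.
  move=> t0 Cx; apply/eqP; rewrite -subr_eq0 -normr_le0.
  have [A A0 hA] := lim_le _ t0; have [Gam Gam0 hG] := rhs_lipschitz t.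
  apply/ler_addgt0Pr => e e0; rewrite add0r.
  have [k hk] := small (A + Gam * A * t) _ e0; apply: le_trans (ltW hk).
  have p2 : 0 <= A / 2 ^+ k by rewrite divr_ge0 // exprn_ge0.
  have h1 := hA k.+1 t x i (lexx _) Cx.
  have h2 : `|picard (picard_iterate k) t x i 0 - picard u t x i 0| <= Gam * (A / 2 ^+ k) * t.
    rewrite !picardE max_l // opprD addrACA subrr add0r.
    apply: picard_primitive_diff => // s /andP[s0 st].
    apply: hG => //; first by rewrite s0.
    by move=> y j Cy; rewrite distrC; exact: hA.
  have h3 : A / 2 ^+ k.+1 <= A / 2 ^+ k.
    rewrite ler_wpM2l // lef_pV2 ?posrE ?exprn_gt0 // exprS ler_peMl ?exprn_ge0 //.
    by rewrite ler1n.
  rewrite (_ : _ - _ = (u t x i 0 - picard_iterate k.+1 t x i 0) +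
    (picard (picard_iterate k) t x i 0 - picard u t x i 0)); last first.
    by rewrite addrA subrK.
  apply: le_trans (ler_normD _ _) _.
  rewrite mulrDl; apply: lerD; first exact: le_trans h3.
  apply: le_trans h2 _; set q := (2 ^+ k)^-1.
  by rewrite (_ : Gam * (A * q) * t = Gam * A * t * q) //; ring.
exists u; split.
- by apply: continuous_subspaceW cu => p [].
- move=> x Cx; apply/colP => i; rewrite ufix // picardE max_r // primitive0 addr0 //.
- move=> t x t0 Cx; apply: is_derive_coordP => i j; rewrite ord1.
  rewrite -[X in is_derive _ _ _ X]/(rhs u t x i 0).
  apply: (@near_eq_is_derive _ _ _ (fun s => phi x i 0 + primitive (fun s => rhs u s x i 0) s)).
    near=> s; have s0 : 0 <= s by apply/ltW; near: s; exact: lt_nbhsr.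
    by rewrite (ufix s) // picardE max_l.
  rewrite -[X in is_derive _ _ _ X]add0r.
  by apply: is_deriveD; apply: is_derive_picard_primitive => //; exact: ltW.
Unshelve. all: by end_near. Qed.

End Picard.

(** * Uniqueness and the clamp onto the order interval *)

Section Uniqueness.
Context {R : realType} {m n : nat}.
Variables (Omega : set 'rV[R]_n) (K : 'I_m -> R -> 'rV[R]_n -> R) (d : 'cV[R]_m).
Hypotheses (oOmega : open Omega) (bOmega : bounded_set Omega).
Hypothesis hd : forall i, 0 < d i 0.
Hypothesis Kcont : forall i, continuous (fun p : R * 'rV[R]_n => K i p.1 p.2).
Hypothesis Kge0 : forall i t x, 0 <= K i t x.
Hypothesis Kint : forall i t,
  (\int[lebesgue_tuple n]_y (K i t (row_of_tuple y))%:E = 1)%E.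
Variable G : R -> 'rV[R]_n -> 'cV[R]_m -> 'cV[R]_m.
Local Notation C := (closure Omega).

(** Comparison applied to both signs of the difference.  The Lipschitz bound is
    local because a solution may a priori leave the order interval. *)
Lemma solution_unique (phi : 'rV[R]_n -> 'cV[R]_m) (u w : R -> 'rV[R]_n -> 'cV[R]_m) :
  (forall tau B : R, exists2 L, 0 <= L & forall (t : R) (x : 'rV[R]_n) (a b : 'cV[R]_m) i (N : R),
     0 <= t <= tau -> C x -> `|a| <= B -> `|b| <= B ->
     (forall j, `|a j 0 - b j 0| <= N) -> `|G t x a i 0 - G t x b i 0| <= L * N) ->
  is_solution Omega K d G 0 phi u -> is_solution Omega K d G 0 phi w ->
  forall (t : R) (x : 'rV[R]_n), 0 <= t -> C x -> u t x = w t x.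
Proof.
move=> Gl [cu u0 du] [cw w0 dw] t x t0 Cx.
have [uc [Bu hBu] ub] := continuous_regular oOmega bOmega t cu.
have [wc [Bw hBw] wb] := continuous_regular oOmega bOmega t cw.
have [L L0 hL] := Gl t (Num.max 0 (Num.max Bu Bw)).
pose I := ({x : 'rV[R]_n | C x} * 'I_m * bool)%type.
pose D := \sum_i d i 0.
have D0 : 0 <= D by apply: sumr_ge0 => k _; rewrite ltW.
pose sg (a : I) : R := if a.2 then 1 else -1.
pose z (s : R) (a : I) := sg a * (u s (sval a.1.1) a.1.2 0 - w s (sval a.1.1) a.1.2 0).
pose dz (s : R) (a : I) := sg a *
  (rhs Omega K d G u s (sval a.1.1) a.1.2 0 - rhs Omega K d G w s (sval a.1.1) a.1.2 0).
have key : forall (s : R) a, 0 <= s <= t -> 0 <= z s a.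
  apply: (@comparison_principle R I t (2 * D + L) (Bu + Bw) z dz).
  - by rewrite addr_ge0 // mulr_ge0.
  - move=> [[[y Cy] j] b] s; apply: cvgM; first exact: cvg_cst.
    by apply: cvgB; [exact: uc | exact: wc].
  - move=> s [[[y Cy] j] b] /andP[s0 _]; apply: is_deriveMl; apply: is_deriveB.
      exact: (is_derive_coord j 0 (du s y s0 Cy)).
    exact: (is_derive_coord j 0 (dw s y s0 Cy)).
  - move=> s [[[y Cy] j] b] sI; rewrite /z /sg /=.
    have := hBu s y j sI Cy; have := hBw s y j sI Cy.
    by rewrite !ler_norml => /andP[h1 h2] /andP[h3 h4]; case: b; lra.
  - by move=> [[[y Cy] j] b]; rewrite /z /= u0 // w0 // subrr mulr0.
  move=> s N [[[y Cy] j] b] sI N0 zN _; rewrite /dz /=.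
  have sI' : 0 <= s <= t by have /andP[h1 h2] := sI; rewrite !ltW.
  have uwN q k : C q -> `|u s q k 0 - w s q k 0| <= N.
    move=> Cq; have := zN (exist _ q Cq, k, true); have := zN (exist _ q Cq, k, false).
    by rewrite /z /sg /= ler_norml => h1 h2; apply/andP; split; lra.
  have nB (f : R -> 'rV[R]_n -> 'cV[R]_m) (Bf : R) : (forall t0 x i, 0 <= t0 <= t -> C x -> `|f t0 x i 0| <= Bf) ->
      Bf <= Num.max 0 (Num.max Bu Bw) -> `|f s y| <= Num.max 0 (Num.max Bu Bw).
    move=> hf hB; apply: normr_mx_le; first by rewrite le_max lexx.
    by move=> k l; rewrite ord1; apply: le_trans hB; exact: hf.
  have : `|rhs Omega K d G u s y j 0 - rhs Omega K d G w s y j 0| <= (2 * D + L) * N.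
    apply: rhs_diff_le => //; try by move=> k; (exact: ub || exact: wb).
    apply: hL => //; last by move=> k; exact: uwN.
      by apply: nB hBu _; rewrite !le_max lexx !orbT.
    by apply: nB hBw _; rewrite !le_max lexx !orbT.
  by rewrite ler_norml => /andP[h1 h2]; rewrite /sg /=; case: b {zN}; lra.
apply/colP => i; apply/eqP; rewrite -subr_eq0 eq_le.
have tI : 0 <= t <= t by rewrite t0 lexx.
have := key t (exist _ x Cx, i, true) tI; have := key t (exist _ x Cx, i, false) tI.
by rewrite /z /sg /= mul1r mulN1r oppr_ge0 => -> ->.
Qed.

End Uniqueness.

Section Clamp.
Context {R : realType} {m : nat}.
Implicit Types (a b v : 'cV[R]_m).

Lemma vclamp_in v a : (forall i, 0 <= v i 0) -> order_interval v (vclamp v a).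
Proof.
move=> v0; apply/order_intervalP => i; rewrite mxE le_max lexx /=.
by rewrite ge_max v0 ge_min lexx orbT.
Qed.

Lemma vclamp_id v a : order_interval v a -> vclamp v a = a.
Proof.
move=> /order_intervalP h; apply/colP => i; rewrite mxE; have /andP[a0 av] := h i.
by rewrite min_l // max_r.
Qed.

Lemma vclamp_ge v a b j (N : R) : 0 <= v j 0 -> 0 <= N -> - N <= a j 0 - b j 0 ->
  - N <= vclamp v a j 0 - vclamp v b j 0.
Proof.
rewrite !mxE; move: (a j 0) (b j 0) (v j 0) => {}a {}b {}v v0 N0 h.
case: (leP a v) => av; case: (leP b v) => bv;
  repeat (match goal with |- context [Num.max 0 ?x] => case: (leP 0 x) => ? end); lra.
Qed.

Lemma vclamp_le v a b j (N : R) : 0 <= v j 0 -> 0 <= N -> a j 0 - b j 0 <= N ->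
  vclamp v a j 0 - vclamp v b j 0 <= N.
Proof.
move=> v0 N0 h; rewrite -lerN2 opprB; apply: vclamp_ge => //.
by rewrite -opprB lerN2.
Qed.

Lemma vclamp_continuous v : continuous (vclamp v).
Proof.
apply/continuous_subspace_setT.
apply: within_coordP => i j; apply: continuous_subspaceT => a.
have -> : (fun a => vclamp v a i j) = ((fun=> 0) \max ((fun a : 'cV[R]_m => a i 0) \min (fun=> v i 0))).
  by apply/funext => b; rewrite mxE.
apply: continuous_max; first exact: cst_continuous.
by apply: continuous_min; [exact: coord_continuous | exact: cst_continuous].
Qed.

End Clamp.

(** * Strict positivity of supersolutions *)

Section Mollifier.
Context {R : realType} {n : nat}.
Variable Omega : set 'rV[R]_n.
Hypotheses (oOmega : open Omega) (bOmega : bounded_set Omega) (cOmega : connected Omega).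
Implicit Types (x y z : 'rV[R]_n) (f : 'rV[R]_n -> R) (r e : R).
Local Notation C := (closure Omega).
Local Notation bm := (bounded_measurable Omega).

Definition bump r z : R := Num.max 0 (r - `|z|).

Lemma bump_ge0 r z : 0 <= bump r z.
Proof. by rewrite le_max lexx. Qed.

Lemma bump_le r z : 0 < r -> bump r z <= r.
Proof. by move=> r0; rewrite ge_max (ltW r0) gerBl normr_ge0. Qed.

Lemma bump_gt0 r z : (0 < bump r z) = (`|z| < r).
Proof. by rewrite lt_max ltxx subr_gt0. Qed.


Lemma bump_lipschitz r x y : `|bump r x - bump r y| <= `|x - y|.
Proof.
have h : `| `|x| - `|y| | <= `|x - y| by exact: ler_dist_dist.
apply: le_trans h; rewrite /bump; move: `|x| `|y| => a b.
have h1 := ler_norm (a - b); have h2 := ler_norm (b - a); rewrite (distrC b a) in h2.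
by case: (leP 0 (r - a)) => ?; case: (leP 0 (r - b)) => ?;
  rewrite ler_norml; apply/andP; split; lra.
Qed.

Lemma bump_continuous r : continuous (bump r).
Proof.
apply/continuous_subspace_setT/within_continuous_epsP => x _ e e0.
exists e => // y _; rewrite -ball_normE /= => xy.
exact: le_lt_trans (bump_lipschitz r x y) xy.
Qed.

(** Local mass of [f] around [x]: a lower bound, up to a constant, for all the
    nonlocal terms at once, and Lipschitz in [x] even when [f] is not continuous. *)
Definition local_mass r f x : R := integralO Omega (fun y => bump r (x - y) * f y).

Lemma bump_bounded_measurable r x : bm (fun y => bump r (x - y)).
Proof.
apply: bounded_measurable_continuous => //; apply: continuous_subspaceT => z.
apply: (@continuous_comp _ _ _ (fun y : 'rV[R]_n => x - y) (bump r)).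
  by move: z; apply: sub_continuous; [exact: cst_continuous | exact: id_continuous].
exact: bump_continuous.
Qed.

Lemma bump_mul_bounded_measurable r x f : bm f -> bm (fun y => bump r (x - y) * f y).
Proof. by apply: bounded_measurableM; exact: bump_bounded_measurable. Qed.

Lemma local_mass_ge0 r f x : (forall y, Omega y -> 0 <= f y) -> 0 <= local_mass r f x.
Proof. by move=> f0; apply: integralO_ge0 => y /f0 fy; rewrite mulr_ge0 // bump_ge0. Qed.

Lemma local_mass_continuous r f : bm f -> continuous (local_mass r f).
Proof.
move=> bf; have [_ [B hB]] := bf.
apply/continuous_subspace_setT/within_continuous_epsP => x _ e e0.
have V0 := volumeO_ge0 Omega; set V := volumeO Omega in V0.
have P0 : 0 < `|B| * V + 1 by rewrite ltr_wpDl // mulr_ge0.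
exists (e / (`|B| * V + 1)); first exact: divr_gt0.
move=> y _; rewrite -ball_normE /= ltr_pdivlMr // => xy.
rewrite /local_mass -integralOB //; try exact: bump_mul_bounded_measurable.
have : `|integralO Omega (fun z => bump r (x - z) * f z - bump r (y - z) * f z)|
    <= (`|x - y| * `|B|) * V.
  apply: normr_integralO_le => //.
    by apply: bounded_measurableB; exact: bump_mul_bounded_measurable.
  move=> z Oz; rewrite -mulrBl normrM; apply: ler_pM => //.
    apply: le_trans (bump_lipschitz _ _ _) _.
    by rewrite opprB addrA subrK.
  by apply: le_trans (hB z Oz) _; exact: ler_norm.
move=> /le_lt_trans; apply; apply: le_lt_trans xy.
by rewrite -mulrA; apply: ler_wpM2l => //; rewrite lerDl.
Qed.

Lemma local_mass_gt0 r s f x y : bm f -> (forall y, Omega y -> 0 <= f y) -> C y -> 0 < s ->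
  (forall z, Omega z -> ball y s z -> `|x - z| < r /\ 0 < f z) -> 0 < local_mass r f x.
Proof.
move=> bf f0 Cy s0 h; apply: (integralO_gt0 oOmega bOmega _ _ Cy s0) => //.
- exact: bump_mul_bounded_measurable.
- by move=> z /f0 fz; rewrite mulr_ge0 // bump_ge0.
- by move=> z Oz yz; have [h1 h2] := h z Oz yz; rewrite mulr_gt0 // bump_gt0.
Qed.

Lemma local_mass_sum r m (f : 'I_m -> 'rV[R]_n -> R) x : (forall i, bm (f i)) ->
  bm (fun y => \sum_i f i y) /\
  local_mass r (fun y => \sum_i f i y) x = \sum_i local_mass r (f i) x.
Proof.
move=> bf; elim: (index_enum _) => [|i s [IH1 IH2]].
  split; first by apply: (eq_bounded_measurable (f := fun=> 0)) (bounded_measurable_cst _ _) => y _;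
    rewrite big_nil.
  rewrite big_nil /local_mass (eq_integralO (g := fun=> 0)); last first.
    by move=> y _; rewrite big_nil mulr0.
  have := integralOZ oOmega bOmega 0 (bounded_measurable_cst Omega (0 : R)).
  by rewrite !mul0r.
split.
  apply: (eq_bounded_measurable (f := fun y => f i y + \sum_(j <- s) f j y)).
    by move=> y _; rewrite big_cons.
  exact: bounded_measurableD.
rewrite big_cons -IH2 /local_mass -integralOD //; try exact: bump_mul_bounded_measurable.
by apply: eq_integralO => y _; rewrite big_cons mulrDr.
Qed.

(** If zeros of [f] force zero local mass, the zero set of the local mass is
    open and closed in the closed domain: near a point of zero mass, zeros of
    [f] are dense. *)
Lemma local_mass_dichotomy r f : 0 < r -> bm f -> (forall y, C y -> 0 <= f y) ->
  (forall x, C x -> f x = 0 -> local_mass r f x = 0) ->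
  (forall x, C x -> local_mass r f x = 0) \/ (forall x, C x -> 0 < local_mass r f x).
Proof.
move=> r0 bf f0 hf.
have f0' y : Omega y -> 0 <= f y by move=> /subset_closure/f0.
have cl := local_mass_continuous (r := r) bf.
have spread x y : C x -> C y -> local_mass r f x = 0 -> `|x - y| < r -> local_mass r f y = 0.
  move=> Cx Cy zx xy; apply/eqP; rewrite eq_le local_mass_ge0 // andbT leNgt; apply/negP => zy.
  have [s /= s0 hs] : nbhs_ball y (fun z => 0 < local_mass r f z).
    by apply/nbhs_ballP; exact: (cvgr_gt _ (cl y) _ zy).
  suff : 0 < local_mass r f x by rewrite zx ltxx.
  apply: (@local_mass_gt0 r (Num.min s (r - `|x - y|)) f x y) => //.
    by rewrite lt_min s0 subr_gt0.
  move=> z Oz; rewrite -ball_normE /= lt_min => /andP[yz1 yz2]; split.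
    have -> : x - z = (x - y) + (y - z) by rewrite addrA subrK.
    by apply: le_lt_trans (ler_normD _ _) _; rewrite -ltrBrDl.
  rewrite lt_neqAle f0' // andbT; apply/eqP => fz.
  have : 0 < local_mass r f z by apply: hs; rewrite -ball_normE.
  by rewrite hf ?ltxx //; exact: subset_closure.
pose W := [set x | C x /\ local_mass r f x = 0].
have [W0|W0] := eqVneq W set0.
  right=> x Cx; rewrite lt_neqAle local_mass_ge0 // andbT eq_sym; apply/eqP => zx.
  by have : W x by []; rewrite W0.
left; suff WC : W = C by move=> x; rewrite -WC => -[].
have cC : connected C by exact: connected_closure.
apply: cC; first exact/set0P.
- exists (\bigcup_(x in W) ball x r)°; first exact: open_interior.
  apply/seteqP; split=> y.
    move=> [Cy zy]; split=> //; apply: filterS (nbhsx_ballx y _ r0) => z yz.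
    by exists y.
  move=> [Cy /interior_subset [x [Cx zx]]]; rewrite -ball_normE /= => xy.
  by split=> //; exact: spread xy.
- exists [set x | local_mass r f x = 0].
    by apply: (@closed_comp _ _ (local_mass r f) [set 0]); [move=> x _; exact: cl | exact: closed_eq].
  by [].
Qed.

(** By compactness finitely many bumps dominate a positive constant, so
    vanishing local mass everywhere means vanishing integral against any
    bounded weight. *)
Lemma local_mass_eq0 r f k : 0 < r -> bm f -> bm k -> (forall y, Omega y -> 0 <= f y) ->
  (forall y, Omega y -> 0 <= k y) ->
  (forall x, C x -> local_mass r f x = 0) -> integralO Omega (fun y => k y * f y) = 0.
Proof.
move=> r0 bf bk f0 k0 z0.
have := bounded_closure_compact bOmega; rewrite compact_cover.
move=> /(_ _ C (fun x => (ball x (r / 2))°) _ _)[||D' D'C cov].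
- by move=> x _; exact: open_interior.
- move=> x Cx; exists x => //; apply: nbhsx_ballx; exact: divr_gt0.
have S (s : seq 'rV[R]_n) : {in s, forall x, C x} ->
    bm (fun y => (\sum_(x <- s) bump r (x - y)) * f y) /\
    integralO Omega (fun y => (\sum_(x <- s) bump r (x - y)) * f y) = 0.
  elim: s => [_|x s IH hs].
    have E y : (\sum_(x <- [::]) bump r (x - y)) * f y = 0 * 0 by rewrite big_nil !mul0r.
    split.
      apply: (eq_bounded_measurable (f := fun=> 0)) (bounded_measurable_cst _ _) => y _.
      by rewrite E mul0r.
    rewrite (eq_integralO (g := fun=> 0 * 0)) //.
    have := integralOZ oOmega bOmega 0 (bounded_measurable_cst Omega (0 : R)).
    by rewrite !mul0r.
  have [|b1 b2] := IH; first by move=> y ys; apply: hs; rewrite inE ys orbT.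
  have E y : bump r (x - y) * f y + (\sum_(x <- s) bump r (x - y)) * f y =
      (\sum_(x <- x :: s) bump r (x - y)) * f y by rewrite big_cons mulrDl.
  split.
    apply: (eq_bounded_measurable (fun y _ => E y)).
    by apply: bounded_measurableD => //; exact: bump_mul_bounded_measurable.
  rewrite -(eq_integralO (fun y _ => E y)) integralOD // ?b2 ?addr0.
    by apply: z0; apply: hs; rewrite inE eqxx.
  exact: bump_mul_bounded_measurable.
have D'C' : {in finmap.enum_fset D', forall x, C x}.
  by move=> x xD; have /D'C := xD; rewrite inE.
have [b1 b2] := S _ D'C'.
have [_ [B hB]] := bk.
have dom y : Omega y -> r / 2 <= \sum_(x <- finmap.enum_fset D') bump r (x - y).
  move=> Oy; have [x xD /interior_subset] := cov y (subset_closure Oy).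
  rewrite -ball_normE /= => xy.
  have xD' : x \in finmap.enum_fset D' by [].
  rewrite (perm_big _ (perm_to_rem xD')) big_cons.
  apply: (@le_trans _ _ (bump r (x - y))); first by rewrite le_max; apply/orP; right; lra.
  by rewrite lerDl; apply: sumr_ge0 => z _; exact: bump_ge0.
apply/eqP; rewrite eq_le; apply/andP; split; last first.
  by apply: integralO_ge0 => y Oy; rewrite mulr_ge0 ?f0 ?k0.
rewrite -[leRHS](mulr0 (2 / r * `|B|)) -[X in _ <= _ * X]b2 -integralOZ //.
apply: le_integralO => //; [exact: bounded_measurableM | exact: bounded_measurableZ |].
move=> y Oy; rewrite mulrA; apply: ler_wpM2r; first exact: f0.
have kB : k y <= `|B| by apply: le_trans (ler_norm _) (le_trans (hB y Oy) (ler_norm _)).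
apply: le_trans kB _; rewrite mulrAC -[leLHS]mul1r; apply: ler_wpM2r => //.
have := dom y Oy; set Sy := \sum_(_ <- _) _ => h.
rewrite mulrAC ler_pdivlMr // mul1r; lra.
Qed.

End Mollifier.

(** The lower bound solves [y' = c - G y] with the same initial value. *)
Lemma linear_ode_lower (R : realType) (y dy : R -> R) (G c t1 : R) : 0 < G -> 0 <= t1 ->
  {within `[0, t1]%classic, continuous y} ->
  (forall t : R, 0 < t < t1 -> is_derive t (1 : R) y (dy t)) ->
  (forall t : R, 0 < t < t1 -> c - G * y t <= dy t) ->
  c / G + (y 0 - c / G) * expR (- (G * t1)) <= y t1.
Proof.
move=> G0 t10 cy yd dyc; rewrite -subr_ge0.
pose a := y 0 - c / G.
pose q t := y t - (c / G + a * expR (- G * t)).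
have -> : y t1 - (c / G + (y 0 - c / G) * expR (- (G * t1))) = q t1 by rewrite /q mulNr.
have ed t : is_derive t (1 : R) (fun t => c / G + a * expR (- G * t)) (a * (- G * expR (- G * t))).
  rewrite -[X in is_derive _ _ _ X]add0r.
  exact: (is_deriveD (is_derive_cst (c / G) t (1 : R)) (is_deriveMl a (is_derive_expRM (- G) t))).
apply: (@barrier_ge0 _ q (fun t => dy t - a * (- G * expR (- G * t)))) => //.
- move=> t; apply: cvgB; first exact: cy.
  move: t; apply: derivable_within_continuous => t _.
  by have [] := ed t.
- by move=> t tI; have h1 := yd t tI; have h2 := ed t; exact: (is_deriveB h1 h2).
- by rewrite /q mulr0 expR0 mulr1 /a; lra.
move=> t tI qt; apply: (@le_trans _ _ (- G * q t)).
  by rewrite mulNr oppr_ge0 pmulr_rle0.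
have -> : - G * q t = c - G * y t - a * (- G * expR (- G * t)).
  by rewrite /q; field; rewrite gt_eqF.
by rewrite lerD2r; exact: dyc.
Qed.

Lemma nonneg_zero_derive (R : realType) (y : R -> R) (t D : R) : 0 < t ->
  (forall s : R, 0 < s -> 0 <= y s) -> (forall s : R, 0 < s -> derivable y s 1) ->
  is_derive t (1 : R) y D -> y t = 0 -> D = 0.
Proof.
move=> t0 y0 yd dD yt.
have h : is_derive t (1 : R) y 0.
  apply: (@derive1_at_min _ y 0 (t + 1) t).
  - by rewrite addr_ge0 // ltW.
  - by move=> s; rewrite in_itv /= => /andP[s0 _]; exact: yd.
  - by rewrite in_itv /= t0 ltrDl ltr01.
  - by move=> s; rewrite in_itv /= yt => /andP[s0 _]; exact: y0.
by have [_ <-] := dD; have [_ ->] := h.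
Qed.

Section Positivity.
Context {R : realType} {m n : nat}.
Variables (Omega : set 'rV[R]_n) (K : 'I_m -> R -> 'rV[R]_n -> R) (d : 'cV[R]_m).
Hypotheses (oOmega : open Omega) (bOmega : bounded_set Omega) (cOmega : connected Omega).
Hypothesis hd : forall i, 0 < d i 0.
Hypothesis Kcont : forall i, continuous (fun p : R * 'rV[R]_n => K i p.1 p.2).
Hypothesis Kge0 : forall i t x, 0 <= K i t x.
Hypothesis Kgt0 : forall i t, 0 < K i t 0.
Implicit Types (t s a b e r : R) (x y z : 'rV[R]_n) (i j : 'I_m)
  (u : R -> 'rV[R]_n -> 'cV[R]_m) (f : 'rV[R]_n -> R).
Local Notation C := (closure Omega).
Local Notation bm := (bounded_measurable Omega).

(** Positivity at [0] persists nearby, uniformly over a compact time interval. *)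
Lemma kernel_lower_bound a b : a <= b -> exists k r, [/\ 0 < k, 0 < r &
  forall i t z, a <= t <= b -> k * bump r z <= K i t z].
Proof.
move=> ab.
have h i : exists e : R, 0 < e /\ forall t z, a <= t <= b -> `|z| < e -> e <= K i t z.
  pose A : set (R * 'rV[R]_n) := `[a, b]%classic `*` [set z | `|z| <= 1].
  have cA : compact A.
    apply: compact_setX; first exact: segment_compact.
    apply: bounded_closed_compact.
      by exists 1; split; [rewrite num_real | move=> M M1 w /= /le_trans; apply; exact: ltW].
    by apply: (@closed_comp _ _ (fun w : 'rV[R]_n => `|w|) [set r | r <= 1]);
      [move=> w _; exact: norm_continuous | exact: closed_le].
  have c0 : {within `[a, b]%classic, continuous (fun t => K i t 0)}.
    apply: continuous_subspaceT => t; apply: (@continuous_comp _ _ _ (fun t : R => (t, 0 : 'rV[R]_n))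
      (fun p : R * 'rV[R]_n => K i p.1 p.2)); last exact: Kcont.
    by move: t; apply: pair_continuous; [exact: id_continuous | exact: cst_continuous].
  have [t0 t0I ht0] := EVT_min ab c0.
  have k20 : 0 < K i t0 0 / 2 by rewrite divr_gt0.
  have [r r0 hr] := compact_uniform_continuity cA (continuous_subspaceT (Kcont (i := i))) k20.
  exists (Num.min (Num.min 1 r) (K i t0 0 / 2)); split.
    by rewrite !lt_min ltr01 r0 k20.
  move=> t z tI; rewrite !lt_min => /andP[/andP[z1 zr] zk].
  have : `|K i t 0 - K i t z| < K i t0 0 / 2.
    apply: (hr (t, 0) (t, z)).
    - by split => /=; rewrite ?in_itv ?normr0.
    - by split => /=; rewrite ?in_itv // ltW.
    - by split; [exact: ballxx | rewrite -ball_normE /= sub0r normrN].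
  have := ht0 t; rewrite in_itv /= => /(_ tI) h1; rewrite ltr_norml => /andP[h2 h3].
  by rewrite ge_min; apply/orP; right; lra.
have [e he] := choice h.
have [i|k k0 hk] := @common_lower_bound R 'I_m e; first by have [] := he i.
exists 1, k; split => // i t z tI; rewrite mul1r.
have [zk|zk] := ltP `|z| k; last by rewrite /bump max_l // subr_le0.
apply: (@le_trans _ _ k); first exact: bump_le.
have [_ h2] := he i; apply: le_trans (hk i) _; apply: h2 => //.
exact: lt_le_trans zk (hk i).
Qed.

Lemma nonlocal_ge_local_mass i t x f k r : bm f -> (forall y, Omega y -> 0 <= f y) ->
  (forall z, k * bump r z <= K i t z) -> k * local_mass Omega r f x <= nonlocal Omega K i t x f.
Proof.
move=> bf f0 hk; rewrite /local_mass -integralOZ //; last exact: bump_mul_bounded_measurable.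
apply: le_integralO => //.
- by apply: bounded_measurableZ; exact: bump_mul_bounded_measurable.
- exact: kernel_mul_bounded_measurable.
- by move=> y /f0 fy; rewrite mulrA; exact: ler_wpM2r.
Qed.

(** The order structure shared by the nonlinear kinetics and their
    linearisation that makes nonnegative supersolutions strictly positive. *)
Definition strongly_positive (B : set 'cV[R]_m) (F : R -> 'rV[R]_n -> 'cV[R]_m -> 'cV[R]_m) :=
  forall t x (z : 'cV[R]_m), 0 <= t -> C x -> B z -> (forall i, 0 <= z i 0) ->
    (z = 0 -> F t x z = 0) /\
    ((forall i, z i 0 = 0 -> F t x z i 0 <= 0) -> z = 0 \/ forall i, 0 < z i 0).

Variables (B : set 'cV[R]_m) (F : R -> 'rV[R]_n -> 'cV[R]_m -> 'cV[R]_m).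
Hypothesis spF : strongly_positive B F.

(** At an interior time a vanishing component has zero derivative, so the
    supersolution inequality leaves no room for any positive term. *)
Lemma supersolution_zero u (du : 'cV[R]_m) t x : 0 < t -> C x ->
  (forall s y i, 0 < s -> C y -> 0 <= u s y i 0) -> B (u t x) ->
  (forall i, bm (fun y => u t y i 0)) ->
  (forall s, 0 < s -> derivable (fun s => u s x) s 1) ->
  is_derive t (1 : R) (fun s => u s x) du ->
  (forall i, dispersal Omega K d u t x i 0 + F t x (u t x) i 0 <= du i 0) ->
  (u t x = 0 \/ forall i, 0 < u t x i 0) /\
  (u t x = 0 -> forall i, nonlocal Omega K i t x (fun y => u t y i 0) = 0).
Proof.
move=> t0 Cx u0 Bu bu ud dD sup.
have J0 i : 0 <= nonlocal Omega K i t x (fun y => u t y i 0).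
  by apply: nonlocal_ge0 => // y /subset_closure Cy; exact: u0.
have key i : u t x i 0 = 0 ->
    d i 0 * nonlocal Omega K i t x (fun y => u t y i 0) + F t x (u t x) i 0 <= 0.
  move=> ui; have <- : du i 0 = 0.
    apply: (nonneg_zero_derive t0 _ _ (is_derive_coord i 0 dD) ui).
      by move=> s s0; exact: u0.
    by move=> s /ud /derivable_mxP; exact.
  by have := sup i; rewrite dispersalE ui mulr0 subr0.
have u0' i : 0 <= u t x i 0 by exact: u0.
have [F0 irr] := spF (ltW t0) Cx Bu u0'.
split; first by apply: irr => i /key; apply: le_trans; rewrite lerDr mulr_ge0 // ltW.
move=> uz i; apply/eqP; rewrite eq_le J0 andbT.
have := key i; rewrite F0 // uz !mxE addr0 => /(_ erefl).
by rewrite pmulr_rle0.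
Qed.

(** Where all components vanish the local mass vanishes too, so the dichotomy
    for the local mass applies to the sum of the components. *)
Lemma supersolution_dichotomy u (du : 'rV[R]_n -> 'cV[R]_m) t : 0 < t ->
  (forall s y i, 0 < s -> C y -> 0 <= u s y i 0) -> (forall x, C x -> B (u t x)) ->
  (forall i, bm (fun y => u t y i 0)) ->
  (forall s x, 0 < s -> C x -> derivable (fun s => u s x) s 1) ->
  (forall x, C x -> is_derive t (1 : R) (fun s => u s x) (du x)) ->
  (forall x i, C x -> dispersal Omega K d u t x i 0 + F t x (u t x) i 0 <= du x i 0) ->
  (forall x i, C x -> 0 < u t x i 0) \/
  exists r, 0 < r /\ forall x i, C x -> local_mass Omega r (fun y => u t y i 0) x = 0.
Proof.
move=> t0 u0 Bu bu ud dD sup.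
have [k [r [k0 r0 hk]]] := kernel_lower_bound (lexx t).
have tI : t <= t <= t by rewrite lexx.
have ui0 i y : Omega y -> 0 <= u t y i 0 by move=> /subset_closure; exact: u0.
pose f y := \sum_i u t y i 0.
have [bf _] := local_mass_sum oOmega bOmega r 0 bu.
have sz x : C x -> (u t x = 0 \/ forall i, 0 < u t x i 0) /\
    (u t x = 0 -> forall i, nonlocal Omega K i t x (fun y => u t y i 0) = 0).
  move=> Cx; apply: (supersolution_zero t0 Cx u0 (Bu x Cx) bu _ (dD x Cx)).
    by move=> s s0; exact: ud.
  by move=> i; exact: sup.
have f0 y : C y -> 0 <= f y by move=> Cy; apply: sumr_ge0 => i _; exact: u0.
have fz x : C x -> f x = 0 -> u t x = 0.
  move=> Cx /eqP; rewrite psumr_eq0; last by move=> i _; exact: u0.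
  by move=> /allP h; apply/colP => i; rewrite mxE; apply/eqP/h; exact: mem_index_enum.
have hf x : C x -> f x = 0 -> local_mass Omega r f x = 0.
  move=> Cx /(fz x Cx) ux; have [_ /(_ ux) Jz] := sz x Cx.
  have [_ ->] := local_mass_sum oOmega bOmega r x bu.
  apply: big1 => i _; apply/eqP; rewrite eq_le local_mass_ge0 ?andbT; last exact: ui0.
  rewrite -(pmulr_rle0 _ k0) -(Jz i); apply: nonlocal_ge_local_mass => //; first exact: ui0.
  by move=> z; exact: hk.
have [all0|allp] := local_mass_dichotomy oOmega bOmega cOmega r0 bf f0 hf.
  right; exists r; split=> // x i Cx.
  have := all0 x Cx; have [_ ->] := local_mass_sum oOmega bOmega r x bu.
  move=> /eqP; rewrite psumr_eq0; last by move=> j _; apply: local_mass_ge0; exact: ui0.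
  by move=> /allP /(_ i (mem_index_enum i)) /eqP.
left=> x i Cx; have [[ux|up] _] := sz x Cx; last exact: up.
have : f x = 0 by rewrite /f ux; apply: big1 => j _; rewrite mxE.
by move=> /(hf x Cx) h; have := allp x Cx; rewrite h ltxx.
Qed.

End Positivity.

(** * Periodic supersolutions *)

Lemma is_derive_shift (R : realType) (V : normedModType R) (f : R -> V) (D : V) (t c : R) :
  is_derive (t + c) (1 : R) f D -> is_derive t (1 : R) (fun s => f (s + c)) D.
Proof.
move=> [df fD].
have E : (fun h => h^-1 *: (((fun s => f (s + c)) \o shift t) (h *: (1 : R)) - f (t + c)))
   = (fun h => h^-1 *: ((f \o shift (t + c)) (h *: (1 : R)) - f (t + c))).
  by apply/funext => h /=; rewrite addrA.
by split; rewrite /derivable /derive /= E.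
Qed.


Section Periodicity.
Context {R : realType}.

Lemma periodic_shift (V : Type) (T : R) (f : R -> V) (k : nat) (t : R) :
  (forall s, f (s + T) = f s) -> f (t + k%:R * T) = f t.
Proof.
move=> fT; elim: k => [|k IH]; first by rewrite mul0r addr0.
by rewrite -addn1 natrD mulrDl mul1r addrA fT.
Qed.

(** One representative serves all [T]-periodic functions at once. *)
Lemma periodic_representative (T t a : R) : 0 < T -> exists s, a <= s <= a + T /\
  forall (V : Type) (f : R -> V), (forall r, f (r + T) = f r) -> f t = f s.
Proof.
move=> T0; pose k := Num.floor ((t - a) / T); have := floor_itv ((t - a) / T); rewrite -/k => /andP[k1 k2].
exists (t - k%:~R * T); split.
  move: k1 k2; rewrite ler_pdivlMr // intrD mulr1z ltr_pdivrMr // mulrDl mul1r => k1 k2.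
  by apply/andP; split; lra.
move=> V f fT; case: k {k1 k2} => k; last first.
  rewrite NegzE mulrNz mulNr opprK -(periodic_shift k.+1 t fT) //.
have -> : f t = f ((t - k%:R * T) + k%:R * T) by rewrite subrK.
by rewrite periodic_shift.
Qed.

Lemma eventually_nonneg (T t : R) : 0 < T -> exists k : nat, 0 < t + k%:R * T.
Proof.
move=> T0; exists (Num.truncn (`|t| / T)).+1.
have := truncnS_gt (`|t| / T); rewrite ltr_pdivrMr // => h.
have := ler_norm (- t); rewrite normrN; lra.
Qed.

Lemma is_derive_of_increment (f : R -> R) (t D : R) :
  (forall e, 0 < e -> exists2 r, 0 < r & forall h, `|h| < r ->
     `|f (t + h) - f t - h * D| <= e * `|h|) -> is_derive t (1 : R) f D.
Proof.
move=> H.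
have c : h^-1 *: ((f \o shift t) (h *: (1 : R)) - f t) @[h --> 0^'] --> D.
  apply/cvgrPdist_le => e e0; have [r r0 hr] := H e e0.
  near=> h.
  have h0 : h != 0 by near: h; exact: nbhs_dnbhs_neq.
  have hlt : `|h| < r.
    near: h; apply: dnbhs0_lt; exact: r0.
  have := hr h hlt; rewrite /= [h *: (1 : R)]mulr1 [h + t]addrC /GRing.scale /= => h1.
  have -> : D - h^-1 * (f (t + h) - f t) = - (h^-1 * (f (t + h) - f t - h * D)).
    by rewrite !mulrBr mulKf //; ring.
  rewrite normrN normrM normfV mulrC ler_pdivrMr ?normr_gt0 //.
split; first by apply/cvg_ex; exists D.
exact: cvg_lim c.
Unshelve. all: by end_near. Qed.

Lemma cvg_coord_col (m : nat) (f : nat -> 'cV[R]_m) (l : 'cV[R]_m) :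
  (forall i, f k i 0 @[k --> \oo] --> l i 0) -> f k @[k --> \oo] --> l.
Proof.
move=> cf; apply/cvg_mx_entourageP => E entE.
have h i : \forall k \near \oo, (l i 0, f k i 0) \in E.
  have /cvg_entourageP /(_ E entE) h := cf i.
  have {}h : \forall k \near \oo, E (l i 0, f k i 0) by exact: h.
  by apply: filterS h => q hq; rewrite inE.
have : \forall k \near \oo, forall i : 'I_m, (l i 0, f k i 0) \in E by exact: filter_forall.
by apply: filterS => k hk i j; rewrite ord1.
Qed.

End Periodicity.

Section PeriodicLowerBound.
Context {R : realType} {m n : nat}.
Variables (Omega : set 'rV[R]_n) (K : 'I_m -> R -> 'rV[R]_n -> R) (d : 'cV[R]_m) (T : R).
Hypotheses (oOmega : open Omega) (bOmega : bounded_set Omega) (neOmega : Omega !=set0).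
Hypothesis hd : forall i, 0 < d i 0.
Hypothesis Kcont : forall i, continuous (fun p : R * 'rV[R]_n => K i p.1 p.2).
Hypothesis Kge0 : forall i t x, 0 <= K i t x.
Hypothesis Kgt0 : forall i t, 0 < K i t 0.
Hypothesis hT : 0 < T.
Implicit Types (t s tau : R) (x y : 'rV[R]_n) (i j : 'I_m).
Local Notation C := (closure Omega).
Local Notation bm := (bounded_measurable Omega).
Variables (B : set 'cV[R]_m) (F : R -> 'rV[R]_n -> 'cV[R]_m -> 'cV[R]_m) (L t0 : R)
  (u du : R -> 'rV[R]_n -> 'cV[R]_m).

(** Discarding all off-diagonal gains leaves a scalar linear inequality for each
    component, so a lower bound [c] on the nonlocal gain is integrated explicitly. *)
Lemma supersolution_ode_lower tmax : 0 <= L -> quasi_monotone C B tmax L F -> B 0 ->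
  (forall t x, 0 <= t -> C x -> F t x 0 = 0) ->
  (forall t x i, 0 < t -> C x -> 0 <= u t x i 0) -> (forall t x, 0 < t -> C x -> B (u t x)) ->
  (forall t x, 0 < t -> C x -> is_derive t (1 : R) (fun s => u s x) (du t x)) ->
  (forall t x i, 0 < t -> C x ->
     dispersal Omega K d u t x i 0 + F t x (u t x) i 0 <= du t x i 0) ->
  exists2 G : R, 0 < G & forall s tau x i (c : R), 0 < s -> 0 <= tau -> s + tau <= tmax -> C x ->
    (forall r : R, s < r < s + tau -> c <= d i 0 * nonlocal Omega K i r x (fun y => u r y i 0)) ->
    c / G + (u s x i 0 - c / G) * expR (- (G * tau)) <= u (tau + s) x i 0.
Proof.
move=> L0 qm B0 F0 u0 uB ud us.
pose D := \sum_i d i 0.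
have dD j : d j 0 <= D by rewrite /D (bigD1 j) //= lerDl sumr_ge0 // => k _; rewrite ltW.
have D0 : 0 <= D by apply: sumr_ge0 => k _; rewrite ltW.
pose G := D + L + 1; have G0 : 0 < G by rewrite ltr_wpDl // addr_ge0.
have low t x i : 0 < t -> t <= tmax -> C x ->
    d i 0 * nonlocal Omega K i t x (fun y => u t y i 0) - G * u t x i 0 <= du t x i 0.
  move=> tp tle Cx; apply: le_trans (us t x i tp Cx); rewrite dispersalE.
  have z00 j : (0 : 'cV[R]_m) j 0 = 0 by rewrite mxE.
  have ui := u0 t x i tp Cx.
  have h : - (L * u t x i 0) <= F t x (u t x) i 0 - F t x 0 i 0.
    apply: (qm t x (u t x) 0 i) => //; first by rewrite ltW.
    - exact: uB.
    - by move=> j; rewrite z00 subr0 (@le_trans _ _ 0) ?oppr_le0 //; exact: u0.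
    - by rewrite z00 subr0.
  rewrite F0 ?(ltW tp) // z00 subr0 in h.
  have := ler_wpM2r ui (dD i); rewrite /G !mulrDl mul1r; lra.
exists G => // s tau x i c s0 tau0 sle Cx hc.
have der (q : R) : 0 <= q -> is_derive q (1 : R) (fun r : R => u (r + s) x i 0) (du (q + s) x i 0).
  move=> q0; apply: (is_derive_shift (f := fun r : R => u r x i 0)).
  by apply: (is_derive_coord i 0 (ud _ x _ Cx)); rewrite ltr_wpDl.
have := @linear_ode_lower R (fun r : R => u (r + s) x i 0) (fun r : R => du (r + s) x i 0) G c tau G0 tau0.
rewrite add0r; apply.
- by apply: derivable_within_continuous => r; rewrite in_itv /= => /andP[/der[]].
- by move=> r /andP[/ltW /der].
- move=> r /andP[r0 rtau]; have rs : 0 < r + s by rewrite addr_gt0.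
  apply: le_trans (low _ _ _ rs _ Cx); last by rewrite addrC (le_trans _ sle) // lerD2l ltW.
  rewrite lerD2r; apply: hc; rewrite ltrDr r0 /= addrC ltrD2l //.
Qed.

Lemma supersolution_persistence tmax : 0 <= L -> quasi_monotone C B tmax L F -> B 0 ->
  (forall t x, 0 <= t -> C x -> F t x 0 = 0) ->
  (forall t x i, 0 < t -> C x -> 0 <= u t x i 0) -> (forall t x, 0 < t -> C x -> B (u t x)) ->
  (forall t x, 0 < t -> C x -> is_derive t (1 : R) (fun s => u s x) (du t x)) ->
  (forall t x i, 0 < t -> C x ->
     dispersal Omega K d u t x i 0 + F t x (u t x) i 0 <= du t x i 0) ->
  exists2 G : R, 0 < G & forall s tau x i, 0 < s -> 0 <= tau -> s + tau <= tmax -> C x ->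
    expR (- (G * tau)) * u s x i 0 <= u (tau + s) x i 0.
Proof.
move=> L0 qm B0 F0 u0 uB ud us.
have [G G0 ode] := supersolution_ode_lower L0 qm B0 F0 u0 uB ud us.
exists G => // s tau x i s0 tau0 sle Cx; have := ode s tau x i 0 s0 tau0 sle Cx.
rewrite mul0r subr0 add0r mulrC; apply => r /andP[sr _].
rewrite mulr_ge0 ?(ltW (hd i)) //; apply: nonlocal_ge0 => // y /subset_closure; apply: u0.
exact: lt_trans s0 sr.
Qed.

(** Positivity at one time is not uniform when [u] is only measurable; the
    nonlocal term, being continuous in space, makes it uniform one period later. *)
Lemma periodic_lower_bound : 0 < t0 -> 0 <= L ->
  quasi_monotone C B (t0 + 2 * T) L F -> B 0 -> (forall t x, 0 <= t -> C x -> F t x 0 = 0) ->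
  (forall t x, C x -> u (t + T) x = u t x) -> (forall t x i, C x -> 0 <= u t x i 0) ->
  (forall t x, C x -> B (u t x)) -> (forall t i, bm (fun y => u t y i 0)) ->
  (forall t x, 0 < t -> C x -> is_derive t (1 : R) (fun s => u s x) (du t x)) ->
  (forall t x i, 0 < t -> C x ->
     dispersal Omega K d u t x i 0 + F t x (u t x) i 0 <= du t x i 0) ->
  (forall x i, C x -> 0 < u t0 x i 0) ->
  exists2 c, 0 < c & forall t x i, C x -> c <= u t x i 0.
Proof.
move=> t00 L0 qm B0 F0 uT u0 uB ub ud us upos.
have u0' t x i : 0 < t -> C x -> 0 <= u t x i 0 by move=> _; exact: u0.
have uB' t x : 0 < t -> C x -> B (u t x) by move=> _; exact: uB.
have [G G0 ode] := supersolution_ode_lower L0 qm B0 F0 u0' uB' ud us.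
have pers s tau x i : 0 < s -> 0 <= tau -> s + tau <= t0 + 2 * T -> C x ->
    expR (- (G * tau)) * u s x i 0 <= u (tau + s) x i 0.
  move=> s0 tau0 sle Cx; have := ode s tau x i 0 s0 tau0 sle Cx.
  rewrite mul0r subr0 add0r mulrC; apply => r /andP[sr _].
  by rewrite mulr_ge0 ?(ltW (hd i)) //; apply: nonlocal_ge0 => // y /subset_closure; exact: u0.
have T2 : t0 + T <= t0 + 2 * T by rewrite lerD2l ler_peMl ?(ltW hT) // ler1n.
have tT : t0 <= t0 + T by rewrite lerDl ltW.
have [k [r [k0 r0 hk]]] := kernel_lower_bound Kcont Kge0 Kgt0 tT.
pose E := expR (- (G * T)); have E0 : 0 < E by exact: expR_gt0.
have neC : C !=set0 by case: neOmega => y /subset_closure Cy; exists y.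
have cC : compact C by exact: bounded_closure_compact.
have u0O t i y : Omega y -> 0 <= u t y i 0 by move=> /subset_closure; exact: u0.
have persE t x i : t0 <= t <= t0 + T -> C x -> E * u t0 x i 0 <= u t x i 0.
  move=> /andP[h1 h2] Cx; have tau0 : 0 <= t - t0 by rewrite subr_ge0.
  have h3 : t0 + (t - t0) <= t0 + 2 * T by rewrite addrC subrK (le_trans h2).
  have := pers t0 (t - t0) x i t00 tau0 h3 Cx; rewrite subrK; apply: le_trans.
  apply: ler_wpM2r; first exact: u0.
  by rewrite /E ler_expR lerN2 ler_pM2l // lerBlDl.
have hq i : exists q : R, 0 < q /\ forall x, C x -> q <= local_mass Omega r (fun y => u t0 y i 0) x.
  have cl := continuous_subspaceT (A := C) (local_mass_continuous oOmega bOmega (r := r) (ub t0 i)).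
  have [x0 /set_mem Cx0 hx0] := compact_EVT_min neC cC cl.
  exists (local_mass Omega r (fun y => u t0 y i 0) x0); split.
    apply: (local_mass_gt0 (s := r) (y := x0) oOmega bOmega) => //; first exact: u0O.
    move=> z Oz; rewrite -ball_normE /=; split=> //; apply: upos; exact: subset_closure.
  by move=> x Cx; apply: hx0; rewrite inE.
have [q hq'] := choice hq.
have [i|q0 q00 hq0] := @common_lower_bound R 'I_m q; first by have [] := hq' i.
have [i|d0 d00 hd0] := @common_lower_bound R 'I_m (fun i => d i 0); first exact: hd.
pose c1 := d0 * (k * (E * q0)).
have c10 : 0 < c1 by rewrite !mulr_gt0.
have nl t x i : t0 <= t <= t0 + T -> C x ->
    c1 <= d i 0 * nonlocal Omega K i t x (fun y => u t y i 0).
  move=> tI Cx; apply: ler_pM => //; rewrite ?(ltW d00) ?mulr_ge0 ?(ltW k0) ?(ltW E0) ?(ltW q00) //.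
  have h1 : k * local_mass Omega r (fun y => u t y i 0) x <=
      nonlocal Omega K i t x (fun y => u t y i 0).
    apply: nonlocal_ge_local_mass => //; first exact: u0O.
    by move=> z; exact: hk.
  apply: le_trans h1; apply: ler_wpM2l; first exact: ltW.
  have [_ /(_ x Cx) h2] := hq' i.
  apply: (@le_trans _ _ (E * local_mass Omega r (fun y => u t0 y i 0) x)).
    by apply: ler_wpM2l; [exact: ltW | exact: le_trans (hq0 i) h2].
  rewrite /local_mass -integralOZ //; last exact: bump_mul_bounded_measurable.
  apply: le_integralO => //.
  - by apply: bounded_measurableZ; exact: bump_mul_bounded_measurable.
  - exact: bump_mul_bounded_measurable.
  move=> y Oy; rewrite mulrCA; apply: ler_wpM2l; first exact: bump_ge0.
  by apply: persE => //; exact: subset_closure.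
have E1 : E < 1 by rewrite /E expR_lt1 oppr_lt0 mulr_gt0.
pose c2 := c1 / G * (1 - E).
have c20 : 0 < c2 by rewrite mulr_gt0 ?divr_gt0 // subr_gt0.
have lb x i : C x -> c2 <= u t0 x i 0.
  move=> Cx; have := ode t0 T x i c1 t00 (ltW hT) T2 Cx.
  rewrite -/E (addrC T) uT // => h; apply: le_trans (h _); last first.
    by move=> s /andP[s1 s2]; apply: nl => //; rewrite !ltW.
  rewrite mulrBl addrCA /c2 mulrBr mulr1 [leRHS]addrC lerDl.
  by apply: mulr_ge0; [exact: u0 | exact: ltW].
exists (E * c2); first exact: mulr_gt0.
move=> t x i Cx; have [s [sI hs]] := periodic_representative t t0 hT.
rewrite (hs _ (fun t => u t x i 0)); last by move=> s'; rewrite uT.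
apply: le_trans (persE s x i sI Cx); apply: ler_wpM2l; [exact: ltW | exact: lb].
Qed.

End PeriodicLowerBound.

(** * The semiflow on the order interval *)

Lemma within_continuous_sum (R : realType) (U : topologicalType) (A : set U) (I : finType)
    (f : I -> U -> R) :
  (forall k, {within A, continuous (f k)}) -> {within A, continuous (fun p => \sum_k f k p)}.
Proof.
move=> cf; elim: (index_enum I) => [|k r IH].
  have -> : (fun p => \sum_(k <- [::]) f k p) = (fun=> 0) by apply/funext => p; rewrite big_nil.
  by apply: continuous_subspaceT; exact: cst_continuous.
have -> : (fun p => \sum_(k <- k :: r) f k p) = (fun p => f k p + \sum_(k <- r) f k p).
  by apply/funext => p; rewrite big_cons.
by move=> p; apply: cvgD; [exact: cf | exact: IH].
Qed.

Section Semiflow.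
Context {R : realType} {m n : nat}.
Variables (Omega : set 'rV[R]_n) (K : 'I_m -> R -> 'rV[R]_n -> R) (d v : 'cV[R]_m)
  (g : R -> 'rV[R]_n -> 'cV[R]_m -> 'cV[R]_m) (T : R).
Implicit Types (t s tau alpha : R) (x y : 'rV[R]_n) (a b z : 'cV[R]_m)
  (phi psi : 'rV[R]_n -> 'cV[R]_m) (u w du dw : R -> 'rV[R]_n -> 'cV[R]_m) (i : 'I_m).
Hypotheses (oOmega : open Omega) (bOmega : bounded_set Omega).
Hypotheses (hd : forall i, 0 < d i 0) (hv : vll 0 v).
Hypothesis Kcont : forall i, continuous (fun p : R * 'rV[R]_n => K i p.1 p.2).
Hypothesis Kge0 : forall i t x, 0 <= K i t x.
Hypothesis Kint : forall i t,
  (\int[lebesgue_tuple n]_y (K i t (row_of_tuple y))%:E = 1)%E.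
Hypothesis gC : C00_1 Omega g.
Hypothesis gcoop : forall t x z, 0 <= t -> closure Omega x -> order_interval v z ->
  cooperative (dmx (g t x) z) /\ irreducible (dmx (g t x) z).
Hypothesis g0 : forall t x, closure Omega x -> g t x 0 = 0.
Hypothesis gv : forall t x z i, closure Omega x -> order_interval v z ->
  z i 0 = v i 0 -> g t x z i 0 <= 0.
Hypothesis gsub : forall t x z alpha, 0 <= t -> closure Omega x ->
  order_interval v z -> vll 0 z -> 0 < alpha -> alpha < 1 ->
  vlt (alpha *: g t x z) (g t x (alpha *: z)).

Local Notation C := (closure Omega).
Local Notation M := (order_interval v).
Local Notation bm := (bounded_measurable Omega).
Local Notation statespace := [set p : R * 'rV[R]_n * 'cV[R]_m | C p.1.2].

Lemma rhs_split (F : R -> 'rV[R]_n -> 'cV[R]_m -> 'cV[R]_m) u t x i :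
  rhs Omega K d F u t x i 0 = dispersal Omega K d u t x i 0 + F t x (u t x) i 0.
Proof. by rewrite /rhs [LHS]mxE. Qed.

(** Globally Lipschitz, and equal to [g] while the state stays in the order interval. *)
Definition clamped t x z : 'cV[R]_m := g t x (vclamp v z).

Let v0 i : 0 <= v i 0. Proof. exact: ltW (v_gt0 hv i). Qed.

Lemma clamped_continuous :
  {within statespace, continuous (fun p => clamped p.1.1 p.1.2 p.2)}.
Proof.
have [cg _ _] := gC.
apply: (within_continuous_comp (h := fun p : R * 'rV[R]_n * 'cV[R]_m => (p.1, vclamp v p.2)) _ _ cg) => //.
apply: continuous_subspaceT; apply: pair_continuous => p; first exact: cvg_fst.
by apply: (@continuous_comp _ _ _ snd (vclamp v)); [exact: cvg_snd | exact: vclamp_continuous].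
Qed.

Lemma clamped_lipschitz tau : exists2 L, 0 <= L & forall t x a b i (N : R), 0 <= t <= tau ->
  C x -> (forall j, `|a j 0 - b j 0| <= N) -> `|clamped t x a i 0 - clamped t x b i 0| <= L * N.
Proof.
have [L L0 hL] := g_lipschitz bOmega gC tau `|v|.
exists L => // t x a b i N tI Cx abN; apply: hL => //;
  try by apply: order_interval_norm; exact: vclamp_in.
move=> j; have := abN j; have N0 : 0 <= N by apply: le_trans (abN j).
by rewrite !ler_norml => /andP[h1 h2]; rewrite vclamp_ge // vclamp_le.
Qed.

Lemma clamped_quasi_monotone tau : exists2 L, 0 <= L & quasi_monotone C setT tau L clamped.
Proof.
have [L L0 hL] := g_quasi_monotone bOmega gC gcoop tau.
exists L => // t x a b i N tI Cx _ _ abN abi.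
have N0 : 0 <= N by have := abN i; lra.
apply: hL => //; try exact: vclamp_in; last exact: vclamp_le.
by move=> j; exact: vclamp_ge.
Qed.

Lemma dispersal_ge0_cst t x i z : (forall i, 0 <= z i 0) -> z i 0 = 0 ->
  0 <= dispersal Omega K d (fun _ _ => z) t x i 0.
Proof.
move=> z0 zi; rewrite dispersalE zi mulr0 subr0 mulr_ge0 ?(ltW (hd i)) //.
by apply: nonlocal_ge0.
Qed.

Lemma dispersal_le0_top t x i : dispersal Omega K d (fun _ _ => v) t x i 0 <= 0.
Proof.
rewrite dispersalE -mulrBr pmulr_rle0 // subr_le0; apply: nonlocal_le => //.
exact: bounded_measurable_cst.
Qed.

Lemma regular_cst tau z : regular Omega tau (fun _ _ => z).
Proof.
split=> [x i _|//|t i _]; first by apply: continuous_subspaceT; exact: cst_continuous.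
  by exists `|z| => t x i _ _; exact: normr_coord_le.
exact: bounded_measurable_cst.
Qed.

(** Existence in the order interval: solve the equation with clamped kinetics,
    then compare with the constant states [0] and [v]. *)
Lemma solution_in_interval phi : X_interval Omega v phi ->
  exists2 u, is_solution Omega K d g 0 phi u & forall t x, 0 <= t -> C x -> M (u t x).
Proof.
move=> [cphi phiM].
have [u su] := solution_exists oOmega bOmega hd Kcont Kge0 Kint clamped_continuous cphi
  clamped_lipschitz.
have [cu u0 du] := su.
have is_cst z t : is_derive t (1 : R) (fun _ : R => z) (0 : 'cV[R]_m) by exact: is_derive_cst.
have uM t x : 0 <= t -> C x -> M (u t x).
  move=> t0 Cx; have ru := continuous_regular oOmega bOmega t cu.
  have [L L0 qm] := clamped_quasi_monotone t; have tI : 0 <= t <= t by rewrite t0 lexx.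
  apply/order_intervalP => i; apply/andP; split.
    rewrite -[leLHS](_ : (0 : 'cV[R]_m) i 0 = 0); last by rewrite mxE.
    apply: (evolution_comparison oOmega bOmega hd Kcont Kge0 Kint (F := clamped)
      (Bset := setT) (tau := t) (L := L) (u := u) (w := fun _ _ => 0)
      (du := rhs Omega K d clamped u) (dw := fun _ _ => 0)) => //.
    - exact: regular_cst.
    - by move=> s y /andP[s0 _] Cy; exact: du.
    - by move=> s y j _ Cy; rewrite rhs_split.
    - move=> s y j _ Cy; rewrite [leLHS]mxE addr_ge0 //.
        by apply: dispersal_ge0_cst; rewrite ?mxE // => k; rewrite mxE.
      by rewrite /clamped vclamp_id ?g0 ?mxE //; exact: order_interval_zero.
    - move=> y j Cy; rewrite u0 // mxE.
      by have /order_intervalP /(_ j) /andP[] := phiM y Cy.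
  apply: (evolution_comparison oOmega bOmega hd Kcont Kge0 Kint (F := clamped)
      (Bset := setT) (tau := t) (L := L) (u := fun _ _ => v) (w := u)
      (du := fun _ _ => 0) (dw := rhs Omega K d clamped u)) => //.
  - exact: regular_cst.
  - by move=> s y /andP[s0 _] Cy; exact: du.
  - move=> s y j _ Cy; rewrite [leRHS]mxE -[leRHS]addr0 lerD ?dispersal_le0_top //.
    have Mv := order_interval_top hv.
    by rewrite /clamped vclamp_id // gv.
  - by move=> s y j _ Cy; rewrite rhs_split.
  - move=> y j Cy; rewrite u0 //.
    by have /order_intervalP /(_ j) /andP[] := phiM y Cy.
exists u => //; split=> // t x t0 Cx.
by have := du t x t0 Cx; rewrite /satisfies_at /clamped vclamp_id //; apply: uM => //; exact: ltW.
Qed.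

Definition flow phi := solution Omega K d g 0 phi.

Lemma flow_is_solution phi : X_interval Omega v phi ->
  is_solution Omega K d g 0 phi (flow phi).
Proof. by move=> /solution_in_interval[u su _]; apply: xgetPex; exists u. Qed.

Lemma solution_eq_flow phi u t x : X_interval Omega v phi ->
  is_solution Omega K d g 0 phi u -> 0 <= t -> C x -> u t x = flow phi t x.
Proof.
move=> Xphi su; apply: (solution_unique oOmega bOmega hd Kcont Kge0 Kint _ su
  (flow_is_solution Xphi)).
by move=> tau B; exact: g_lipschitz.
Qed.

Lemma flow_in_interval phi t x : X_interval Omega v phi -> 0 <= t -> C x -> M (flow phi t x).
Proof.
move=> Xphi t0 Cx; have [u su uM] := solution_in_interval Xphi.
by rewrite -(solution_eq_flow Xphi su) //; exact: uM.
Qed.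

Lemma flow_continuous phi : X_interval Omega v phi ->
  {within [set p : R * 'rV[R]_n | 0 <= p.1 /\ C p.2], continuous (fun p => flow phi p.1 p.2)}.
Proof. by move=> /flow_is_solution[]. Qed.

Lemma flow_regular phi tau : X_interval Omega v phi -> regular Omega tau (flow phi).
Proof. by move=> /flow_continuous; exact: continuous_regular. Qed.

Lemma flow0 phi x : X_interval Omega v phi -> C x -> flow phi 0 x = phi x.
Proof. by move=> /flow_is_solution[_ h _]; exact: h. Qed.

Lemma flow_derive phi t x : X_interval Omega v phi -> 0 < t -> C x ->
  is_derive t (1 : R) (fun s => flow phi s x) (rhs Omega K d g (flow phi) t x).
Proof. by move=> /flow_is_solution[_ _ h]; exact: h. Qed.

Lemma flow_interval phi t : X_interval Omega v phi -> 0 <= t -> X_interval Omega v (flow phi t).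
Proof.
move=> Xphi t0; split; last by move=> x Cx; exact: flow_in_interval.
apply: within_coordP => i j; rewrite ord1.
exact: (slice_continuous (A := [set t | 0 <= t]) (t := t) t0 (flow_continuous Xphi) (i := i)).
Qed.

Lemma subsolution_le_flow phi w dw tau : X_interval Omega v phi -> regular Omega tau w ->
  (forall t x, 0 < t < tau -> C x -> is_derive t (1 : R) (fun s => w s x) (dw t x)) ->
  (forall t x, 0 < t < tau -> C x -> M (w t x)) ->
  (forall t x i, 0 < t < tau -> C x ->
     dw t x i 0 <= dispersal Omega K d w t x i 0 + g t x (w t x) i 0) ->
  (forall x i, C x -> w 0 x i 0 <= phi x i 0) ->
  forall t x i, 0 <= t <= tau -> C x -> w t x i 0 <= flow phi t x i 0.
Proof.
move=> Xphi rw dw_ wM sw init; have [L L0 qm] := g_quasi_monotone bOmega gC gcoop tau.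
apply: (evolution_comparison oOmega bOmega hd Kcont Kge0 Kint (F := g) (Bset := M)
  (tau := tau) (L := L) (du := rhs Omega K d g (flow phi)) (dw := dw)) => //.
- exact: flow_regular.
- by move=> t x /andP[t0 _]; exact: flow_derive.
- by move=> t x tI Cx; split; [apply: flow_in_interval => //; have /andP[/ltW] := tI | exact: wM].
- by move=> t x i _ _; rewrite rhs_split.
- by move=> x i Cx; rewrite flow0 //; exact: init.
Qed.

Lemma flow_monotone phi psi t x i : X_interval Omega v phi -> X_interval Omega v psi ->
  (forall x i, C x -> phi x i 0 <= psi x i 0) -> 0 <= t -> C x ->
  flow phi t x i 0 <= flow psi t x i 0.
Proof.
move=> Xphi Xpsi le t0 Cx.
apply: (subsolution_le_flow (tau := t) (dw := rhs Omega K d g (flow phi))) => //.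
- exact: flow_regular.
- by move=> s y /andP[s0 _]; exact: flow_derive.
- by move=> s y /andP[/ltW s0 _]; exact: flow_in_interval.
- by move=> s y j _ _; rewrite rhs_split.
- by move=> y j Cy; rewrite flow0 //; exact: le.
- by rewrite t0 lexx.
Qed.

Lemma linear_part_continuous :
  {within statespace, continuous (fun p => linear_part g p.1.1 p.1.2 p.2)}.
Proof.
apply: within_coordP => i j; rewrite ord1.
have -> : (fun p : R * 'rV[R]_n * 'cV[R]_m => linear_part g p.1.1 p.1.2 p.2 i 0) =
    (fun p => \sum_k dmx (g p.1.1 p.1.2) 0 i k * p.2 k 0).
  by apply/funext => p; rewrite linear_partE.
have [_ _ cd] := gC; apply: within_continuous_sum => k p; apply: cvgM.
  move: p; apply: (within_continuous_comp (h := fun p : R * 'rV[R]_n * 'cV[R]_m => (p.1, 0 : 'cV[R]_m))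
    _ _ (within_coord (i := i) (j := k) cd)) => //.
  apply: continuous_subspaceT; apply: pair_continuous => p; first exact: cvg_fst.
  exact: cvg_cst.
move: p; apply: (within_coord (i := k) (j := 0) (f := fun p : R * 'rV[R]_n * 'cV[R]_m => p.2)).
by apply: continuous_subspaceT => p; exact: cvg_snd.
Qed.

Lemma linear_flow_is_solution phi : X_space Omega phi ->
  is_solution Omega K d (linear_part g) 0 phi (fun t => Phi Omega K d g t 0 phi).
Proof.
move=> cphi; apply: xgetPex.
apply: (solution_exists oOmega bOmega hd Kcont Kge0 Kint linear_part_continuous cphi).
by move=> tau; exact: linear_lipschitz.
Qed.

(** Sublinearity makes the linearisation at [0] a supersolution. *)
Lemma flow_le_linear_flow phi t x i : X_interval Omega v phi -> 0 <= t -> C x ->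
  flow phi t x i 0 <= Phi Omega K d g t 0 phi x i 0.
Proof.
move=> Xphi t0 Cx; have [Xs _] := Xphi.
have [cp p0 dp] := linear_flow_is_solution Xs.
have [L L0 qm] := linear_quasi_monotone bOmega hv gC gcoop t.
apply: (evolution_comparison oOmega bOmega hd Kcont Kge0 Kint (F := linear_part g)
  (Bset := setT) (tau := t) (L := L) (dw := rhs Omega K d g (flow phi))
  (u := fun t => Phi Omega K d g t 0 phi)
  (du := rhs Omega K d (linear_part g) (fun t => Phi Omega K d g t 0 phi))) => //.
- exact: continuous_regular.
- exact: flow_regular.
- by move=> s y /andP[s0 _] Cy; exact: dp.
- by move=> s y /andP[s0 _]; exact: flow_derive.
- by move=> s y j _ _; rewrite rhs_split.
- move=> s y j /andP[s0 _] Cy; rewrite rhs_split lerD2l.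
  exact: (g_le_linear bOmega hv gC g0 gsub j (ltW s0) Cy (flow_in_interval Xphi (ltW s0) Cy)).
- by move=> y j Cy; rewrite flow0 // p0.
- by rewrite t0 lexx.
Qed.

Hypothesis hT : 0 < T.
Hypothesis Kper : forall i t x, K i (t + T) x = K i t x.
Hypothesis gper : forall t x z, C x -> g (t + T) x z = g t x z.

Lemma nonlocal_periodic i t x f : nonlocal Omega K i (t + T) x f = nonlocal Omega K i t x f.
Proof. by apply: eq_integralO => y _; rewrite Kper. Qed.

Lemma rhs_shift u t x : C x ->
  rhs Omega K d g u (t + T) x = rhs Omega K d g (fun s => u (s + T)) t x.
Proof.
by move=> Cx; apply/colP => i; rewrite !rhsE nonlocal_periodic gper.
Qed.

(** By periodicity of the coefficients, both sides solve the same initial value problem. *)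
Lemma flow_shift phi t x : X_interval Omega v phi -> 0 <= t -> C x ->
  flow (flow phi T) t x = flow phi (t + T) x.
Proof.
move=> Xphi t0 Cx; have XT := flow_interval Xphi (ltW hT).
have [cu _ du] := flow_is_solution Xphi.
apply/esym; refine (solution_eq_flow (u := fun s => flow phi (s + T)) XT _ t0 Cx); split.
- apply: (within_continuous_comp (h := fun p : R * 'rV[R]_n => (p.1 + T, p.2)) _ _ cu).
    apply: continuous_subspaceT; apply: pair_continuous => p; last exact: cvg_snd.
    by apply: cvgD; [exact: cvg_fst | exact: cvg_cst].
  by move=> p [/= p0 Cp]; split => //; rewrite addr_ge0 // ltW.
- by move=> y Cy; rewrite add0r.
- move=> s y s0 Cy.
  rewrite /satisfies_at -/(rhs Omega K d g (fun s => flow phi (s + T)) s y) -rhs_shift //.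
  by apply: (@is_derive_shift _ _ (fun r => flow phi r y)); apply: flow_derive => //; rewrite addr_gt0.
Qed.



(** * Periodic limits of orbits *)

Lemma g_state_continuous t x i : C x -> continuous (fun z => g t x z i 0).
Proof.
move=> Cx; have [cg _ _] := gC; apply/continuous_subspace_setT.
apply: (within_continuous_comp (h := fun z : 'cV[R]_m => ((t, x), z)) _ _
  (within_coord (i := i) (j := 0) cg)) => //.
apply: continuous_subspaceT; apply: pair_continuous; [exact: cst_continuous | exact: id_continuous].
Qed.

(** In the order interval the time derivatives are bounded, so solutions are
    equi-Lipschitz in time and their derivatives equicontinuous in time, all
    uniformly in space.  Hence pointwise limits of solutions are solutions, even
    when the limit is only measurable in space. *)
Lemma limit_solution (u : nat -> R -> 'rV[R]_n -> 'cV[R]_m) (W : R -> 'rV[R]_n -> 'cV[R]_m) (a b : R) t x :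
  a < t < b -> C x ->
  (forall k s y, a <= s <= b -> C y -> M (u k s y)) ->
  (forall k s i, a <= s <= b -> bm (fun y => u k s y i 0)) ->
  (forall k s y, a <= s <= b -> C y ->
     is_derive s (1 : R) (fun s => u k s y) (rhs Omega K d g (u k) s y)) ->
  (forall s y i, a <= s <= b -> C y -> u k s y i 0 @[k --> \oo] --> W s y i 0) ->
  is_derive t (1 : R) (fun s => W s x) (rhs Omega K d g W t x).
Proof.
move=> /andP[at_ tb] Cx uM ub ud uW.
have tI : a <= t <= b by rewrite !ltW.
pose N := `|v|; have N0 : 0 <= N by exact: normr_ge0.
have uN k s y i : a <= s <= b -> C y -> `|u k s y i 0| <= N.
  move=> sI Cy; apply: le_trans (normr_coord_le _ _ _) _.
  by apply: order_interval_norm; exact: uM.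
have uN' k s y : a <= s <= b -> C y -> `|u k s y| <= N.
  by move=> sI Cy; apply: order_interval_norm; exact: uM.
have [cg _ _] := gC.
pose A : set (R * 'rV[R]_n * 'cV[R]_m) := (`[a, b]%classic `*` C) `*` [set z | `|z| <= N].
have cA : compact A.
  apply: compact_setX; last exact: compact_cV_ball.
  by apply: compact_setX; [exact: segment_compact | exact: bounded_closure_compact].
have cgA i : {within A, continuous (fun p => g p.1.1 p.1.2 p.2 i 0)}.
  by apply: within_coord; apply: continuous_subspaceW cg => p [[_ Cp] _].
have inA s y z : a <= s <= b -> C y -> `|z| <= N -> A (s, y, z).
  by move=> sI Cy zN; split => //; split => //; rewrite /= in_itv.
have [|Bg Bg0 hBg] := @compact_within_bounded _ _ _ A (fun p => g p.1.1 p.1.2 p.2) cA.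
  by apply: continuous_subspaceW cg => p [[_ Cp] _].
pose D := \sum_i d i 0.
have dD j : d j 0 <= D by rewrite /D (bigD1 j) //= lerDl sumr_ge0 // => k _; rewrite ltW.
have D0 : 0 <= D by apply: sumr_ge0 => k _; rewrite ltW.
pose L := D * N + D * N + Bg.
have L0 : 0 <= L by rewrite !addr_ge0 ?mulr_ge0.
have rhsL k s y i : a <= s <= b -> C y -> `|rhs Omega K d g (u k) s y i 0| <= L.
  move=> sI Cy; rewrite rhsE.
  have dN (q : R) : `|q| <= N -> `|d i 0 * q| <= D * N.
    by move=> qN; rewrite normrM; apply: ler_pM => //; rewrite ger0_norm // ltW.
  have h1 : `|d i 0 * nonlocal Omega K i s y (fun y => u k s y i 0)| <= D * N.
    apply/dN/normr_nonlocal_le => //; first exact: ub.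
    by move=> z /subset_closure; exact: uN.
  have h2 : `|d i 0 * u k s y i 0| <= D * N by apply/dN/uN.
  have h3 : `|g s y (u k s y) i 0| <= Bg.
    by apply: le_trans (normr_coord_le _ i 0) (hBg _ (inA _ _ _ sI Cy (uN' k s y sI Cy))).
  apply: le_trans (ler_normD _ _) _; apply: lerD => //.
  by apply: le_trans (ler_normB _ _) _; exact: lerD.
have uL k s s' y i : a <= s <= b -> a <= s' <= b -> C y ->
    `|u k s' y i 0 - u k s y i 0| <= L * `|s' - s|.
  wlog ss' : s s' / s <= s'.
    move=> h sI sI' Cy; have [|/ltW] := leP s s'; first by move=> /h; exact.
    by move=> /h; rewrite distrC (distrC s'); exact.
  move=> /andP[as_ sb] /andP[as' sb'] Cy; rewrite (@ger0_norm _ (s' - s)) ?subr_ge0 //.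
  apply: (derivable_increment_le (f := fun s => u k s y i 0)
    (df := fun s => rhs Omega K d g (u k) s y i 0) ss') => q /andP[q1 q2].
    have qI : a <= q <= b by rewrite (le_trans as_) // (le_trans q2).
    exact: (is_derive_coord i 0 (ud k q y qI Cy)).
  by apply: rhsL => //; rewrite (le_trans as_) // (le_trans q2).
apply: is_derive_coordP => i j; rewrite (ord1 j) {j}.
apply: is_derive_of_increment => e e0.
have V0 := volumeO_ge0 Omega; set V := volumeO Omega in V0.
(* four errors of size [e / 4]: the kernel, the nonlocal average, the state, the kinetics *)
have e40 : 0 < e / 4 by exact: divr_gt0.
have P1 : 0 < d i 0 * (N * V) + 1 by rewrite ltr_wpDl // !mulr_ge0 // ltW.
have P2 : 0 < d i 0 * L + 1 by rewrite ltr_wpDl // !mulr_ge0 // ltW.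
have P3 : 0 < L + 1 by rewrite ltr_wpDl.
pose e1 := e / 4 / (d i 0 * (N * V) + 1); have e10 : 0 < e1 by exact: divr_gt0.
have [r1 r10 hr1] := kernel_uniform bOmega Kcont i a b e10.
have [r2 r20 hr2] := compact_uniform_continuity cA (cgA i) e40.
have eqc : exists2 r, 0 < r & forall k s, a <= s <= b -> `|s - t| < r ->
    `|rhs Omega K d g (u k) s x i 0 - rhs Omega K d g (u k) t x i 0| <= e.
  exists (Num.min (Num.min r1 r2) (Num.min (r2 / (L + 1)) (e / 4 / (d i 0 * L + 1)))).
    by rewrite !lt_min r10 r20 !divr_gt0.
  move=> k s sI; rewrite !lt_min => /andP[/andP[st1 st2] /andP[]].
  rewrite !ltr_pdivlMr // => st3 st4.
  have st0 := normr_ge0 (s - t).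
  rewrite !rhsE.
  have h1 : `|nonlocal Omega K i s x (fun y => u k s y i 0)
      - nonlocal Omega K i t x (fun y => u k t y i 0)| <= e1 * N * V + L * `|s - t|.
    apply: nonlocal_diff => //; try exact: ub.
    - by move=> y /subset_closure; exact: uN.
    - exact: mulr_ge0.
    - by move=> y /subset_closure Cy; exact: uL.
    - move=> y /subset_closure Cy; apply/ltW/hr1 => //; exact: ballxx.
  have h2 := uL k t s x i tI sI Cx.
  have h3 : `|g s x (u k s x) i 0 - g t x (u k t x) i 0| < e / 4.
    apply: (hr2 (s, x, u k s x) (t, x, u k t x)).
    - by apply: inA => //; exact: uN'.
    - by apply: inA => //; exact: uN'.
    - split; first by split => /=; [rewrite -ball_normE | exact: ballxx].
      rewrite -ball_normE /=.
      apply: (@le_lt_trans _ _ (L * `|s - t|)).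
        apply: normr_mx_le; first exact: mulr_ge0.
        by move=> j l; rewrite (ord1 l) !mxE; exact: uL.
      apply: le_lt_trans st3; rewrite mulrC; apply: ler_wpM2l => //; lra.
  have dh (p q : R) : `|p| <= q -> `|d i 0 * p| <= d i 0 * q.
    by move=> pq; rewrite normrM ger0_norm ?(ltW (hd i)) // ler_pM2l.
  have h1' := dh _ _ h1; have h2' := dh _ _ h2.
  have b1 : d i 0 * (e1 * N * V) <= e / 4.
    rewrite (_ : d i 0 * (e1 * N * V) = e1 * (d i 0 * (N * V))); last by ring.
    rewrite /e1 mulrAC ler_pdivrMr //; apply: ler_wpM2l; [exact: ltW | lra].
  have b2 : d i 0 * (L * `|s - t|) <= e / 4.
    rewrite ler_pdivlMr //; apply/ltW/(le_lt_trans _ st4); apply: ler_wpM2r => //.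
    by rewrite mulrA mulrC; apply: ler_wpM2l => //; rewrite lerDl.
  rewrite mulrBr mulrDr in h1'; rewrite mulrBr in h2'.
  move: h1' h2' h3 b1 b2; clear.
  move: (d i 0 * nonlocal _ _ _ _ _ _) (d i 0 * nonlocal _ _ _ _ _ _) (d i 0 * u k s x i 0)
    (d i 0 * u k t x i 0) (g s x _ i 0) (g t x _ i 0) (d i 0 * (e1 * N * V))
    (d i 0 * (L * `|s - t|)) => p1 p2 p3 p4 p5 p6 p7 p8.
  rewrite !ler_norml ltr_norml => /andP[? ?] /andP[? ?] /andP[? ?] ? ?.
  by apply/andP; split; lra.
have [r r0 hr] := eqc.
exists (Num.min r (Num.min (t - a) (b - t))); first by rewrite !lt_min r0 !subr_gt0 at_ tb.
move=> h; rewrite !lt_min => /andP[hr0 /andP[ha hb]].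
have thI : a <= t + h <= b.
  move: ha; rewrite ltr_norml opprB ltrBlDr addrC => /andP[h1 _].
  by move: hb; rewrite ltr_norml ltrBrDl => /andP[_ h2]; rewrite (ltW h1) ltW.
have fin k : `|u k (t + h) x i 0 - u k t x i 0 - h * rhs Omega K d g (u k) t x i 0| <= e * `|h|.
  set c := rhs Omega K d g (u k) t x i 0.
  have key p q : a <= p -> p <= q -> q <= b -> (forall s, p <= s <= q -> `|s - t| < r) ->
      `|(u k q x i 0 - q * c) - (u k p x i 0 - p * c)| <= e * (q - p).
    move=> ap pq qb near_; apply: (derivable_increment_le (f := fun s => u k s x i 0 - s * c)
      (df := fun s => rhs Omega K d g (u k) s x i 0 - c) pq) => s /andP[ps sq];
      have sI : a <= s <= b by rewrite (le_trans ap ps) (le_trans sq qb).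
      apply: is_deriveB; first exact: (is_derive_coord i 0 (ud k s x sI Cx)).
      have -> : (fun s => s * c) = (fun s : R => c * s) by apply/funext => q'; rewrite mulrC.
      rewrite -[X in is_derive _ _ _ X]mulr1; exact: (is_deriveMl c (is_derive_id s (1 : R))).
    by apply: hr => //; apply: near_; rewrite ps sq.
  have /andP[th1 th2] := thI.
  have [h0|h0] := leP 0 h.
    have := key t (t + h) (ltW at_) _ th2 _; rewrite lerDl h0 => /(_ isT).
    rewrite (_ : t + h - t = h) ?(ger0_norm h0); last by ring.
    move=> k1.
    rewrite (_ : _ - _ - _ = u k (t + h) x i 0 - (t + h) * c - (u k t x i 0 - t * c)); last by ring.
    apply: k1 => s /andP[s1 s2]; rewrite ger0_norm ?subr_ge0 //.
    by move: hr0; rewrite ger0_norm // => hr0; apply: le_lt_trans hr0; rewrite lerBlDl.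
  have := key (t + h) t th1 _ (ltW tb) _; rewrite gerDl (ltW h0) => /(_ isT).
  rewrite (_ : t - (t + h) = - h) ?(ltr0_norm h0); last by ring.
  move=> k1.
  rewrite (_ : _ - _ - _ = - (u k t x i 0 - t * c - (u k (t + h) x i 0 - (t + h) * c))); last by ring.
  rewrite normrN; apply: k1 => s /andP[s1 s2]; rewrite ler0_norm ?subr_le0 //.
  by move: hr0; rewrite ltr0_norm // => hr0; apply: le_lt_trans hr0; rewrite lerN2 lerBrDl.
have crhs : rhs Omega K d g (u k) t x i 0 @[k --> \oo] --> rhs Omega K d g W t x i 0.
  rewrite rhsE; under eq_fun do rewrite rhsE.
  apply: cvgD; first apply: cvgB.
  - apply: cvgMr.
    have [_ [BK hBK]] := kernel_bounded_measurable oOmega bOmega Kcont i t x.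
    have [] := integralO_cvg (f := fun k y => K i t (x - y) * u k t y i 0)
      (g := fun y => K i t (x - y) * W t y i 0) (B := BK * N) oOmega bOmega => //.
    - by move=> k; apply: kernel_mul_bounded_measurable => //; exact: ub.
    - move=> k y Oy; rewrite normrM; apply: ler_pM => //; first exact: hBK.
      by apply: uN => //; exact: subset_closure.
    - by move=> y Oy; apply: cvgMr; apply: uW => //; exact: subset_closure.
  - by apply: cvgMr; exact: uW.
  - have cu : u k t x @[k --> \oo] --> W t x by apply: cvg_coord_col => l; exact: uW.
    exact: (cvg_comp (fun k => u k t x) (fun z => g t x z i 0) cu (@g_state_continuous t x i Cx (W t x))).
have clim : `|u k (t + h) x i 0 - u k t x i 0 - h * rhs Omega K d g (u k) t x i 0| @[k --> \oo] -->
    `|W (t + h) x i 0 - W t x i 0 - h * rhs Omega K d g W t x i 0|.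
  apply: cvg_norm; apply: cvgB; last exact: cvgMr.
  by apply: cvgB; exact: uW.
rewrite -(cvg_lim (@Rhausdorff R) clim); apply: limr_le; first by apply/cvg_ex; eexists; exact: clim.
by near=> k; exact: fin.
Unshelve. all: by end_near. Qed.

Section PeriodicLimit.
Variable phi : 'rV[R]_n -> 'cV[R]_m.
Hypothesis Xphi : X_interval Omega v phi.

Fixpoint period_map (k : nat) psi := if k is k'.+1 then period_map k' (flow psi T) else psi.

Lemma period_map_interval k psi : X_interval Omega v psi -> X_interval Omega v (period_map k psi).
Proof. by elim: k psi => //= k IH psi Xpsi; apply: IH; apply: flow_interval => //; exact: ltW. Qed.

Lemma flow_period_map k psi t x : X_interval Omega v psi -> 0 <= t -> C x ->
  flow (period_map k psi) t x = flow psi (t + k%:R * T) x.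
Proof.
elim: k psi t => [|k IH] psi t Xpsi t0 Cx /=; first by rewrite mul0r addr0.
rewrite IH //; last by apply: flow_interval => //; exact: ltW.
rewrite flow_shift //; last by rewrite addr_ge0 // mulr_ge0 // ltW.
by rewrite -addrA -(addn1 k) natrD mulrDl mul1r.
Qed.

(** The maximum gives a meaning to negative times and affects only finitely many [k]. *)
Definition periodic_limit t x : 'cV[R]_m :=
  \col_i limn (fun k => flow phi (Num.max 0 (t + k%:R * T)) x i 0).

Hypothesis cvg_orbit : forall t x i, 0 <= t -> C x ->
  cvgn (fun k => flow phi (t + k%:R * T) x i 0).

Local Notation W := periodic_limit.

Lemma periodic_limit_cvg t x i : C x ->
  flow phi (Num.max 0 (t + k%:R * T)) x i 0 @[k --> \oo] --> W t x i 0.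
Proof.
move=> Cx; rewrite mxE; have [k0 /ltW t0] := eventually_nonneg t hT.
apply: cvgP; rewrite -(cvg_shiftn k0).
have -> : [sequence flow phi (Num.max 0 (t + (k + k0)%:R * T)) x i 0]_k =
    (fun k => flow phi (t + k0%:R * T + k%:R * T) x i 0).
  apply/funext => k /=; rewrite natrD mulrDl (addrC (k%:R * T)) addrA max_r //.
  by rewrite addr_ge0 // mulr_ge0 // ltW.
exact: cvg_orbit t0 Cx.
Qed.

Lemma periodic_limit_cvg_ge0 t x i : 0 <= t -> C x ->
  flow phi (t + k%:R * T) x i 0 @[k --> \oo] --> W t x i 0.
Proof.
move=> t0 Cx; have := periodic_limit_cvg (t := t) (i := i) Cx.
have -> // : (fun k : nat => flow phi (Num.max 0 (t + k%:R * T)) x i 0) =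
  (fun k => flow phi (t + k%:R * T) x i 0).
by apply/funext => k; rewrite max_r // addr_ge0 // mulr_ge0 // ltW.
Qed.

Lemma periodic_limit_periodic t x : C x -> W (t + T) x = W t x.
Proof.
move=> Cx; apply/colP => i; have h := periodic_limit_cvg (t := t) (i := i) Cx.
have := periodic_limit_cvg (t := t + T) (i := i) Cx.
have -> : (fun k : nat => flow phi (Num.max 0 (t + T + k%:R * T)) x i 0) =
  [sequence flow phi (Num.max 0 (t + k.+1%:R * T)) x i 0]_k.
  by apply/funext => k /=; rewrite -addrA -(addn1 k) natrD mulrDl mul1r (addrC T).
rewrite (cvg_shiftS (fun k => flow phi (Num.max 0 (t + k%:R * T)) x i 0)) => h'.
exact: (cvg_unique _ h' h).
Qed.

Lemma periodic_limit_interval t x : C x -> M (W t x).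
Proof.
move=> Cx; apply/order_intervalP => i; have c := periodic_limit_cvg (t := t) (i := i) Cx.
have uM k : M (flow phi (Num.max 0 (t + k%:R * T)) x).
  by apply: flow_in_interval => //; rewrite le_max lexx.
have h : cvgn (fun k => flow phi (Num.max 0 (t + k%:R * T)) x i 0) by apply/cvg_ex; eexists; exact: c.
rewrite -(cvg_lim (@Rhausdorff R) c); apply/andP; split.
  by apply: limr_ge => //; near=> k; have /order_intervalP /(_ i) /andP[] := uM k.
by apply: limr_le => //; near=> k; have /order_intervalP /(_ i) /andP[] := uM k.
Unshelve. all: by end_near. Qed.

Lemma periodic_limit_bounded_measurable t i : bm (fun y => W t y i 0).
Proof.
have max0 (s : R) : 0 <= Num.max 0 s by rewrite le_max lexx.
have [|||b _] := @integralO_cvg _ _ _ oOmega bOmega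
  (fun k y => flow phi (Num.max 0 (t + k%:R * T)) y i 0) (fun y => W t y i 0) `|v|; last exact: b.
- move=> k; have [_ _ h] := flow_regular (Num.max 0 (t + k%:R * T)) Xphi.
  by apply: h; rewrite max0 lexx.
- move=> k y /subset_closure Cy; apply: le_trans (normr_coord_le _ _ _) _.
  by apply: order_interval_norm; exact: flow_in_interval.
- by move=> y /subset_closure Cy; exact: periodic_limit_cvg.
Qed.

Lemma periodic_limit_B_per : B_per_interval Omega v T W.
Proof.
split; last by move=> t x Cx; exact: periodic_limit_interval.
split.
- move=> i.
  have mA : measurable (@time_space R n @^-1` cylinder Omega).
    rewrite (_ : _ @^-1` _ = ~` (@time_space R n @^-1` (~` cylinder Omega))); last first.
      by rewrite preimage_setC setCK.
    apply: measurableC; apply: measurable_time_space_open; rewrite openC.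
    by apply: (@closed_comp _ _ snd C); [move=> p _; exact: cvg_snd | exact: closed_closure].
  apply: (@measurable_fun_cvg _ (measurableTypeR R * n.-tuple (measurableTypeR R))%type R _
    (fun k p => flow phi (Num.max 0 (p.1 + k%:R * T)) (row_of_tuple p.2) i 0)); last first.
    by move=> p; exact: periodic_limit_cvg.
  move=> k; apply: (measurable_time_space_continuous
    (f := fun p : R * 'rV[R]_n => flow phi (Num.max 0 (p.1 + k%:R * T)) p.2 i 0) mA).
  apply: (within_continuous_comp (h := fun p : R * 'rV[R]_n => (Num.max 0 (p.1 + k%:R * T), p.2))
    _ _ (within_coord (i := i) (j := 0) (flow_continuous Xphi))).
    apply: continuous_subspaceT; apply: pair_continuous => p; last exact: cvg_snd.
    apply: (@continuous_max _ _ (fun=> 0) (fun p : R * 'rV[R]_n => p.1 + k%:R * T)); first exact: cvg_cst.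
    by apply: cvgD; [exact: cvg_fst | exact: cvg_cst].
  by move=> p Cp; split => //=; rewrite le_max lexx.
- exists `|v| => t x Cx; apply: order_interval_norm; exact: periodic_limit_interval.
- by move=> t x Cx; exact: periodic_limit_periodic.
Qed.

Lemma rhs_periodic u k t x : (forall t x, C x -> u (t + T) x = u t x) -> C x ->
  rhs Omega K d g u (t + k%:R * T) x = rhs Omega K d g u t x.
Proof.
move=> uT Cx; apply/colP => i.
have E y : C y -> u (t + k%:R * T) y = u t y.
  by move=> Cy; rewrite (@periodic_shift _ _ T (fun t => u t y)) // => s; exact: uT.
rewrite !rhsE E //; congr (_ * _ - _ + _).
  apply: eq_integralO => y /subset_closure Cy; rewrite E //.
  by rewrite (@periodic_shift _ _ T (fun t => K i t (x - y))).
by rewrite (@periodic_shift _ _ T (fun s => g s x (u t x))) // => s; rewrite gper.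
Qed.

(** At positive times this is [limit_solution]; periodicity reaches the other times. *)
Lemma periodic_limit_derive t x : C x ->
  is_derive t (1 : R) (fun s => W s x) (rhs Omega K d g W t x).
Proof.
move=> Cx; have [k0 s0] := eventually_nonneg t hT.
have WT s y : C y -> W (s + T) y = W s y by exact: periodic_limit_periodic.
rewrite -(rhs_periodic k0 t WT Cx).
rewrite (_ : (fun s => W s x) = (fun s => W (s + k0%:R * T) x)); last first.
  by apply/funext => s; rewrite (@periodic_shift _ _ T (fun s => W s x)) // => r; exact: WT.
apply: (is_derive_shift (f := fun s => W s x)); set s := t + _ in s0 *.
have nn (q : R) : s / 2 <= q <= 2 * s -> 0 <= q.
  by move=> /andP[h _]; apply: le_trans h; rewrite divr_ge0 // ltW.
apply: (limit_solution (u := fun k => flow (period_map k phi)) (a := s / 2) (b := 2 * s)) => //.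
- by apply/andP; split; lra.
- by move=> k q y /nn q0 Cy; apply: flow_in_interval => //; exact: period_map_interval.
- move=> k q i /nn q0; have [_ _ h] := flow_regular q (period_map_interval k Xphi).
  by apply: h; rewrite q0 lexx.
- move=> k q y qI Cy; apply: flow_derive => //; first exact: period_map_interval.
  by have /andP[h _] := qI; apply: lt_le_trans h; rewrite divr_gt0.
- move=> q y i /nn q0 Cy; under eq_fun do rewrite flow_period_map //.
  exact: periodic_limit_cvg_ge0.
Qed.

End PeriodicLimit.

Lemma orbit_le phi psi t x i : X_interval Omega v phi -> X_interval Omega v psi ->
  (forall y j, C y -> flow phi T y j 0 <= psi y j 0) -> 0 <= t -> C x ->
  flow phi (t + T) x i 0 <= flow psi t x i 0.
Proof.
move=> Xphi Xpsi le t0 Cx; rewrite -flow_shift //; apply: flow_monotone => //.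
by apply: flow_interval => //; exact: ltW.
Qed.

Lemma orbit_ge phi psi t x i : X_interval Omega v phi -> X_interval Omega v psi ->
  (forall y j, C y -> psi y j 0 <= flow phi T y j 0) -> 0 <= t -> C x ->
  flow psi t x i 0 <= flow phi (t + T) x i 0.
Proof.
move=> Xphi Xpsi le t0 Cx; rewrite -flow_shift //; apply: flow_monotone => //.
by apply: flow_interval => //; exact: ltW.
Qed.

Let addT t (k : nat) : t + k.+1%:R * T = t + k%:R * T + T.
Proof. by rewrite -(addn1 k) natrD mulrDl mul1r addrA. Qed.

Let ge0T t (k : nat) : 0 <= t -> 0 <= t + k%:R * T.
Proof. by move=> t0; rewrite addr_ge0 // mulr_ge0 // ltW. Qed.

Lemma decreasing_orbit_step phi (k : nat) t x i : X_interval Omega v phi ->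
  (forall y j, C y -> flow phi T y j 0 <= phi y j 0) -> 0 <= t -> C x ->
  flow phi (t + k.+1%:R * T) x i 0 <= flow phi (t + k%:R * T) x i 0.
Proof. by move=> Xphi le t0 Cx; rewrite addT; apply: orbit_le => //; exact: ge0T. Qed.

Lemma increasing_orbit_step phi (k : nat) t x i : X_interval Omega v phi ->
  (forall y j, C y -> phi y j 0 <= flow phi T y j 0) -> 0 <= t -> C x ->
  flow phi (t + k%:R * T) x i 0 <= flow phi (t + k.+1%:R * T) x i 0.
Proof. by move=> Xphi le t0 Cx; rewrite addT; apply: orbit_ge => //; exact: ge0T. Qed.

Let orbit_bounds phi t x i : X_interval Omega v phi -> 0 <= t -> C x ->
  0 <= flow phi t x i 0 <= v i 0.
Proof. by move=> Xphi t0 Cx; have /order_intervalP /(_ i) := flow_in_interval Xphi t0 Cx. Qed.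

Lemma decreasing_orbit_cvg phi t x i : X_interval Omega v phi ->
  (forall y j, C y -> flow phi T y j 0 <= phi y j 0) -> 0 <= t -> C x ->
  cvgn (fun k : nat => flow phi (t + k%:R * T) x i 0).
Proof.
move=> Xphi le t0 Cx; apply: nonincreasing_is_cvgn.
  by apply/nonincreasing_seqP => k; exact: decreasing_orbit_step.
by exists 0 => _ [k _ <-]; have /andP[] := orbit_bounds i Xphi (ge0T k t0) Cx.
Qed.

Lemma increasing_orbit_cvg phi t x i : X_interval Omega v phi ->
  (forall y j, C y -> phi y j 0 <= flow phi T y j 0) -> 0 <= t -> C x ->
  cvgn (fun k : nat => flow phi (t + k%:R * T) x i 0).
Proof.
move=> Xphi le t0 Cx; apply: nondecreasing_is_cvgn.
  by apply/nondecreasing_seqP => k; exact: increasing_orbit_step.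
by exists (v i 0) => _ [k _ <-]; have /andP[] := orbit_bounds i Xphi (ge0T k t0) Cx.
Qed.

Lemma periodic_limit_ge phi t x i : X_interval Omega v phi ->
  (forall y j, C y -> phi y j 0 <= flow phi T y j 0) -> 0 <= t -> C x ->
  flow phi t x i 0 <= periodic_limit phi t x i 0.
Proof.
move=> Xphi le t0 Cx.
have cv s y j : 0 <= s -> C y -> cvgn (fun k : nat => flow phi (s + k%:R * T) y j 0).
  exact: increasing_orbit_cvg.
have h := periodic_limit_cvg_ge0 cv (i := i) t0 Cx.
rewrite -(cvg_lim (@Rhausdorff R) h).
have := @nondecreasing_cvgn_le R (fun k : nat => flow phi (t + k%:R * T) x i 0) _ (cv t x i t0 Cx) 0%N.
rewrite mul0r addr0; apply.
by apply/nondecreasing_seqP => k; exact: increasing_orbit_step.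
Qed.

Lemma time_decomposition t (k0 : nat) : k0%:R * T <= t ->
  exists (k : nat) s, [/\ (k0 <= k)%N, 0 <= s <= T & t = s + k%:R * T].
Proof.
move=> kt; have t0 : 0 <= t by apply: le_trans kt; rewrite mulr_ge0 // ltW.
have := truncn_itv (divr_ge0 t0 (ltW hT)); set k := Num.truncn _ => /andP[].
rewrite ler_pdivlMr // ltr_pdivrMr // => h1 h2.
exists k, (t - k%:R * T); split; last by rewrite subrK.
  rewrite -ltnS -(ltr_nat R) -(ltr_pM2r hT); exact: le_lt_trans h2.
rewrite subr_ge0 h1 lerBlDr; apply/ltW; move: h2.
by rewrite -(addn1 k) natrD mulrDl mul1r addrC.
Qed.

Section UniformConvergence.
Variables (phi : 'rV[R]_n -> 'cV[R]_m) (w : R -> 'rV[R]_n -> 'cV[R]_m).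
Hypothesis Xphi : X_interval Omega v phi.
Hypothesis cw : {within cylinder Omega, continuous (fun p => w p.1 p.2)}.
Hypothesis wT : forall t x, C x -> w (t + T) x = w t x.
Hypothesis limw : forall t x, C x -> periodic_limit phi t x = w t x.

Let slab : set (R * 'rV[R]_n) := `[0, T]%classic `*` C.

Let compact_slab : compact slab.
Proof. by apply: compact_setX; [exact: segment_compact | exact: bounded_closure_compact]. Qed.

Let orbit_continuous (k : nat) i : {within slab, continuous (fun p => flow phi (p.1 + k%:R * T) p.2 i 0)}.
Proof.
apply: (within_continuous_comp (h := fun p : R * 'rV[R]_n => (p.1 + k%:R * T, p.2))
  _ _ (within_coord (i := i) (j := 0) (flow_continuous Xphi))).
  apply: continuous_subspaceT; apply: pair_continuous => p; last exact: cvg_snd.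
  by apply: cvgD; [exact: cvg_fst | exact: cvg_cst].
by move=> p [/=]; rewrite in_itv /= => /andP[p0 _] Cp; split => //; exact: ge0T.
Qed.

Let w_continuous i : {within slab, continuous (fun p => w p.1 p.2 i 0)}.
Proof.
apply: within_coord; apply: continuous_subspaceW cw.
by move=> p [_].
Qed.

(** The number [s] is a sign, so that upper and lower estimates are treated alike. *)
Let uniform_in_time (e : R) (s : R) :
  (forall i, exists k0 : nat, forall (k : nat) p, (k0 <= k)%N -> slab p ->
    s * (flow phi (p.1 + k%:R * T) p.2 i 0 - w p.1 p.2 i 0) < e) ->
  exists2 t0, 0 <= t0 & forall t x i, t0 <= t -> C x -> s * (flow phi t x i 0 - w t x i 0) < e.
Proof.
move=> h; have [k0 hk0] := choice h.
exists ((\sum_i k0 i)%N%:R * T); first by rewrite mulr_ge0 // ltW.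
move=> t x i /time_decomposition[k [q [kk q0 ->]]] Cx.
rewrite (@periodic_shift _ _ T (fun t => w t x)); last by move=> r; exact: wT.
apply: (hk0 i k (q, x)); last by split => //=; rewrite in_itv.
by apply: leq_trans kk; rewrite (bigD1 i) //= leq_addr.
Qed.

(** Dini's theorem over one period, extended to later times by periodicity of [w]. *)
Lemma decreasing_orbit_uniform (e : R) : 0 < e ->
  (forall y j, C y -> flow phi T y j 0 <= phi y j 0) ->
  exists2 t0, 0 <= t0 & forall t x i, t0 <= t -> C x -> flow phi t x i 0 < w t x i 0 + e.
Proof.
move=> e0 le; have [i|t0 t00 h] := @uniform_in_time e 1; last first.
  by exists t0 => // t x i tt Cx; have := h t x i tt Cx; rewrite mul1r ltrBlDl.
have cv s y j : 0 <= s -> C y -> cvgn (fun k : nat => flow phi (s + k%:R * T) y j 0).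
  exact: decreasing_orbit_cvg.
have [k p|k p [/=]|p|k0 hk0] := @dini_decreasing _ _ slab
    (fun (k : nat) p => flow phi (p.1 + k%:R * T) p.2 i 0 - w p.1 p.2 i 0) e compact_slab.
- by apply: cvgB; [exact: orbit_continuous | exact: w_continuous].
- rewrite in_itv /= => /andP[p0 _] Cp; rewrite lerD2r; exact: decreasing_orbit_step.
- move=> [/=]; rewrite in_itv /= => /andP[p0 _] Cp.
  have := periodic_limit_cvg_ge0 cv (i := i) p0 Cp; rewrite limw // => c.
  have [k _ hk] : \forall k \near \oo, flow phi (p.1 + k%:R * T) p.2 i 0 < w p.1 p.2 i 0 + e.
    by apply: (cvgr_lt _ c); rewrite ltrDl.
  by exists k; rewrite ltrBlDl; apply: hk => /=.
by exists k0 => k p kk sp; rewrite mul1r; exact: hk0.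
Qed.

Lemma increasing_orbit_uniform (e : R) : 0 < e ->
  (forall y j, C y -> phi y j 0 <= flow phi T y j 0) ->
  exists2 t0, 0 <= t0 & forall t x i, t0 <= t -> C x -> w t x i 0 - e < flow phi t x i 0.
Proof.
move=> e0 le; have [i|t0 t00 h] := @uniform_in_time e (-1); last first.
  by exists t0 => // t x i tt Cx; have := h t x i tt Cx; rewrite mulN1r opprB ltrBlDl addrC -ltrBlDl addrC.
have cv s y j : 0 <= s -> C y -> cvgn (fun k : nat => flow phi (s + k%:R * T) y j 0).
  exact: increasing_orbit_cvg.
have [k p|k p [/=]|p|k0 hk0] := @dini_decreasing _ _ slab
    (fun (k : nat) p => w p.1 p.2 i 0 - flow phi (p.1 + k%:R * T) p.2 i 0) e compact_slab.
- by apply: cvgB; [exact: w_continuous | exact: orbit_continuous].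
- rewrite in_itv /= => /andP[p0 _] Cp; rewrite lerD2l lerN2; exact: increasing_orbit_step.
- move=> [/=]; rewrite in_itv /= => /andP[p0 _] Cp.
  have := periodic_limit_cvg_ge0 cv (i := i) p0 Cp; rewrite limw // => c.
  have [k _ hk] : \forall k \near \oo, w p.1 p.2 i 0 - e < flow phi (p.1 + k%:R * T) p.2 i 0.
    by apply: (cvgr_gt _ c); rewrite ltrBlDr ltrDl.
  by exists k; rewrite ltrBlDl -ltrBlDr; apply: hk => /=.
by exists k0 => k p kk sp; rewrite mulN1r opprB; exact: hk0.
Qed.

End UniformConvergence.

(** * Growth bounds and stability of zero *)

Lemma supnorm_le (U : Type) (A : set U) (f : U -> 'cV[R]_m) (e : R) : 0 <= e ->
  (forall p, A p -> `|f p| <= e) -> supnorm A f <= e.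
Proof.
move=> e0 h; rewrite /supnorm; set S := [set _ | _ in _].
have [->|/set0P S0] := eqVneq S set0; first by rewrite sup0.
by apply: ge_sup => // _ [p Ap <-]; exact: h.
Qed.

Lemma supnorm_ge0 (U : Type) (A : set U) (f : U -> 'cV[R]_m) : 0 <= supnorm A f.
Proof.
rewrite /supnorm; set S := [set _ | _ in _].
have [[[r Sr] ubS]|/sup_out ->//] := pselect (has_sup S).
by apply: le_trans (ub_le_sup ubS Sr); have [p _ <-] := Sr.
Qed.

Lemma normr_le_supnorm (U : Type) (A : set U) (f : U -> 'cV[R]_m) (B : R) p :
  (forall p, A p -> `|f p| <= B) -> A p -> `|f p| <= supnorm A f.
Proof.
move=> h Ap; apply: ub_le_sup; last by exists p.
by exists B => _ [q Aq <-]; exact: h.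
Qed.

Lemma X_space_bounded phi : X_space Omega phi -> exists B : R, forall x, C x -> `|phi x| <= B.
Proof.
move=> cphi; have [B _ hB] := compact_within_bounded (bounded_closure_compact bOmega) cphi.
by exists B.
Qed.

Lemma cst_X_interval z : M z -> X_interval Omega v (fun=> z).
Proof. by move=> Mz; split => //; apply: continuous_subspaceT; exact: cst_continuous. Qed.

Lemma linear_growth_bound (w : R) : growth_rate Omega K d g w -> exists2 A : R, 1 <= A &
  forall phi t x i, X_space Omega phi -> 0 <= t -> C x ->
    Phi Omega K d g t 0 phi x i 0 <= A * expR (w * t) * supnorm C phi.
Proof.
move=> [A A1 hA]; exists A => // phi t x i Xphi t0 Cx.
have := hA t 0 phi t0 Xphi; rewrite subr0; apply: le_trans.
have [cP _ _] := linear_flow_is_solution Xphi.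
have [|B hB] := @X_space_bounded (Phi Omega K d g t 0 phi).
  by apply: within_coordP => k j; rewrite (ord1 j); apply: (slice_continuous (A := [set s | 0 <= s]) (t := t) t0 cP).
apply: le_trans (normr_le_supnorm hB Cx).
exact: le_trans (ler_norm _) (normr_coord_le _ _ _).
Qed.

Lemma growth_bound (w : R) : growth_rate Omega K d g w -> exists2 A : R, 1 <= A &
  forall phi t x i, X_interval Omega v phi -> 0 <= t -> C x ->
    flow phi t x i 0 <= A * expR (w * t) * supnorm C phi.
Proof.
move=> /linear_growth_bound[A A1 hA]; exists A => // phi t x i Xphi t0 Cx.
apply: le_trans (flow_le_linear_flow i Xphi t0 Cx) _.
by apply: hA => //; have [] := Xphi.
Qed.

(** The bound [B] makes the supremum of [phi - w 0] a true upper bound, so that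
    norms and pointwise estimates determine each other. *)
Lemma stable_of_estimates (S : set ('rV[R]_n -> 'cV[R]_m)) w (B : R) :
  (forall phi, S phi -> X_interval Omega v phi) -> (forall x, C x -> `|w 0 x| <= B) ->
  (forall phi (e : R), S phi -> 0 < e -> exists t0, forall t x, t0 <= t -> 0 <= t -> C x ->
     `|flow phi t x - w t x| <= e) ->
  (forall e : R, 0 < e -> exists2 delta : R, 0 < delta & forall phi, S phi ->
     (forall x, C x -> `|phi x - w 0 x| < delta) ->
     forall t x, 0 <= t -> C x -> `|flow phi t x - w t x| <= e) ->
  globally_asymptotically_stable Omega K d g S w.
Proof.
move=> SX wB attr stab; split.
- move=> phi Sphi; apply/cvgrPdist_le => e e0.
  have [t0 h] := attr phi e Sphi e0; near=> t.
  have tt0 : t0 <= t by near: t; apply: nbhs_pinfty_ge; rewrite num_real.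
  have tp : 0 <= t by near: t; apply: nbhs_pinfty_ge; rewrite num_real.
  rewrite sub0r normrN ger0_norm; last exact: supnorm_ge0.
  by apply: supnorm_le; [exact: ltW | move=> x; exact: h].
- move=> e e0; have e20 : 0 < e / 2 by exact: divr_gt0.
  have [delta d0 h] := stab _ e20; exists delta => // phi Sphi small t t0.
  apply: (@le_lt_trans _ _ (e / 2)); last lra.
  apply: supnorm_le; first exact: ltW.
  move=> x Cx; apply: h => // y Cy; apply: le_lt_trans small.
  have [B' hB'] := X_space_bounded (proj1 (SX phi Sphi)).
  apply: (@normr_le_supnorm _ C (fun x => phi x - w 0 x) (B' + B)) => // z Cz.
  by apply: le_trans (ler_normB _ _) _; apply: lerD; [exact: hB' | exact: wB].
Unshelve. all: by end_near. Qed.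

(** Decay of the largest orbit controls all orbits at large times; a crude
    exponential bound controls them on bounded time intervals. *)
Lemma zero_stable (w : R) : growth_rate Omega K d g w ->
  (forall e : R, 0 < e -> exists2 t0, 0 <= t0 & forall t x i, t0 <= t -> C x ->
     flow (fun=> v) t x i 0 < e) ->
  globally_asymptotically_stable Omega K d g (X_interval Omega v) (fun _ _ => 0).
Proof.
move=> hw dec; have [A A1 hA] := growth_bound hw.
have Xv := cst_X_interval (order_interval_top hv).
have toe phi t x e : X_interval Omega v phi -> 0 <= t -> C x -> 0 <= e ->
    (forall i, flow phi t x i 0 <= e) -> `|flow phi t x - 0| <= e.
  move=> Xphi t0 Cx e0 h; rewrite subr0; apply: normr_mx_le => // i j; rewrite (ord1 j).
  by have /order_intervalP /(_ i) /andP[p _] := flow_in_interval Xphi t0 Cx; rewrite ger0_norm.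
have lev phi t x i : X_interval Omega v phi -> 0 <= t -> C x ->
    flow phi t x i 0 <= flow (fun=> v) t x i 0.
  move=> Xphi t0 Cx; apply: flow_monotone => // y j Cy.
  by have [_ /(_ y Cy) /order_intervalP /(_ j) /andP[]] := Xphi.
apply: (stable_of_estimates (B := 0)) => //.
- by move=> x _; rewrite normr0.
- move=> phi e Xphi e0; have [t0 t00 h] := dec e e0; exists t0 => t x tt tp Cx.
  by apply: toe => //; [exact: ltW | move=> i; apply: le_trans (lev _ _ _ _ _ _ _) (ltW (h _ _ _ _ _))].
- move=> e e0; have [t0 t00 h] := dec e e0.
  have P0 : 0 < A * expR (`|w| * t0) by rewrite mulr_gt0 ?expR_gt0 // (lt_le_trans ltr01).
  exists (e / (A * expR (`|w| * t0))); first exact: divr_gt0.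
  move=> phi Xphi small t x tp Cx; apply: toe => //; first exact: ltW.
  move=> i; have [tt|tt] := leP t0 t.
    by apply: le_trans (lev _ _ _ _ _ _ _) (ltW (h _ _ _ _ _)).
  apply: le_trans (hA phi t x i Xphi tp Cx) _.
  have s1 : supnorm C phi <= e / (A * expR (`|w| * t0)).
    apply: supnorm_le; first by rewrite ltW // divr_gt0.
    by move=> y Cy; have := small y Cy; rewrite subr0 => /ltW.
  apply: (@le_trans _ _ (A * expR (`|w| * t0) * (e / (A * expR (`|w| * t0))))); last first.
    by rewrite mulrCA divff ?mulr1 // gt_eqF.
  have w1 : w * t <= `|w| * t0.
    apply: (@le_trans _ _ (`|w| * t)); first by apply: ler_wpM2r => //; exact: ler_norm.
    by apply: ler_wpM2l => //; exact: ltW.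
  have A0 : 0 <= A by apply: le_trans A1.
  apply: ler_pM => //.
  - by rewrite mulr_ge0 // ltW // expR_gt0.
  - exact: supnorm_ge0.
  - by apply: ler_wpM2l => //; rewrite ler_expR.
Qed.

Lemma stable_of_negative_growth : (omega_Phi Omega K d g < 0)%E ->
  globally_asymptotically_stable Omega K d g (X_interval Omega v) (fun _ _ => 0).
Proof.
move=> /ereal_inf_lt[_ [w hw <-]]; rewrite lte_fin => w0.
apply: (zero_stable hw) => e e0; have [A A1 hA] := growth_bound hw.
have Xv := cst_X_interval (order_interval_top hv).
pose N := A * supnorm C (fun=> v).
have N0 : 0 <= N.
  rewrite mulr_ge0 ?(le_trans _ A1) //.
  exact: supnorm_ge0.
(* [expR x >= 1 + x] turns the exponential into a decay like [1 / (1 - w t)] *)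
have q0 : 0 <= N / e / - w by rewrite divr_ge0 ?oppr_ge0 ?(ltW w0) // divr_ge0 // ltW.
exists (N / e / - w) => // t x i tt Cx; have tp : 0 <= t by exact: le_trans tt.
apply: le_lt_trans (hA _ t x i Xv tp Cx) _.
rewrite mulrAC -/N -[w * t]opprK expRN -mulNr -(ltr_pM2r (expR_gt0 (- w * t))) mulfVK ?gt_eqF ?expR_gt0 //.
apply: lt_le_trans (_ : e * (1 + - w * t) <= _); last first.
  by rewrite ler_pM2l // expR_ge1Dx.
move: tt; rewrite ler_pdivrMr ?oppr_gt0 // ler_pdivrMr // => tt.
rewrite mulrDr mulr1; apply: ltr_pwDl => //.
by apply: le_trans tt _; rewrite mulrC (mulrC t).
Qed.

(** * Decay at zero growth bound *)

Hypotheses (cOmega : connected Omega) (neOmega : Omega !=set0).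
Hypothesis Kgt0 : forall i t, 0 < K i t 0.

Lemma kinetics_strongly_positive : strongly_positive Omega M g.
Proof.
move=> t x z t0 Cx Mz _; split; first by move=> ->; exact: g0.
exact: (g_irreducible bOmega hv gC gcoop g0).
Qed.

Lemma linear_part_strongly_positive : strongly_positive Omega setT (linear_part g).
Proof.
move=> t x z t0 Cx _ z0; split; first by move=> ->; rewrite /linear_part mulmx0.
exact: (linear_irreducible hv gcoop).
Qed.

(** The constant [e / 2] can be subtracted without leaving the cone. *)
Lemma cone_interior_lower u : C_per_cone_interior Omega T u ->
  exists2 c, 0 < c & forall t x i, C x -> c <= u t x i 0.
Proof.
move=> [[[cu uT] _] [e e0 he]]; have e20 : 0 < e / 2 by exact: divr_gt0.
exists (e / 2) => // t x i Cx.
have [||_ h] := he (fun t x => u t x - const_mx (e / 2)).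
- split; last by move=> s y Cy; rewrite uT.
  by move=> p; apply: cvgB; [exact: cu | exact: cvg_cst].
- apply: (@le_lt_trans _ _ (e / 2)); last lra.
  apply: supnorm_le; first exact: ltW.
  move=> p _; rewrite addrAC subrr add0r normrN; apply: normr_mx_le; first exact: ltW.
  by move=> k j; rewrite mxE ger0_norm // ltW.
by have := h t x Cx => /vleP /(_ i); rewrite !mxE subr_ge0.
Qed.

Let U := periodic_limit (fun=> v).
Let Xv : X_interval Omega v (fun=> v) := cst_X_interval (order_interval_top hv).

Let top_decreasing y j : C y -> flow (fun=> v) T y j 0 <= v j 0.
Proof. by move=> Cy; have /andP[] := orbit_bounds j Xv (ltW hT) Cy. Qed.

Let top_cvg t x i : 0 <= t -> C x -> cvgn (fun k : nat => flow (fun=> v) (t + k%:R * T) x i 0).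
Proof. by apply: decreasing_orbit_cvg => // y j; exact: top_decreasing. Qed.

Let UM t x : C x -> M (U t x). Proof. exact: periodic_limit_interval. Qed.
Let UT t x : C x -> U (t + T) x = U t x. Proof. exact: periodic_limit_periodic. Qed.
Let U0 t x i : C x -> 0 <= U t x i 0.
Proof. by move=> /UM -/(_ t) /order_intervalP /(_ i) /andP[]. Qed.
Let Ubm t i : bm (fun y => U t y i 0). Proof. exact: periodic_limit_bounded_measurable. Qed.
Let Ud t x : C x -> is_derive t (1 : R) (fun s => U s x) (rhs Omega K d g U t x).
Proof. exact: periodic_limit_derive. Qed.

Lemma decay_of_zero_limit : (forall t x, C x -> U t x = 0) ->
  forall e : R, 0 < e -> exists2 t0, 0 <= t0 &
    forall t x i, t0 <= t -> C x -> flow (fun=> v) t x i 0 < e.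
Proof.
move=> Uz e e0; have [|||t0 t00 h] := @decreasing_orbit_uniform (fun=> v) (fun _ _ => 0) Xv _ _ Uz e e0.
- by apply: continuous_subspaceT; exact: cst_continuous.
- by [].
- exact: top_decreasing.
by exists t0 => // t x i tt Cx; have := h t x i tt Cx; rewrite mxE add0r.
Qed.

(** Strict sublinearity in some component separates the kinetics from their linearisation. *)
Lemma g_lt_linear t x z : 0 <= t -> C x -> M z -> (forall i, 0 < z i 0) ->
  exists i, g t x z i 0 < linear_part g t x z i 0.
Proof.
move=> t0 Cx Mz z0; have h0 : (0 : R) < 1 / 2 by rewrite divr_gt0.
have h1 : (1 / 2 : R) < 1 by lra.
have vz : vll 0 z by apply/vllP => i; rewrite mxE.
have /vltP[_ [i hi]] := gsub t0 Cx Mz vz h0 h1; exists i.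
have Mh : M (1 / 2 *: z) by apply: order_interval_scale => //; rewrite !ltW.
have := g_le_linear bOmega hv gC g0 gsub i t0 Cx Mh.
have -> : linear_part g t x (1 / 2 *: z) = 1 / 2 *: linear_part g t x z.
  by rewrite /linear_part scalemxAr.
move: hi; rewrite !mxE => hi /(lt_le_trans hi); rewrite ltr_pM2l //.
Qed.

(** If a multiple of the positive eigenfunction touched the limit [U] from
    above, the strong maximum principle would make both equal, contradicting
    strict sublinearity. *)
Lemma zero_limit_of_eigenfunction : has_positive_eigenfunction Omega K d g T 0 ->
  forall t x, C x -> U t x = 0.
Proof.
move=> [psi [[[cpsi psiT] psid _] psiI Lpsi]].
have [c0 c00 psi_ge] := cone_interior_lower psiI.
have dpsi t x : C x -> is_derive t (1 : R) (fun s => psi s x)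
    (dispersal Omega K d psi t x + linear_part g t x (psi t x)).
  move=> Cx; have h := psid t x Cx; split => //.
  have := Lpsi t x Cx; rewrite /L_op scale0r => /eqP.
  by rewrite -addrA addrC addr_eq0 opprK => /eqP <-.
have psibm t i : bm (fun y => psi t y i 0).
  by apply: bounded_measurable_continuous => //; apply: (slice_continuous (A := setT) (t := t)) => //;
    apply: continuous_subspaceW cpsi => p [].
have [|B B0 psiB] := @slab_bounded _ _ _ _ bOmega 0 T psi.
  by apply: continuous_subspaceW cpsi => p [].
have psi_le t x i : C x -> psi t x i 0 <= B.
  move=> Cx; have [s []] := periodic_representative t 0 hT; rewrite add0r => sI hs.
  rewrite (hs _ (fun t => psi t x i 0)); last by move=> r; rewrite psiT.
  exact: le_trans (ler_norm _) (psiB s x i sI Cx).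
move=> t x Cx; apply/colP => i; rewrite [RHS]mxE; apply/eqP; rewrite eq_le U0 // andbT leNgt.
apply/negP => Upos.
(* the multiples of [psi] that lie above [U] *)
pose S := [set c : R | forall t x i, C x -> U t x i 0 <= c * psi t x i 0].
have psi0 s y j : C y -> 0 < psi s y j 0 by move=> Cy; exact: lt_le_trans (psi_ge s y j Cy).
have Slb : lbound S 0.
  move=> c Sc; have := lt_le_trans Upos (Sc t x i Cx).
  by rewrite pmulr_lgt0 ?psi0 // => /ltW.
have S0 : S !=set0.
  exists (`|v| / c0) => s y j Cy; rewrite -mulrA.
  apply: (@le_trans _ _ `|v|).
    apply: le_trans (ler_norm _) (le_trans (normr_coord_le _ _ _) _).
    by apply: order_interval_norm; exact: UM.
  by rewrite ler_peMr // mulrC ler_pdivlMr // mul1r psi_ge.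
pose rho := inf S.
have Srho : S rho.
  move=> s y j Cy; rewrite -ler_pdivrMr ?psi0 //; apply: lb_le_inf => // c Sc.
  by rewrite ler_pdivrMr ?psi0 //; exact: Sc.
have rho0 : 0 < rho by have := lt_le_trans Upos (Srho t x i Cx); rewrite pmulr_lgt0 ?psi0.
pose z s y : 'cV[R]_m := rho *: psi s y - U s y.
have zE s y j : z s y j 0 = rho * psi s y j 0 - U s y j 0 by rewrite !mxE.
pose dz s y := rho *: (dispersal Omega K d psi s y + linear_part g s y (psi s y))
  - rhs Omega K d g U s y.
have z0 s y j : C y -> 0 <= z s y j 0 by move=> Cy; rewrite zE subr_ge0; exact: Srho.
have zbm s j : bm (fun y => z s y j 0).
  apply: (eq_bounded_measurable (f := fun y => rho * psi s y j 0 - U s y j 0)); first by move=> y _; rewrite zE.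
  by apply: bounded_measurableB => //; exact: bounded_measurableZ.
have zd s y : C y -> is_derive s (1 : R) (fun s => z s y) (dz s y).
  move=> Cy; apply: is_derive_coordP => k j; rewrite (ord1 j) {j}.
  have -> : (fun s => z s y k 0) = (fun s => rho * psi s y k 0 - U s y k 0) by apply/funext => r; rewrite zE.
  have -> : dz s y k 0 = rho * (dispersal Omega K d psi s y + linear_part g s y (psi s y)) k 0
    - rhs Omega K d g U s y k 0 by rewrite !mxE.
  exact: (is_deriveB (is_deriveMl rho (is_derive_coord k 0 (dpsi s y Cy))) (is_derive_coord k 0 (Ud s Cy))).
have linZ s y (c : R) (a b : 'cV[R]_m) k : linear_part g s y (c *: a - b) k 0 =
    c * linear_part g s y a k 0 - linear_part g s y b k 0.
  by rewrite /linear_part mulmxBr -scalemxAr !mxE.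
have dzE s y k : C y -> dz s y k 0 = dispersal Omega K d z s y k 0 + linear_part g s y (z s y) k 0
    + (linear_part g s y (U s y) k 0 - g s y (U s y) k 0).
  move=> Cy.
  have -> : dz s y k 0 = rho * (dispersal Omega K d psi s y k 0 + linear_part g s y (psi s y) k 0)
    - rhs Omega K d g U s y k 0 by rewrite !mxE.
  rewrite rhs_split linZ !dispersalE zE.
  rewrite (_ : nonlocal Omega K k s y (fun y => z s y k 0) =
    rho * nonlocal Omega K k s y (fun y => psi s y k 0) - nonlocal Omega K k s y (fun y => U s y k 0)).
    by ring.
  rewrite -nonlocalZ // -nonlocalB //; last exact: bounded_measurableZ.
  by apply: eq_integralO => q _; rewrite zE.
have gl s y k : 0 <= s -> C y -> 0 <= linear_part g s y (U s y) k 0 - g s y (U s y) k 0.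
  move=> s0 Cy; rewrite subr_ge0.
  exact: (g_le_linear bOmega hv gC g0 gsub k s0 Cy (UM s Cy)).
have zsup s y k : 0 < s -> C y ->
    dispersal Omega K d z s y k 0 + linear_part g s y (z s y) k 0 <= dz s y k 0.
  by move=> /ltW s0 Cy; rewrite dzE // lerDl gl.
have zpos s y : 0 < s -> C y -> forall k, 0 < z s y k 0.
  move=> s0 Cy.
  have [||||[zz|//] _] := supersolution_zero hd Kge0 linear_part_strongly_positive
    (u := z) (du := dz s y) s0 Cy _ _ (zbm s) _ (zd s y Cy) _.
  - by move=> r q k _; exact: z0.
  - by [].
  - by move=> r _; have [] := zd r y Cy.
  - by move=> k; exact: zsup.
  have Up k : 0 < U s y k 0.
    have := zE s y k; rewrite zz mxE => /eqP; rewrite eq_sym subr_eq0 => /eqP <-.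
    by rewrite mulr_gt0 ?psi0.
  have [k hk] := g_lt_linear (ltW s0) Cy (UM s Cy) Up.
  have dz0 : dz s y k 0 = 0.
    apply: (nonneg_zero_derive s0 _ _ (is_derive_coord k 0 (zd s y Cy))).
    - by move=> r _; exact: z0.
    - by move=> r _; have [] := is_derive_coord k 0 (zd r y Cy).
    - by rewrite zz mxE.
  exfalso; have zk : z s y k 0 = 0 by rewrite zz mxE.
  have L0 : linear_part g s y 0 k 0 = 0 by rewrite /linear_part mulmx0 mxE.
  have J0 : 0 <= d k 0 * nonlocal Omega K k s y (fun y => z s y k 0).
    by rewrite mulr_ge0 ?(ltW (hd k)) //; apply: nonlocal_ge0 => // q /subset_closure; exact: z0.
  have := dzE s y k Cy; rewrite dz0 dispersalE zk mulr0 subr0 zz L0 addr0.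
  by move=> E; have := ltr_wpDl J0 (_ : 0 < linear_part g s y (U s y) k 0 - g s y (U s y) k 0);
    rewrite -E ltxx subr_gt0 hk => /(_ isT).
have [L L0 qm] := linear_quasi_monotone bOmega hv gC gcoop (1 + 2 * T).
have zT s y : C y -> z (s + T) y = z s y by move=> Cy; rewrite /z psiT // UT.
have l0 s y : 0 <= s -> C y -> linear_part g s y 0 = 0 by move=> _ _; rewrite /linear_part mulmx0.
have [c cp zc] := periodic_lower_bound oOmega bOmega neOmega hd Kcont Kge0 Kgt0 hT
  (u := z) (du := dz) ltr01 L0 qm I l0 zT z0 (fun _ _ _ => I) zbm (fun s y _ => zd s y) zsup
  (fun y k Cy => zpos 1 y ltr01 Cy k).
have BP : 0 < B by apply: lt_le_trans (psi0 t x i Cx) (psi_le t x i Cx).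
have : S (rho - c / B).
  move=> s y j Cy; rewrite mulrBl; have := zc s y j Cy; rewrite zE.
  have : c / B * psi s y j 0 <= c by rewrite mulrAC ler_pdivrMr // ler_pM2l // psi_le.
  lra.
move=> Sc; have := ge_inf (ex_intro _ 0 Slb : has_lbound S) Sc; rewrite -/rho lerBrDr gerDl => h.
by have := divr_gt0 cp BP; rewrite ltNge h.
Qed.

Section StrictSublinearity.
Hypothesis gstrict : forall t x z alpha, 0 <= t -> C x -> M z -> vll 0 z ->
  0 < alpha -> alpha < 1 -> vll (alpha *: g t x z) (g t x (alpha *: z)).

(** Compactness turns strict sublinearity into a uniform gap away from [0]. *)
Lemma linear_gap (c : R) : 0 < c -> exists2 eps : R, 0 < eps & forall t x z i, 0 <= t -> C x ->
  M z -> (forall j, c <= z j 0) -> g t x z i 0 + eps * z i 0 <= linear_part g t x z i 0.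
Proof.
move=> c0; have [cg _ _] := gC; have N0 : 0 <= `|v| by exact: normr_ge0.
pose Z : set 'cV[R]_m := \bigcap_(j in [set: 'I_m]) [set z | c <= z j 0 <= v j 0].
have ZM z : Z z -> M z.
  move=> Zz; apply/order_intervalP => j; have /andP[h ->] := Zz j I.
  by rewrite andbT (le_trans (ltW c0)).
have cZ : compact Z.
  apply: (subclosed_compact _ (@compact_cV_ball R m `|v|)).
    have cl j : closed [set z : 'cV[R]_m | c <= z j 0 <= v j 0].
      have -> : [set z : 'cV[R]_m | c <= z j 0 <= v j 0] =
          [set z | c <= z j 0] `&` [set z | z j 0 <= v j 0].
        by apply/seteqP; split=> z /= => [/andP[]|[-> ->]].
      apply: closedI.
        by apply: (@closed_comp _ _ (fun z : 'cV[R]_m => z j 0) [set r : R | c <= r]);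
          [move=> z _; exact: coord_continuous | exact: closed_ge].
      by apply: (@closed_comp _ _ (fun z : 'cV[R]_m => z j 0) [set r : R | r <= v j 0]);
        [move=> z _; exact: coord_continuous | exact: closed_le].
    by apply: closed_bigI => j _; exact: cl.
  by move=> z /ZM; exact: order_interval_norm.
pose Q : set (R * 'rV[R]_n * 'cV[R]_m) := (`[0, T]%classic `*` C) `*` Z.
have cQ : compact Q.
  apply: compact_setX => //.
  by apply: compact_setX; [exact: segment_compact | exact: bounded_closure_compact].
pose f i (p : R * 'rV[R]_n * 'cV[R]_m) :=
  linear_part g p.1.1 p.1.2 p.2 i 0 - g p.1.1 p.1.2 p.2 i 0.
have QC : Q `<=` statespace by move=> p [[_ Cp] _].
have cf i : {within Q, continuous (f i)}.
  move=> p; apply: cvgB; move: p; apply: within_coord.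
    exact: continuous_subspaceW QC linear_part_continuous.
  exact: continuous_subspaceW QC cg.
have fpos i p : Q p -> 0 < f i p.
  move: p => [[t x] z] [[/= tI Cx] Zz]; rewrite /f /= subr_gt0.
  have t0 : 0 <= t by move: tI; rewrite in_itv /= => /andP[].
  have Mz := ZM z Zz; have h0 : (0 : R) < 1 / 2 by rewrite divr_gt0.
  have h1 : (1 / 2 : R) < 1 by lra.
  have vz : vll 0 z.
    by apply/vllP => j; rewrite mxE; have /andP[h _] := Zz j I; exact: lt_le_trans h.
  have /vllP /(_ i) hi := gstrict t0 Cx Mz vz h0 h1.
  have Mh : M (1 / 2 *: z) by apply: order_interval_scale => //; rewrite !ltW.
  have := g_le_linear bOmega hv gC g0 gsub i t0 Cx Mh.
  have -> : linear_part g t x (1 / 2 *: z) = 1 / 2 *: linear_part g t x z.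
    by rewrite /linear_part scalemxAr.
  by move: hi; rewrite mxE => hi /(lt_le_trans hi); rewrite mxE ltr_pM2l.
have low i : exists e : R, 0 < e /\ forall p, Q p -> e <= f i p.
  have [Q0|/set0P Q0] := eqVneq Q set0; first by exists 1; split => // p; rewrite Q0.
  have [q /set_mem Qq hq] := compact_EVT_min Q0 cQ (cf i).
  by exists (f i q); split; [exact: fpos | move=> p Qp; apply: hq; rewrite inE].
have [e he] := choice low.
have [i|e0 e00 he0] := @common_lower_bound R 'I_m e; first by have [] := he i.
have P0 : 0 < `|v| + 1 by rewrite ltr_wpDl.
exists (e0 / (`|v| + 1)); first exact: divr_gt0.
move=> t x z i t0 Cx Mz cz; have /order_intervalP zM := Mz.
have [s []] := periodic_representative t 0 hT; rewrite add0r => sI hs.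
have gT r : g (r + T) x = g r x by apply/funext => y; rewrite gper.
have := hs _ (fun t => f i (t, x, z)) _; rewrite /f /= => E.
rewrite addrC -lerBrDr E; last by move=> r; rewrite /linear_part gT.
have [_ h] := he i; have {}h : e i <= f i (s, x, z).
  by apply: h; split; [split => //; rewrite /= in_itv | move=> j _; rewrite /= cz; have /andP[] := zM j].
apply: le_trans h; apply: le_trans (he0 i).
rewrite mulrAC ler_pdivrMr //; apply: ler_wpM2l; first exact: ltW.
apply: (@le_trans _ _ `|v|); last by rewrite lerDl.
apply: le_trans (ler_norm _) (le_trans (normr_coord_le _ _ _) _); exact: order_interval_norm.
Qed.

(** If [U] is not zero it is bounded below either on the whole domain or on a
    single fibre where it receives nothing from elsewhere. *)
Lemma persistent_part t x : C x -> U t x <> 0 -> exists (S : set 'rV[R]_n) (c : R),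
  [/\ S !=set0, S `<=` C, 0 < c, (forall t x i, S x -> c <= U t x i 0) &
    (forall x, C x -> S x) \/
    (forall t x i, 0 < t -> S x -> nonlocal Omega K i t x (fun y => U t y i 0) = 0)].
Proof.
move=> Cx Ux; have [k0 s0] := eventually_nonneg t hT.
have Usx : U (t + k0%:R * T) x <> 0.
  by rewrite (@periodic_shift _ _ T (fun t => U t x)) // => r; exact: UT.
move: Usx s0; move: (t + _) => {t Ux k0} s Usx s0.
have Usup r y i : 0 < r -> C y ->
    dispersal Omega K d U r y i 0 + g r y (U r y) i 0 <= rhs Omega K d g U r y i 0.
  by move=> _ _; rewrite rhs_split.
have Uder r y : 0 < r -> C y -> derivable (fun s => U s y) r 1.
  by move=> _ Cy; have [] := Ud r Cy.
have [[r [r0 rpos]]|nopos] := pselect (exists r, 0 < r /\ forall y i, C y -> 0 < U r y i 0).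
  have [L L0 qm] := g_quasi_monotone bOmega gC gcoop (r + 2 * T).
  have [c c0 hc] := periodic_lower_bound oOmega bOmega neOmega hd Kcont Kge0 Kgt0 hT (u := U)
    (du := rhs Omega K d g U) r0 L0 qm (order_interval_zero hv) (fun r y _ => @g0 r y) UT U0 UM Ubm
    (fun r y _ => @Ud r y) Usup rpos.
  exists C, c; split => //; last by left.
  by exists x.
have dich r : 0 < r -> exists q, 0 < q /\ forall y i, C y ->
    local_mass Omega q (fun y => U r y i 0) y = 0.
  move=> r0; have [//|//] := supersolution_dichotomy oOmega bOmega cOmega hd Kcont Kge0 Kgt0
    kinetics_strongly_positive (u := U) (du := rhs Omega K d g U r) r0 (fun r y i _ => @U0 r y i)
    (UM r) (Ubm r) Uder (Ud r) (fun y i => Usup r y i r0).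
  by move=> rpos; case: nopos; exists r.
have Jz r y i : 0 < r -> nonlocal Omega K i r y (fun y => U r y i 0) = 0.
  move=> /dich[q [q0 hq]]; apply: (local_mass_eq0 oOmega bOmega q0) => //.
  - exact: kernel_bounded_measurable.
  - by move=> z /subset_closure; exact: U0.
  - by move=> z Cz; exact: hq.
have [[//|Upos] _] := supersolution_zero hd Kge0 kinetics_strongly_positive (u := U)
  (du := rhs Omega K d g U s x) s0 Cx (fun r y i _ => @U0 r y i) (UM s Cx) (Ubm s)
  (fun r r0 => Uder r x r0 Cx) (Ud s Cx) (fun i => Usup s x i s0 Cx).
have [L L0 qm] := g_quasi_monotone bOmega gC gcoop (s + T).
have [G G0 pers] := supersolution_persistence hd Kge0 L0 qm (order_interval_zero hv)
  (fun r y _ => @g0 r y) (fun r y i _ => @U0 r y i) (fun r y _ => @UM r y) (fun r y _ => @Ud r y) Usup.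
have [//|c c0 hc] := @common_lower_bound R 'I_m (fun i => U s x i 0).
exists [set x], (expR (- (G * T)) * c); split.
- by exists x.
- by move=> _ ->.
- by rewrite mulr_gt0 ?expR_gt0.
- move=> r _ i ->; have [q [/andP[sq qs] hq]] := periodic_representative r s hT.
  rewrite (hq _ (fun t => U t x i 0)); last by move=> p; rewrite UT.
  have qs0 : 0 <= q - s by rewrite subr_ge0.
  have qsT : s + (q - s) <= s + T by rewrite addrC subrK.
  have := pers s (q - s) x i s0 qs0 qsT Cx; rewrite subrK; apply: le_trans.
  apply: ler_pM => //; first exact: ltW.
  by rewrite ler_expR lerN2 ler_pM2l // lerBlDl.
- by right=> r y i r0 _; exact: Jz.
Qed.

(** With zero growth bound, a nonzero limit [U] would feed the linear flow: by the
    gap, [exp (eps t) U] is a subsolution of the linear equation. *)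
Lemma zero_limit_of_strict_sublinearity :
  (forall eps : R, 0 < eps -> exists2 w : R, w < eps & growth_rate Omega K d g w) ->
  forall t x, C x -> U t x = 0.
Proof.
move=> small t x Cx; apply: contrapT => Ux.
have [l _] : exists i, U t x i 0 <> 0.
  apply: contrapT => h; apply: Ux; apply/colP => i; rewrite [RHS]mxE.
  by apply: contrapT => hi; apply: h; exists i.
have [S [c [[x1 Sx1] SC c0 Uc alt]]] := persistent_part Cx Ux.
have [eps eps0 gap] := linear_gap c0.
have [w weps gw] := small eps eps0; have [A A1 hA] := linear_growth_bound gw.
pose p s := Phi Omega K d g s 0 (fun=> v).
have [Xs _] := Xv; have [cp p0 dp] := linear_flow_is_solution Xs.
have pge0 s y i : 0 <= s -> C y -> 0 <= p s y i 0.
  move=> s0 Cy; apply: le_trans (flow_le_linear_flow i Xv s0 Cy).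
  by have /andP[] := orbit_bounds i Xv s0 Cy.
have pbm s i : 0 <= s -> bm (fun y => p s y i 0).
  by move=> s0; have [_ _ h] := continuous_regular oOmega bOmega s cp; apply: h; rewrite s0 lexx.
have key s y i : 0 <= s -> S y -> expR (eps * s) * U s y i 0 <= p s y i 0.
  move=> s0 Sy.
  pose I := ({y : 'rV[R]_n | S y} * 'I_m)%type.
  pose z r (a : I) := p r (sval a.1) a.2 0 - expR (eps * r) * U r (sval a.1) a.2 0.
  pose dz r (a : I) := rhs Omega K d (linear_part g) p r (sval a.1) a.2 0 -
    (expR (eps * r) * rhs Omega K d g U r (sval a.1) a.2 0
     + U r (sval a.1) a.2 0 * (eps * expR (eps * r))).
  rewrite -subr_ge0 -[leRHS]/(z s (exist _ y Sy, i)).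
  have [L L0 qm] := linear_quasi_monotone bOmega hv gC gcoop s.
  pose D := \sum_i d i 0.
  have dD j : d j 0 <= D by rewrite /D (bigD1 j) //= lerDl sumr_ge0 // => k _; rewrite ltW.
  have D0 : 0 <= D by apply: sumr_ge0 => k _; rewrite ltW.
  have eUd r q j : C q -> is_derive r (1 : R) (fun r => expR (eps * r) * U r q j 0)
      (expR (eps * r) * rhs Omega K d g U r q j 0 + U r q j 0 * (eps * expR (eps * r))).
    move=> Cq; have h1 := is_derive_expRM eps r; have h2 := is_derive_coord j 0 (Ud r Cq).
    exact: (is_deriveM h1 h2).
  apply: (@comparison_principle R I s (D + L) (expR (eps * s) * `|v|) z dz) => //.
  - exact: addr_ge0.
  - move=> [[q Sq] j] r; apply: cvgB.
      move: r; apply: continuous_subspaceW (path_continuous (A := [set r | 0 <= r]) (SC q Sq) cp (i := j)).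
      by move=> r /=; rewrite in_itv /= => /andP[].
    move: r; apply: derivable_within_continuous => r _.
    by have [] := eUd r q j (SC q Sq).
  - move=> r [[q Sq] j] /andP[r0 _]; apply: is_deriveB; last exact: eUd (SC q Sq).
    exact: (is_derive_coord j 0 (dp r q r0 (SC q Sq))).
  - move=> r [[q Sq] j] /andP[r0 rs]; rewrite /z /= -[leLHS]add0r lerB ?pge0 ?(SC q Sq) //.
      exact: SC.
    apply: ler_pM; [exact: expR_ge0 | apply: U0; exact: SC | by rewrite ler_expR ler_pM2l |].
    apply: le_trans (ler_norm _) (le_trans (normr_coord_le _ _ _) _).
    by apply: order_interval_norm; apply: UM; exact: SC.
  - move=> [[q Sq] j]; rewrite /z /= mulr0 expR0 mul1r subr_ge0.
    rewrite (_ : p 0 q = v); last by apply: p0; exact: SC.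
    by have /order_intervalP /(_ j) /andP[] := UM 0 (SC q Sq).
  - move=> r N [[q Sq] j] /andP[r0 rs] N0 zN zle; have Cq := SC q Sq.
    have rI : 0 <= r <= s by rewrite !ltW.
    have E0 : 0 < expR (eps * r) by exact: expR_gt0.
    rewrite /dz /= !rhsE; rewrite /z /= in zle.
    set E := expR (eps * r) in E0 zle *.
    have h1 : - N <= nonlocal Omega K j r q (fun y => p r y j 0)
        - E * nonlocal Omega K j r q (fun y => U r y j 0).
      case: alt => [CS|Jz]; last first.
        rewrite Jz // mulr0 subr0; apply: (@le_trans _ _ 0); first by rewrite oppr_le0.
        by apply: nonlocal_ge0 => // q' /subset_closure; apply: pge0; exact: ltW.
      rewrite -nonlocalZ // -nonlocalB //; [|exact/pbm/ltW|exact: bounded_measurableZ].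
      apply: nonlocal_ge => //; first by apply: bounded_measurableB; [exact/pbm/ltW|exact: bounded_measurableZ].
      by move=> q' /subset_closure/CS Sq'; exact: (zN (exist _ q' Sq', j)).
    have h2 : - (L * N) <= linear_part g r q (p r q) j 0 - linear_part g r q (E *: U r q) j 0.
      apply: qm => //; first by move=> k; rewrite [X in _ <= _ - X]mxE; exact: (zN (exist _ q Sq, k)).
      by rewrite [X in _ - X <= _]mxE; exact: le_trans N0.
    have h3 : E * (g r q (U r q) j 0 + eps * U r q j 0) <= linear_part g r q (E *: U r q) j 0.
      rewrite (_ : linear_part g r q (E *: U r q) j 0 = E * linear_part g r q (U r q) j 0); last first.
        by rewrite /linear_part -scalemxAr mxE.
      rewrite ler_pM2l //; apply: gap => //; [exact: ltW | exact: UM | by move=> k; exact: Uc].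
    have h4 : - (D * N) <= d j 0 * (nonlocal Omega K j r q (fun y => p r y j 0)
        - E * nonlocal Omega K j r q (fun y => U r y j 0)).
      apply: (@le_trans _ _ (d j 0 * - N)); last by rewrite ler_pM2l.
      by rewrite mulrN lerN2; exact: ler_wpM2r.
    have h5 : 0 <= - (d j 0 * (p r q j 0 - E * U r q j 0)).
      by rewrite oppr_ge0 pmulr_rle0.
    move: h2 h3 h4 h5.
    move: (nonlocal _ _ _ _ _ _) (nonlocal _ _ _ _ _ _) (linear_part g r q (p r q) j 0)
      (linear_part g r q (E *: U r q) j 0) (g r q (U r q) j 0) => J2 J1 a1 a2 b1.
    move: (d j 0) (p r q j 0) (U r q j 0) => dj pj Uj h2 h3 h4 h5.
    rewrite (_ : _ - _ = (a1 - a2) + (a2 - E * (b1 + eps * Uj)) + dj * (J1 - E * J2)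
      + - (dj * (pj - E * Uj))); last by ring.
    rewrite mulrDl opprD; move: h3; rewrite -subr_ge0; lra.
  by rewrite s0 lexx.
have N0 : 0 <= A * supnorm C (fun=> v) by rewrite mulr_ge0 ?supnorm_ge0 // (le_trans _ A1).
set N := A * supnorm C (fun=> v) in N0.
have Nc : 0 <= N / c by rewrite divr_ge0 // ltW.
pose s := N / c / (eps - w).
have s0 : 0 <= s by rewrite divr_ge0 // subr_ge0 ltW.
have up := le_trans (key s x1 l s0 Sx1) (hA _ s x1 l Xs s0 (SC x1 Sx1)).
have {}up : expR (eps * s) * c <= N * expR (w * s).
  rewrite /N mulrAC; apply: le_trans up; apply: ler_wpM2l; [exact: expR_ge0 | exact: Uc].
have : expR ((eps - w) * s) * c <= N.
  by rewrite mulrBl expRB mulrAC ler_pdivrMr ?expR_gt0.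
apply/negP; rewrite -ltNge -ltr_pdivrMr //.
apply: lt_le_trans (expR_ge1Dx _).
by rewrite /s (mulrC (eps - w)) divfK ?ltrDr // gt_eqF // subr_gt0.
Qed.

End StrictSublinearity.

Lemma stable_of_zero_growth : omega_Phi Omega K d g = 0%E ->
  (forall t x z alpha, 0 <= t -> C x -> M z -> vll 0 z -> 0 < alpha -> alpha < 1 ->
     vll (alpha *: g t x z) (g t x (alpha *: z))) \/ has_positive_eigenfunction Omega K d g T 0 ->
  globally_asymptotically_stable Omega K d g (X_interval Omega v) (fun _ _ => 0).
Proof.
move=> om0 alt.
have small (eps : R) : 0 < eps -> exists2 w : R, w < eps & growth_rate Omega K d g w.
  move=> e0; have : (omega_Phi Omega K d g < eps%:E)%E by rewrite om0 lte_fin.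
  by move=> /ereal_inf_lt[_ [w hw <-]]; rewrite lte_fin => we; exists w.
have [w _ gw] := small 1 ltr01.
apply: (zero_stable gw); apply: decay_of_zero_limit => t x Cx.
case: alt => [gs|ef]; first exact: zero_limit_of_strict_sublinearity.
exact: zero_limit_of_eigenfunction.
Qed.

(** * Attraction by the positive periodic solution *)

(** By sublinearity, a multiple [alpha <= 1] of a solution is a subsolution. *)
Lemma flow_scale_le phi psi alpha t x i : X_interval Omega v phi -> X_interval Omega v psi ->
  0 <= alpha <= 1 -> (forall y j, C y -> alpha * phi y j 0 <= psi y j 0) -> 0 <= t -> C x ->
  alpha * flow phi t x i 0 <= flow psi t x i 0.
Proof.
move=> Xphi Xpsi aI le t0 Cx; have /andP[a0 a1] := aI.
have sE s y j : (alpha *: flow phi s y) j 0 = alpha * flow phi s y j 0 by rewrite mxE.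
rewrite -sE; have cf := flow_continuous Xphi.
have bf s j : 0 <= s -> bm (fun y => flow phi s y j 0).
  by move=> s0; have [_ _ h] := flow_regular s Xphi; apply: h; rewrite s0 lexx.
refine (@subsolution_le_flow psi (fun s y => alpha *: flow phi s y)
  (fun s y => alpha *: rhs Omega K d g (flow phi) s y) t Xpsi _ _ _ _ _ t x i _ Cx).
- apply: continuous_regular => //.
  by move=> p; apply: cvgZr; exact: cf.
- move=> s y /andP[s0 _] Cy; apply: is_derive_coordP => k j; rewrite (ord1 j) mxE.
  have -> : (fun s => (alpha *: flow phi s y) k 0) = (fun s => alpha * flow phi s y k 0).
    by apply/funext => r; rewrite mxE.
  exact: (is_deriveMl alpha (is_derive_coord k 0 (flow_derive Xphi s0 Cy))).
- move=> s y /andP[/ltW s0 _] Cy; apply: order_interval_scale => //; exact: flow_in_interval.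
- move=> s y j /andP[/ltW s0 _] Cy; rewrite [leLHS]mxE rhs_split mulrDr; apply: lerD.
    rewrite !dispersalE sE mulrBr (mulrCA alpha) (mulrCA alpha (d j 0) (flow phi s y j 0)) lerD2r.
    rewrite (_ : nonlocal Omega K j s y (fun y => (alpha *: flow phi s y) j 0) =
      alpha * nonlocal Omega K j s y (fun y => flow phi s y j 0)) //.
    rewrite -nonlocalZ //; last exact: bf.
    by apply: eq_integralO => q _; rewrite mxE.
  exact: (g_sublinear bOmega hv gC g0 gsub j s0 Cy (flow_in_interval Xphi s0 Cy)).
- by move=> y j Cy; rewrite mxE flow0 //; exact: le.
- by rewrite t0 lexx.
Qed.

(** Positivity at one point persists until time [T], and the dichotomy then
    spreads it over the whole domain. *)
Lemma flow_positive phi : X_interval Omega v phi -> (exists2 x, C x & phi x <> 0) ->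
  forall x i, C x -> 0 < flow phi T x i 0.
Proof.
move=> Xphi [x0 Cx0 nz].
have f0 t x i : 0 < t -> C x -> 0 <= flow phi t x i 0.
  by move=> /ltW t0 Cx; have /andP[] := orbit_bounds i Xphi t0 Cx.
have fM t x : 0 < t -> C x -> M (flow phi t x) by move=> /ltW t0; exact: flow_in_interval.
have fd t x : 0 < t -> C x -> is_derive t (1 : R) (fun s => flow phi s x)
    (rhs Omega K d g (flow phi) t x) by exact: flow_derive.
have fder t x : 0 < t -> C x -> derivable (fun s => flow phi s x) t 1.
  by move=> t0 Cx; have [] := fd t x t0 Cx.
have fsup t x i : 0 < t -> C x -> dispersal Omega K d (flow phi) t x i 0
    + g t x (flow phi t x) i 0 <= rhs Omega K d g (flow phi) t x i 0.
  by move=> _ _; rewrite rhs_split.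
have fbm t i : 0 <= t -> bm (fun y => flow phi t y i 0).
  by move=> t0; have [_ _ h] := flow_regular t Xphi; apply: h; rewrite t0 lexx.
have [i pi] : exists i, 0 < phi x0 i 0.
  apply: contrapT => h; apply: nz; apply/colP => i; rewrite [RHS]mxE; apply/eqP.
  have [_ /(_ x0 Cx0) /order_intervalP /(_ i) /andP[p0 _]] := Xphi.
  by rewrite eq_le p0 andbT leNgt; apply/negP => pp; apply: h; exists i.
have cf := flow_continuous Xphi.
have [s [s0 sT fs]] : exists s, [/\ 0 < s, s <= T & 0 < flow phi s x0 i 0].
  have /within_continuous_epsP := path_continuous (A := [set t | 0 <= t]) Cx0 cf (i := i).
  move=> /(_ 0 (lexx 0) _ pi); rewrite flow0 // => -[r r0 hr].
  have sp : 0 < Num.min (r / 2) T by rewrite lt_min divr_gt0.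
  exists (Num.min (r / 2) T); split => //; first by rewrite ge_min lexx orbT.
  have := hr (Num.min (r / 2) T) (ltW sp).
  rewrite -ball_normE /= sub0r normrN (gtr0_norm sp) => h.
  have {h} : `|phi x0 i 0 - flow phi (Num.min (r / 2) T) x0 i 0| < phi x0 i 0.
    by apply: h; rewrite gt_min; apply/orP; left; rewrite ltr_pdivrMr // mulr_natr ltr_pwDr.
  by rewrite ltr_norml ltrBlDr ltrDl => /andP[_].
have [L L0 qm] := g_quasi_monotone bOmega gC gcoop T.
have [G G0 pers] := supersolution_persistence hd Kge0 L0 qm (order_interval_zero hv)
  (fun r y _ => @g0 r y) f0 fM fd fsup.
have fT : 0 < flow phi T x0 i 0.
  have Ts : 0 <= T - s by rewrite subr_ge0.
  have := pers s (T - s) x0 i s0 Ts; rewrite addrC subrK lexx => /(_ isT Cx0).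
  by apply: lt_le_trans; rewrite mulr_gt0 ?expR_gt0.
have [//|[q [q0 hq]]] := supersolution_dichotomy oOmega bOmega cOmega hd Kcont Kge0 Kgt0
  kinetics_strongly_positive (u := flow phi) (du := rhs Omega K d g (flow phi) T) hT f0
  (fun x => @fM T x hT) (fun i => fbm T i (ltW hT)) fder
  (fun x => @fd T x hT) (fun x i => @fsup T x i hT).
have /within_continuous_epsP := slice_continuous (A := [set t | 0 <= t]) (t := T) (ltW hT) cf (i := i).
move=> /(_ x0 Cx0 _ fT) [r r0 hr].
have : 0 < local_mass Omega q (fun y => flow phi T y i 0) x0.
  apply: (local_mass_gt0 (s := Num.min q r) (y := x0) oOmega bOmega) => //.
  - exact/fbm/ltW.
  - by move=> y /subset_closure; exact: f0.
  - by rewrite lt_min q0.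
  - move=> z Oz; rewrite -ball_normE /= lt_min => /andP[zq zr]; split => //.
    have := hr z (subset_closure Oz); rewrite -ball_normE /= => /(_ zr).
    by rewrite ltr_norml ltrBlDr ltrDl => /andP[_].
by rewrite hq // ltxx.
Qed.

Section PositiveSolution.
Variable w : R -> 'rV[R]_n -> 'cV[R]_m.
Hypothesis wuniq : unique_positive_periodic_solution Omega K d v g T w.
Hypothesis wint : C_per_cone_interior Omega T w.

Let cw : {within cylinder Omega, continuous (fun p => w p.1 p.2)}.
Proof. by have [[[]]] := wint. Qed.

Let wT t x : C x -> w (t + T) x = w t x.
Proof. by have [[[_ h] _] _] := wint; exact: h. Qed.

Let wM t x : C x -> M (w t x).
Proof. by have [[[_ h] _ _] _] := wuniq; exact: h. Qed.

Let w_norm t x i : C x -> w t x i 0 <= `|v|.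
Proof.
move=> Cx; apply: le_trans (ler_norm _) (le_trans (normr_coord_le _ _ _) _).
by apply: order_interval_norm; exact: wM.
Qed.

Let w0_interval : X_interval Omega v (w 0).
Proof.
split; last by move=> x; exact: wM.
apply: within_coordP => k j; rewrite (ord1 j); apply: (slice_continuous (A := setT) (t := 0)) => //.
by apply: continuous_subspaceW cw => p [].
Qed.

Let w_flow t x : 0 <= t -> C x -> flow (w 0) t x = w t x.
Proof.
move=> t0 Cx; apply/esym; apply: (solution_eq_flow w0_interval) => //; split=> //.
  by apply: continuous_subspaceW cw => p [].
by move=> s y _ Cy; have [[_ _ h] _] := wuniq; exact: h.
Qed.

Let limit_eq_w phi c : X_interval Omega v phi -> 0 < c ->
  (forall t x i, 0 <= t -> C x -> cvgn (fun k : nat => flow phi (t + k%:R * T) x i 0)) ->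
  (forall t x i, 0 <= t -> C x -> c <= periodic_limit phi t x i 0) ->
  forall t x, C x -> periodic_limit phi t x = w t x.
Proof.
move=> Xphi c0 cv low; have [_ h] := wuniq; apply: h; split.
- exact: periodic_limit_B_per.
- move=> t x Cx i; have [k0 /ltW s0] := eventually_nonneg t hT.
  rewrite -(@periodic_shift _ _ T (fun t => periodic_limit phi t x i 0) k0); last first.
    by move=> r; rewrite periodic_limit_periodic.
  exact: lt_le_trans c0 (low _ _ _ s0 Cx).
- by move=> t x Cx; exact: periodic_limit_derive.
Qed.

(** The orbit of [v] decreases along the period map to a periodic solution above
    [w], which is [w] by uniqueness. *)
Lemma flow_eventually_below (e : R) : 0 < e -> exists2 t0, 0 <= t0 &
  forall phi t x i, X_interval Omega v phi -> t0 <= t -> C x -> flow phi t x i 0 < w t x i 0 + e.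
Proof.
move=> e0; have [c c0 wc] := cone_interior_lower wint.
have lim : forall t x, C x -> U t x = w t x.
  apply: (limit_eq_w Xv c0 top_cvg) => t x i t0 Cx.
  have h := periodic_limit_cvg_ge0 top_cvg (i := i) t0 Cx.
  rewrite -(cvg_lim (@Rhausdorff R) h); apply: limr_ge; first exact: top_cvg.
  near=> k; apply: le_trans (wc (t + k%:R * T) x i Cx) _.
  rewrite -w_flow //; last exact: ge0T.
  apply: flow_monotone => //; last exact: ge0T.
  by move=> y j Cy; have /order_intervalP /(_ j) /andP[] := wM 0 Cy.
have [t0 t00 h] := decreasing_orbit_uniform Xv cw wT lim e0 top_decreasing.
exists t0 => // phi t x i Xphi tt Cx; apply: le_lt_trans (h t x i tt Cx).
apply: flow_monotone => //; last exact: le_trans tt.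
by move=> y j Cy; have [_ /(_ y Cy) /order_intervalP /(_ j) /andP[]] := Xphi.
Unshelve. all: by end_near. Qed.

(** After one period the orbit exceeds a small multiple of [w 0]; the orbit of
    that multiple increases along the period map, by uniqueness to [w]. *)
Lemma flow_eventually_above phi (e : R) : X_interval Omega v phi ->
  (exists2 x, C x & phi x <> 0) -> 0 < e -> exists2 t0, 0 <= t0 &
  forall t x i, t0 <= t -> C x -> w t x i 0 - e < flow phi t x i 0.
Proof.
move=> Xphi nz e0; have [c c0 wc] := cone_interior_lower wint.
have XT := flow_interval Xphi (ltW hT).
have neC : C !=set0 by have [x Cx _] := nz; exists x.
have low i : exists q : R, 0 < q /\ forall x, C x -> q <= flow phi T x i 0.
  have [x0 /set_mem Cx0 hx0] := compact_EVT_min neC (bounded_closure_compact bOmega)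
    (slice_continuous (A := [set t | 0 <= t]) (t := T) (ltW hT) (flow_continuous Xphi) (i := i)).
  exists (flow phi T x0 i 0); split; first exact: flow_positive.
  by move=> x Cx; apply: hx0; rewrite inE.
have [q hq] := choice low.
have [i|q0 q00 hq0] := @common_lower_bound R 'I_m q; first by have [] := hq i.
have P0 : 0 < `|v| + 1 by rewrite ltr_wpDl.
pose eps := Num.min 1 (q0 / (`|v| + 1)).
have eps0 : 0 < eps by rewrite lt_min ltr01 divr_gt0.
have epsI : 0 <= eps <= 1 by rewrite (ltW eps0) ge_min lexx.
pose psi x := eps *: w 0 x.
have psiE x i : psi x i 0 = eps * w 0 x i 0 by rewrite mxE.
have [cw0 _] := w0_interval.
have Xpsi : X_interval Omega v psi.
  split; last by move=> x Cx; apply: order_interval_scale => //; exact: wM.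
  by move=> p; apply: cvgZr; exact: cw0.
have scale t x i : 0 <= t -> C x -> eps * w t x i 0 <= flow psi t x i 0.
  move=> t0 Cx; rewrite -w_flow //; apply: flow_scale_le => // y j Cy.
  by rewrite psiE.
have inc y j : C y -> psi y j 0 <= flow psi T y j 0.
  by move=> Cy; rewrite psiE -(add0r T) -[w 0 y]wT // add0r; apply: scale => //; exact: ltW.
have lim t x : C x -> periodic_limit psi t x = w t x.
  have ec : 0 < eps * c by rewrite mulr_gt0.
  move: t x; apply: (limit_eq_w Xpsi ec) => t x i t0 Cx; first exact: increasing_orbit_cvg.
  apply: le_trans (periodic_limit_ge i Xpsi inc t0 Cx).
  by apply: le_trans (scale t x i t0 Cx); rewrite ler_pM2l // wc.
have [t0 t00 h] := increasing_orbit_uniform Xpsi cw wT lim e0 inc.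
exists (t0 + T); first by rewrite addr_ge0 // ltW.
move=> t x i tt Cx; have tT : t0 <= t - T by rewrite lerBrDr.
have tT0 : 0 <= t - T by exact: le_trans tT.
rewrite -[t](subrK T) -flow_shift // wT //; apply: lt_le_trans (h _ x i tT Cx) _.
apply: flow_monotone => // y j Cy; rewrite psiE.
have [_ /(_ y Cy)] := hq j; apply: le_trans; apply: le_trans (hq0 j).
apply: (@le_trans _ _ (q0 / (`|v| + 1) * (`|v| + 1))); last by rewrite divfK // gt_eqF.
apply: ler_pM; [exact: ltW | | by rewrite ge_min lexx orbT |].
  by have /order_intervalP /(_ j) /andP[] := wM 0 Cy.
by apply: le_trans (w_norm 0 j Cy) _; rewrite lerDl.
Qed.

(** Sublinearity keeps orbits between the multiples of [w] that enclose their initial values. *)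
Lemma positive_solution_stable : globally_asymptotically_stable Omega K d g
  [set phi | X_interval Omega v phi /\ exists2 x, C x & phi x <> 0] w.
Proof.
have normP (a b : 'cV[R]_m) (e : R) : 0 <= e -> (forall i, b i 0 - e <= a i 0) ->
    (forall i, a i 0 <= b i 0 + e) -> `|a - b| <= e.
  move=> e0 h1 h2; apply: normr_mx_le => // i j; rewrite (ord1 j) !mxE ler_norml.
  by rewrite lerBrDl h1 lerBlDl h2.
apply: (stable_of_estimates (B := `|v|)).
- by move=> phi [].
- by move=> x Cx; apply: order_interval_norm; exact: wM.
- move=> phi e [Xphi nz] e0; have [t1 _ h1] := flow_eventually_below e0.
  have [t2 _ h2] := flow_eventually_above Xphi nz e0.
  exists (Num.max t1 t2) => t x; rewrite ge_max => /andP[tt1 tt2] _ Cx.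
  by apply: normP => [|i|i]; apply: ltW => //; [exact: h2 | exact: h1].
- move=> e e0; have [c c0 wc] := cone_interior_lower wint.
  have P0 : 0 < `|v| + 1 by rewrite ltr_wpDl.
  pose eta := Num.min 1 (e / (`|v| + 1)).
  have eta0 : 0 < eta by rewrite lt_min ltr01 divr_gt0.
  have eta1 : eta <= 1 by rewrite ge_min lexx.
  have etae : eta * `|v| <= e.
    apply: (@le_trans _ _ (e / (`|v| + 1) * (`|v| + 1))); last by rewrite divfK // gt_eqF.
    by apply: ler_pM => //; [exact: ltW | rewrite ge_min lexx orbT | rewrite lerDl].
  exists (eta * c); first exact: mulr_gt0.
  move=> phi [Xphi _] small t x t0 Cx.
  have close y j : C y -> w 0 y j 0 - eta * w 0 y j 0 <= phi y j 0 <= w 0 y j 0 + eta * w 0 y j 0.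
    move=> Cy; have := le_lt_trans (normr_coord_le (phi y - w 0 y) j 0) (small y Cy).
    rewrite !mxE ltr_norml => /andP[h1 h2].
    have : eta * c <= eta * w 0 y j 0 by rewrite ler_pM2l // wc.
    by move: (eta * c) (eta * w 0 y j 0) h1 h2 => p q h1 h2 pq; apply/andP; split; lra.
  have ew i : eta * w t x i 0 <= e.
    by apply: le_trans etae; rewrite ler_pM2l //; exact: w_norm.
  have q1 : 0 < 1 + eta by rewrite addr_gt0.
  apply: normP => [|i|i]; first exact: ltW.
    have := @flow_scale_le (w 0) phi (1 - eta) t x i w0_interval Xphi.
    rewrite subr_ge0 eta1 gerBl (ltW eta0) w_flow // mulrBl mul1r => h.
    have {}h : w t x i 0 - eta * w t x i 0 <= flow phi t x i 0.
      by apply: h => // y j Cy; rewrite mulrBl mul1r; have /andP[] := close y j Cy.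
    by apply: le_trans h; rewrite lerD2l lerN2.
  have := @flow_scale_le phi (w 0) (1 + eta)^-1 t x i Xphi w0_interval.
  rewrite invr_ge0 (ltW q1) invf_le1 // lerDl (ltW eta0) w_flow // => h.
  have {}h : (1 + eta)^-1 * flow phi t x i 0 <= w t x i 0.
    apply: h => // y j Cy; rewrite mulrC ler_pdivrMr // mulrDr mulr1 (mulrC _ eta).
    by have /andP[] := close y j Cy.
  move: h; rewrite mulrC ler_pdivrMr // mulrDr mulr1 (mulrC _ eta) => h.
  by apply: le_trans h _; rewrite lerD2l.
Qed.

End PositiveSolution.

End Semiflow.

Theorem theorem3p9 (R : realType) (m n : nat) (hm : (1 <= m)%N) (hn : (1 <= n)%N)
    (Omega : set 'rV[R]_n) (hdom : domain Omega) (hbnd : bounded_set Omega)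
    (hsc : simply_connected Omega) (hsmooth : smooth_boundary Omega)
    (d : 'cV[R]_m) (hd : forall i, 0 < d i 0)
    (v : 'cV[R]_m) (hv : vll 0 v)
    (K : 'I_m -> R -> 'rV[R]_n -> R)
    (g : R -> 'rV[R]_n -> 'cV[R]_m -> 'cV[R]_m)
    (T : R) (hT : 0 < T)
    (* (a) *)
    (Kcont : forall i, continuous (fun p : R * 'rV[R]_n => K i p.1 p.2))
    (Kge0 : forall i t x, 0 <= K i t x)
    (Kgt0 : forall i t, 0 < K i t 0)
    (Kint : forall i t,
      (\int[lebesgue_tuple n]_y (K i t (row_of_tuple y))%:E = 1)%E)
    (* (b) *)
    (gC : C00_1 Omega g)
    (gcoop : forall t x u, 0 <= t -> closure Omega x -> order_interval v u ->
      cooperative (dmx (g t x) u) /\ irreducible (dmx (g t x) u))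
    (g0 : forall t x, closure Omega x -> g t x 0 = 0)
    (gv : forall t x u i, closure Omega x -> order_interval v u ->
      u i 0 = v i 0 -> g t x u i 0 <= 0)
    (* (c) *)
    (gsub : forall t x u alpha, 0 <= t -> closure Omega x ->
      order_interval v u -> vll 0 u -> 0 < alpha -> alpha < 1 ->
      vlt (alpha *: g t x u) (g t x (alpha *: u)))
    (* (d) *)
    (Kper : forall i t x, K i (t + T) x = K i t x)
    (gper : forall t x u, closure Omega x -> g (t + T) x u = g t x u) :
  [/\ (omega_Phi Omega K d g < 0)%E ->
        globally_asymptotically_stable Omega K d g
          (X_interval Omega v) (fun _ _ => 0),
      omega_Phi Omega K d g = 0%E ->
        (forall t x u alpha, 0 <= t -> closure Omega x ->
           order_interval v u -> vll 0 u -> 0 < alpha -> alpha < 1 ->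
           vll (alpha *: g t x u) (g t x (alpha *: u))) \/
        has_positive_eigenfunction Omega K d g T 0 ->
        globally_asymptotically_stable Omega K d g
          (X_interval Omega v) (fun _ _ => 0) &
      (0 < omega_Phi Omega K d g)%E ->
        forall w, unique_positive_periodic_solution Omega K d v g T w ->
          C_per_cone_interior Omega T w ->
          globally_asymptotically_stable Omega K d g
            [set phi | X_interval Omega v phi /\
               exists2 x, closure Omega x & phi x <> 0] w].
Proof.
have [oOmega cOmega neOmega] := hdom; split.
- exact: (stable_of_negative_growth oOmega hbnd hd hv Kcont Kge0 Kint gC gcoop g0 gv gsub).
- exact: (stable_of_zero_growth oOmega hbnd hd hv Kcont Kge0 Kint gC gcoop g0 gv gsub hT
    Kper gper cOmega neOmega Kgt0).
- move=> _ w; exact: (positive_solution_stable oOmega hbnd hd hv Kcont Kge0 Kint gC gcoop g0 gv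
    gsub hT Kper gper cOmega Kgt0).
Qed.
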